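(* Let $K$ be a field and $f\in K(x)$ a rational function of degree $d\ge2$ such that either $\mathrm{char}(K)=0$ or $\mathrm{char}(K)$ does not divide the local degree of any critical point of $f$. Let $t$ be transcendental over $K$ and $G:=G_\infty(K^{\mathrm{sep}},f,t)$. Assume that (i) the fixed-point process $\{X_n\}_{n\ge1}$ of $G$ is a martingale, and (ii) $\#\Upsilon_f\le1$. Then $G$ (acting on the standard tree $T$ via a labeling as described in the context) is mixing.
   Context: Let $L:=K^{\mathrm{sep}}$ (separably closed). Geometric iterated Galois group: fix a separable closure $L(t)^{\mathrm{sep}}$; $f^{-n}(t)$ is the set of $s$ with $f^n(s)=t$; the tree of preimages $T_t$ has vertices $\bigsqcup_{n\ge0}f^{-n}(t)$, root $t$, $s$ adjacent to $f(s)$. $K_\infty(f,t)=L(t)(\bigcup_nf^{-n}(t))$ and $G=\mathrm{Gal}(K_\infty(f,t)/L(t))$, a closed subgroup of $\mathrm{Aut}(T_t)$. Labeling: let $X=\{1,\dots,d\}$, fix a bijection $i\mapsto t_i$ from $X$ to $f^{-1}(t)$ and $L$-isomorphisms $\lambda_i$ from $L(t)^{\mathrm{sep}}$ to a separable closure of $L(t_i)$ with $\lambda_i(t)=t_i$. Define $\phi:T_t\to T$ (the tree of words over $X$) by $\phi(t)=\emptyset$ and, for $s\in f^{-(n+1)}(t)$ with $f^n(s)=t_i$, $\phi(s)=i\,\phi(\lambda_i^{-1}(s))$. Via $\phi$, $G$ is regarded as a subgroup of $\mathrm{Aut}(T)$. Tree notation on $T$: sections $g|_v$ (unique element with $(vw)^g=v^gw^{g|_v}$),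 $\pi_m$ restriction to first $m$ levels, $g|_v^m=\pi_m(g|_v)$, stabilizers $\mathrm{st}_H(v)$, level stabilizers $\mathrm{St}_H(n)$, and $H_v^m=\{h|_v^m:h\in\mathrm{st}_H(v)\}$, $H_v=\{h|_v: h\in\mathrm{st}_H(v)\}$. $G$ is fractal if $g|_v\in G$ always, $G$ is transitive on each level, and $G_v=G$ for all $v$. A fractal $G$ is mixing if (a) for every $n$, every $u$ at level $n$ and every $k\ge1$, $\mathrm{St}_G(n)$ acts transitively on $\{uw:|w|=k\}$; (b) for all $n,m\ge1$ there is $N(m)\ge0$ with $\mathrm{St}_G(n)_v^m=\pi_m(G)$ for all $v$ with $|v|\ge n+N(m)$. Fixed-point process: on $(G,\mu_G)$ with $\mu_G$ normalized Haar measure, $X_n(g)$ is the number of level-$n$ vertices fixed by $g$; it is a martingale if $\mathbb E(X_n)<\infty$ and $\mathbb E(X_{n+1}\mid X_1=t_1,\dots,X_n=t_n)=t_n$ whenever the conditioning event has positive measure. Critical points: $e_f(z)$ is the local degree at $z\in\mathbb{P}^1_L$; $C_f=\{z:e_f(z)\ge2\}$; $P_f=\bigcup_{n\ge1}f^n(C_f)$. A set $\Upsilon\subseteq P_f$ is critically exceptional if $\Upsilon=f^{-1}(\Upsilon)\setminus((C_f\cup P_f)\setminus\Upsilon)$; $\Upsilon_f$ denotes the maximal critically exceptional set (the union of all of them). *)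

(* Defs.v *)
From HB Require Import structures.
From mathcomp Require Import all_boot all_order all_algebra all_field.
From mathcomp Require Import all_classical all_reals all_analysis.

Set Implicit Arguments.
Unset Strict Implicit.
Unset Printing Implicit Defensive.

Import Order.TTheory GRing.Theory Num.Theory.
Local Open Scope classical_set_scope.
Local Open Scope ring_scope.

(** * Closures of fields *)

Definition is_sep_closure (F E : fieldType) (i : {rmorphism F -> E}) : Prop :=
  (forall x : E, exists2 p : {poly F},
     separable_poly p & root (map_poly i p) x) /\
  (forall p : {poly E}, separable_poly p -> (1 < size p)%N ->
     exists x : E, root p x).

Definition is_alg_closure (F E : fieldType) (i : {rmorphism F -> E}) : Prop :=
  (forall x : E, algebraicOver i x) /\ GRing.closed_field_axiom E.

(** * Rational functions acting on the projective line *)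

(* [Some a] is the affine point [a : 1], [None] is the point at infinity. *)
Definition P1 (F : Type) : Type := option F.

(* Coprime numerator and denominator; they are determined by [f] up to a
   common nonzero scalar, on which nothing below depends. *)
Definition numer (K : fieldType) (f : {fraction {poly K}}) : {poly K} :=
  let r := frac (repr f) in r.1 %/ gcdp r.1 r.2.

Definition denom (K : fieldType) (f : {fraction {poly K}}) : {poly K} :=
  let r := frac (repr f) in r.2 %/ gcdp r.1 r.2.

Definition pair_degree (F : fieldType) (p q : {poly F}) : nat :=
  maxn (size p).-1 (size q).-1.

Definition ratdeg (K : fieldType) (f : {fraction {poly K}}) : nat :=
  pair_degree (numer f) (denom f).

(* The map [x : y] |-> [p : q] in homogeneous form, for [p], [q] coprime; the
   value at infinity is given by the coefficients of top degree. *)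
Definition P1map (F : fieldType) (p q : {poly F}) (z : P1 F) : P1 F :=
  let d := pair_degree p q in
  let: (a, b) :=
    if z is Some x then (p.[x], q.[x]) else (p`_d, q`_d) in
  if b == 0 then None else Some (a / b).

(* The fibre of [p / q] over [w], as a binary form of degree [pair_degree p q]
   written in the affine coordinate; its defect in degree is the order of
   vanishing at infinity. *)
Definition fiber_poly (F : fieldType) (p q : {poly F}) (w : P1 F) : {poly F} :=
  if w is Some b then p - b *: q else q.

Definition pair_local_degree (F : fieldType) (p q : {poly F}) (z : P1 F) : nat :=
  let h := fiber_poly p q (P1map p q z) in
  if z is Some a then mup a h else (pair_degree p q - (size h).-1)%N.

Definition ratmap (K F : fieldType) (i : K -> F) (f : {fraction {poly K}}) :
    P1 F -> P1 F :=
  P1map (map_poly i (numer f)) (map_poly i (denom f)).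

Definition local_degree (K F : fieldType) (i : K -> F)
    (f : {fraction {poly K}}) : P1 F -> nat :=
  pair_local_degree (map_poly i (numer f)) (map_poly i (denom f)).

(** * Critical points and critically exceptional sets *)

(* Here [F] is meant to be an algebraic closure of the separably closed base
   field [L].  As [F / L] is purely inseparable, points of [P1 F] are the closed
   points of the projective line over [L]; [P1 L] alone would miss the critical
   points that are inseparable over [L]. *)

Definition crit (K F : fieldType) (i : K -> F) (f : {fraction {poly K}}) :
    set (P1 F) :=
  [set z | (2 <= local_degree i f z)%N].

Definition postcrit (K F : fieldType) (i : K -> F) (f : {fraction {poly K}}) :
    set (P1 F) :=
  \bigcup_(n in [set n | (1 <= n)%N]) (iter n (ratmap i f) @` crit i f).

Definition crit_exceptional (K F : fieldType) (i : K -> F)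
    (f : {fraction {poly K}}) (Y : set (P1 F)) : Prop :=
  Y `<=` postcrit i f /\
  Y = (ratmap i f @^-1` Y) `\` ((crit i f `|` postcrit i f) `\` Y).

Definition Upsilon (K F : fieldType) (i : K -> F) (f : {fraction {poly K}}) :
    set (P1 F) :=
  \bigcup_(Y in [set Y | crit_exceptional i f Y]) Y.

(** * The tree of words and its automorphisms *)

Definition word (d : nat) : Type := seq 'I_d.

Definition adjacent (d : nat) (u v : word d) : Prop :=
  (exists x, v = rcons u x) \/ (exists x, u = rcons v x).

Definition tree_aut (d : nat) (g : word d -> word d) : Prop :=
  [/\ bijective g, g [::] = [::] &
      forall u v, adjacent (g u) (g v) <-> adjacent u v].

(* [g (v ++ w) = g v ++ section g v w] for a tree automorphism [g]. *)
Definition section (d : nat) (g : word d -> word d) (v : word d) :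
    word d -> word d :=
  fun w => drop (size v) (g (v ++ w)).

Definition pi_level (d m : nat) (g : word d -> word d) :
    m.-bseq 'I_d -> word d :=
  fun w => g w.
Arguments pi_level {d} m g w.

Definition stab (d : nat) (H : set (word d -> word d)) (v : word d) :
    set (word d -> word d) :=
  [set h | H h /\ h v = v].

Definition level_stab (d : nat) (H : set (word d -> word d)) (n : nat) :
    set (word d -> word d) :=
  [set h | H h /\ forall v : word d, size v = n -> h v = v].

Definition sections_at (d : nat) (H : set (word d -> word d)) (v : word d) :
    set (word d -> word d) :=
  [set section h v | h in stab H v].

Definition sections_at_level (d : nat) (H : set (word d -> word d))
    (v : word d) (m : nat) : set (m.-bseq 'I_d -> word d) :=
  [set pi_level m (section h v) | h in stab H v].
Arguments sections_at_level {d} H v m.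

Definition fractal (d : nat) (G : set (word d -> word d)) : Prop :=
  [/\ forall g v, G g -> G (section g v),
      forall u v : word d, size u = size v -> exists2 g, G g & g u = v &
      forall v, sections_at G v = G].

(* The bound [N m] depends on [m] only. *)
Definition mixing (d : nat) (G : set (word d -> word d)) : Prop :=
  [/\ fractal G,
      forall (n : nat) (u : word d), size u = n ->
        forall k : nat, (1 <= k)%N ->
        forall w w' : word d, size w = k -> size w' = k ->
          exists2 g, level_stab G n g & g (u ++ w) = u ++ w' &
      exists N : nat -> nat,
        forall n m : nat, (1 <= n)%N -> (1 <= m)%N ->
        forall v : word d, (n + N m <= size v)%N ->
          sections_at_level (level_stab G n) v m = [set pi_level m g | g in G]].

(** * Haar measure and the fixed-point process *)

(* The proof [G1] only serves to make the type pointed. *)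
Definition elements (d : nat) (G : set (word d -> word d)) (G1 : G id) : Type :=
  {g : word d -> word d | G g}.

HB.instance Definition _ (d : nat) (G : set (word d -> word d)) (G1 : G id) := gen_eqMixin (@elements d G G1).
HB.instance Definition _ (d : nat) (G : set (word d -> word d)) (G1 : G id) := gen_choiceMixin (@elements d G G1).
HB.instance Definition _ (d : nat) (G : set (word d -> word d)) (G1 : G id) :=
  isPointed.Build (@elements d G G1) (exist _ id G1).

(* The profinite topology: the cosets of the level stabilizers form a basis. *)
Definition group_open (d : nat) (G : set (word d -> word d)) (G1 : G id) :
    set (set (elements G1)) :=
  [set U | forall g, U g -> exists n, forall h : elements G1,
     pi_level n (sval h) = pi_level n (sval g) -> U h].

Definition borel_group (d : nat) (G : set (word d -> word d)) (G1 : G id) :=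
  g_sigma_algebraType (group_open (G1 := G1)).

HB.instance Definition _ (d : nat) (G : set (word d -> word d)) (G1 : G id) := Measurable.on (@borel_group d G G1).

(* Automorphisms act on the right, so [g * a] is the function [a \o g]. *)
Definition is_haar (R : realType) (d : nat) (G : set (word d -> word d))
    (G1 : G id) (mu : probability (borel_group G1) R) : Prop :=
  forall (g : borel_group G1) (A : set (borel_group G1)), measurable A ->
    mu [set h | exists2 a, A a & sval h = sval a \o sval g] = mu A.

Definition fixed_points (R : realType) (d : nat) (G : set (word d -> word d))
    (G1 : G id) (n : nat) (g : borel_group G1) : R :=
  #|[set w : n.-tuple 'I_d | sval g w == w :> word d]|%:R.

Definition cond_expectation (R : realType) (disp : measure_display)
    (T : measurableType disp) (mu : probability T R) (Y : T -> R) (A : set T) :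
    \bar R :=
  (\int[mu]_(x in A) (Y x)%:E * (mu A)^-1)%E.

Definition is_martingale (R : realType) (disp : measure_display)
    (T : measurableType disp) (mu : probability T R) (X : nat -> T -> R) :
    Prop :=
  (forall n, (1 <= n)%N -> ('E_mu[X n] < +oo)%E) /\
  (forall (n : nat) (a : nat -> R), (1 <= n)%N ->
     let A := [set x | forall i, (1 <= i <= n)%N -> X i x = a i] in
     (0 < mu A)%E -> cond_expectation mu (X n.+1) A = (a n)%:E).

(** * Subfields generated by a set *)

Definition gen_subfield (M : fieldType) (S : set M) : {pred M} :=
  fun x => `[< forall k : {pred M},
    GRing.divring_closed k -> (forall y, S y -> y \in k) -> x \in k >].

Lemma gen_subfield_divring_closed (M : fieldType) (S : set M) :
  GRing.divring_closed (gen_subfield S).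
Proof.
split.
- by apply/asboolP => k [k1 _ _] _.
- move=> x y /asboolP xS /asboolP yS; apply/asboolP => k kc kS.
  by have [_ kB _] := kc; apply: kB; [exact: xS | exact: yS].
- move=> x y /asboolP xS /asboolP yS; apply/asboolP => k kc kS.
  by have [_ _ kV] := kc; apply: kV; [exact: xS | exact: yS].
Qed.

HB.instance Definition _ (M : fieldType) (S : set M) :=
  GRing.isDivringClosed.Build M (gen_subfield S)
    (gen_subfield_divring_closed S).

Definition subfield_of (M : fieldType) (S : set M) : Type :=
  {x : M | x \in gen_subfield S}.

HB.instance Definition _ (M : fieldType) (S : set M) :=
  SubType.on (@subfield_of M S).
HB.instance Definition _ (M : fieldType) (S : set M) :=
  Choice.on (@subfield_of M S).
HB.instance Definition _ (M : fieldType) (S : set M) :=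
  [SubChoice_isSubComUnitRing of @subfield_of M S by <:].
HB.instance Definition _ (M : fieldType) (S : set M) :=
  [SubComUnitRing_isSubIntegralDomain of @subfield_of M S by <:].
HB.instance Definition _ (M : fieldType) (S : set M) :=
  [SubIntegralDomain_isSubField of @subfield_of M S by <:].

(** * The geometric iterated Galois group *)

(* Throughout, [M] is a separable closure of [L(t)], with [t] the variable. *)

Definition const_emb (K L M : fieldType) (i : {rmorphism K -> L})
    (j : {rmorphism {fraction {poly L}} -> M}) (c : K) : M :=
  j (tofrac (i c)%:P).

Definition tvar (L M : fieldType) (j : {rmorphism {fraction {poly L}} -> M}) :
    M :=
  j (tofrac 'X).

Definition preimages (K L M : fieldType) (f : {fraction {poly K}})
    (i : {rmorphism K -> L}) (j : {rmorphism {fraction {poly L}} -> M})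
    (n : nat) (x : M) : set M :=
  [set s | iter n (ratmap (const_emb i j) f) (Some s) = Some x].

Definition K_infty (K L M : fieldType) (f : {fraction {poly K}})
    (i : {rmorphism K -> L}) (j : {rmorphism {fraction {poly L}} -> M}) :
    fieldType :=
  subfield_of
    (range j `|` \bigcup_(n in [set: nat]) preimages f i j n (tvar j)).

Definition gal_K_infty (K L M : fieldType) (f : {fraction {poly K}})
    (i : {rmorphism K -> L}) (j : {rmorphism {fraction {poly L}} -> M}) :
    set {rmorphism K_infty f i j -> K_infty f i j} :=
  [set sigma : {rmorphism K_infty f i j -> K_infty f i j} | bijective sigma /\
     forall (a : {fraction {poly L}}) (x : K_infty f i j),
       \val x = j a -> sigma x = x].

(* As [M] is algebraic and separable over each [L(t_i)], it is a separable
   closure of [L(t_i)], and the isomorphisms are self-maps of [M]. *)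
Record labeling (K L M : fieldType) (f : {fraction {poly K}})
    (i : {rmorphism K -> L}) (j : {rmorphism {fraction {poly L}} -> M}) :=
  Labeling {
    lab_pt : 'I_(ratdeg f) -> M;
    lab_pt_bij : set_bij [set: 'I_(ratdeg f)]
                   (preimages f i j 1 (tvar j)) lab_pt;
    lab_iso : 'I_(ratdeg f) -> {rmorphism M -> M};
    lab_inv : 'I_(ratdeg f) -> M -> M;
    lab_isoK : forall x, cancel (lab_iso x) (lab_inv x);
    lab_invK : forall x, cancel (lab_inv x) (lab_iso x);
    lab_iso_const : forall x (c : L),
      lab_iso x (j (tofrac c%:P)) = j (tofrac c%:P);
    lab_iso_t : forall x, lab_iso x (tvar j) = lab_pt x
  }.

(* [lab_word lam n s] is the word attached to the vertex [s] of level [n]. *)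
Fixpoint lab_word (K L M : fieldType) (f : {fraction {poly K}})
    (i : {rmorphism K -> L}) (j : {rmorphism {fraction {poly L}} -> M})
    (lam : labeling f i j) (n : nat) (s : M) : word (ratdeg f) :=
  if n is n'.+1 then
    if [pick x | `[< preimages f i j n' (lab_pt lam x) s >]] is Some x
    then x :: lab_word lam n' (lab_inv lam x s)
    else [::]
  else [::].

Definition G_infty (K L M : fieldType) (f : {fraction {poly K}})
    (i : {rmorphism K -> L}) (j : {rmorphism {fraction {poly L}} -> M})
    (lam : labeling f i j) : set (word (ratdeg f) -> word (ratdeg f)) :=
  [set g | tree_aut g /\ exists2 sigma, @gal_K_infty K L M f i j sigma &
     forall (n : nat) (s : K_infty f i j),
       preimages f i j n (tvar j) (\val s) ->
       g (lab_word lam n (\val s)) = lab_word lam n (\val (sigma s))].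

Lemma G_infty_id (K L M : fieldType) (f : {fraction {poly K}})
    (i : {rmorphism K -> L}) (j : {rmorphism {fraction {poly L}} -> M})
    (lam : labeling f i j) : G_infty lam id.
Proof.
split; first by split=> //; exists id.
by exists (idfun : {rmorphism K_infty f i j -> K_infty f i j}); last by [].
Qed.

(* Main.v *)
(* [G] acts on words as the Galois group of [M / L(t)] acts on the iterated preimages of [t];
   conjugation by the labeling isomorphisms makes it fractal.

   On the event [St_G(n)] the martingale property says that the expected number of fixed
   children of a level-[n] vertex is one; by invariance of the measure this is the number of
   orbits of [St_G(n)] on these children, whence condition (a).

   For (b), fix [v] and let [H] be the normal subgroup of those [g] in [G] that agree down to
   level [m] with the section at [v] of an element of [St_G(n)].  At a point [z] of the [t]-line
   embed the preimages of [t] into Laurent series in [x], with [x^e] a local parameter: by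
   tameness a suitable [e] works, and rotating [x] by an [e]-th root of unity is induced by an
   inertia automorphism [s].  If [z] is not exceptional, some [y] with [f^k(y) = f^k(z)] is
   unramified under all [f^i], [i <= m], and [s] fixes the tree of height [m] above a point [s']
   over [y].  The commutator of a lift of [s] with an element of [St_G(n)] provided by (a) then
   shows that [s] lies in [H].  Hence the fixed field of [H] in the level-[m] field is a cover of
   the line unramified outside a single point and tame there, so it is trivial.  The latter is
   proved on a lattice of functions on the cover, integral away from that point and of minimal
   degree at it: minimality makes its discriminant constant, and then all functions involved
   are constant. *)

Require Import Defs.
From HB Require Import structures.
From mathcomp Require Import all_boot all_order all_algebra all_field.
From mathcomp Require Import all_classical all_reals all_analysis.
From mathcomp Require Import perm measurable_realfun zify ring.
From mathcomp Require cyclic.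

Set Implicit Arguments.
Unset Strict Implicit.
Unset Printing Implicit Defensive.

Import Order.TTheory GRing.Theory Num.Theory.
Local Open Scope classical_set_scope.
Local Open Scope ring_scope.

(** * Morphisms and partial isomorphisms of fields *)

(** The geometry lives over the algebraic closure [Om] of [L], the Galois theory over [L(t)]. In
    positive characteristic these differ by purely inseparable extensions, so functions are raised
    to a power [q] of the characteristic to bring them down to [L(t)]; [q]-th powers are additive
    and injective, hence nothing is lost.

    Places of [M] are maximal partial isomorphisms between [M] and Laurent series over the expansion
    of [L(t)] at [z]. Since fibres split by Hensel's lemma, such an isomorphism reaches all of the
    tree that matters.

    The point [y] differs from [z] in general and is invisible in the tree over [t]. The tree is
    therefore rooted at [f^k(t)], of which [t] and [s'] are both preimages, and is used to height
    [m + k]. This gives the exponent [m + J] in the choice of [e], and [N(m) = J], a bound on [k]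
    that is uniform because all but finitely many [z] need only [k = 0]. Besides, the local degree
    of [f^k] at [y] must divide the one at [z], so that the multiplicity left over [y] is a multiple
    of [e].

    A commutator enters because a lift of [s] does not fix level [n], whereas [St_G(n)] is normal in
    [G]. *)

Section MakeMorphism.
Variables (R S : nzRingType) (g : R -> S).
Hypotheses (gB : zmod_morphism g) (gM : monoid_morphism g).
(** The proofs are arguments so that the instances below can be found by unification on
    [mk_rmorphism]. *)
Definition mk_rmorphism (_ : zmod_morphism g) (_ : monoid_morphism g) : R -> S := g.
Local Notation h := (mk_rmorphism gB gM).
HB.instance Definition _ := GRing.isZmodMorphism.Build R S h gB.
HB.instance Definition _ := GRing.isMonoidMorphism.Build R S h gM.
Lemma rmorphism_exists : exists h : {rmorphism R -> S}, h =1 g.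
Proof. by exists h. Qed.
End MakeMorphism.

Lemma frac_numden (R : idomainType) (x : {fraction R}) :
  exists a b : R, b != 0 /\ x = tofrac a / tofrac b.
Proof.
elim/quotW: x => -[[a b] /= b0]; exists a, b; split=> //.
have hb : tofrac b != 0 :> {fraction R} by rewrite tofrac_eq0.
apply: (mulIf hb); rewrite divfK // [LHS]/GRing.mul /= !piE.
apply/eqmodP; rewrite /= FracField.equivfE /FracField.mulf.
by rewrite !numden_Ratio ?oner_eq0 ?mulr1 ?b0 //= mulrC.
Qed.

Lemma frac_lift (R : idomainType) (E : fieldType) (g : {rmorphism R -> E}) :
  injective g ->
  exists h : {rmorphism {fraction R} -> E}, forall a, h (tofrac a) = g a.
Proof.
move=> gI.
have g0 b : b != 0 -> g b != 0 by rewrite -(inj_eq gI) rmorph0.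
have tf0 (b : R) : b != 0 -> tofrac b != 0 :> {fraction R} by rewrite tofrac_eq0.
pose P (x : {fraction R}) (y : E) :=
  exists a b : R, [/\ b != 0, x = tofrac a / tofrac b & y = g a / g b].
have PU x y z : P x y -> P x z -> y = z.
  move=> [a [b [b0 -> ->]]] [c [e [e0 h ->]]].
  have {}h : a * e = c * b.
    apply/eqP; rewrite -tofrac_eq !tofracM; apply/eqP.
    by apply/eqP; rewrite -eqr_div ?tf0 // h.
  by apply/eqP; rewrite eqr_div ?g0 // -!rmorphM h.
have Pex x : exists y, P x y.
  have [a [b [b0 ->]]] := frac_numden x.
  by exists (g a / g b), a, b.
have [h hP] := choice Pex.
have hE x y : P x y -> h x = y by move=> /(PU _ _ _ (hP x)).
have hB : zmod_morphism h.
  move=> x y; have [a [b [b0 -> hx]]] := hP x; have [c [e [e0 -> hy]]] := hP y.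
  rewrite hx hy; apply: hE; exists (a * e - c * b), (b * e).
  split; first by rewrite mulf_neq0.
  - by rewrite -mulNr addf_div ?tf0 // mulNr tofracB !tofracM.
  - by rewrite -mulNr addf_div ?g0 // mulNr rmorphB !rmorphM.
have hM : monoid_morphism h.
  split; first by apply: hE; exists 1, 1; rewrite oner_eq0 tofrac1 rmorph1 !divr1.
  move=> x y; have [a [b [b0 -> hx]]] := hP x; have [c [e [e0 -> hy]]] := hP y.
  rewrite hx hy; apply: hE; exists (a * c), (b * e).
  by rewrite mulf_neq0 // !mulf_div !tofracM !rmorphM.
have [k kE] := rmorphism_exists hB hM.
exists k => a; rewrite kE; apply: hE; exists a, 1.
by rewrite oner_eq0 tofrac1 rmorph1 !divr1.
Qed.

(** Maps chosen pointwise are turned into morphisms here: [g] is injective, so every identity may be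
    checked after applying it. *)
Lemma rmorph_factor (k D E : fieldType) (i : {rmorphism k -> E})
    (g : {rmorphism D -> E}) :
  (forall c, exists b, g b = i c) ->
  exists h : {rmorphism k -> D}, forall c, g (h c) = i c.
Proof.
move=> /choice[h hE].
have gI := fmorph_inj g.
have hB : zmod_morphism h by move=> x y; apply: gI; rewrite rmorphB !hE rmorphB.
have hM : monoid_morphism h.
  split; first by apply: gI; rewrite hE !rmorph1.
  by move=> x y; apply: gI; rewrite rmorphM !hE rmorphM.
have [f fE] := rmorphism_exists hB hM.
by exists f => c; rewrite fE.
Qed.

(* A partial isomorphism between two fields, encoded by its graph. *)
Definition field_graph (E1 E2 : fieldType) (H : set (E1 * E2)) : Prop :=
  [/\ H (1, 1),
      forall u v, H u -> H v -> H (u.1 - v.1, u.2 - v.2),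
      forall u v, H u -> H v -> H (u.1 / v.1, u.2 / v.2) &
      forall y, H (0, y) -> y = 0].

Section Graph.
Variables (E1 E2 : fieldType) (H : set (E1 * E2)) (gH : field_graph H).

Definition graph_dom (_ : field_graph H) : {pred E1} :=
  fun x => `[< exists y, H (x, y) >].

Lemma graph_dom_divring_closed : GRing.divring_closed (graph_dom gH).
Proof.
have [H1 HB HV _] := gH; split.
- by apply/asboolP; exists 1.
- move=> x y /asboolP[a Ha] /asboolP[b Hb]; apply/asboolP.
  by exists (a - b); exact: (HB _ _ Ha Hb).
- move=> x y /asboolP[a Ha] /asboolP[b Hb]; apply/asboolP.
  by exists (a / b); exact: (HV _ _ Ha Hb).
Qed.

HB.instance Definition _ :=
  GRing.isDivringClosed.Build E1 (graph_dom gH) graph_dom_divring_closed.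

Definition graph_type (_ : field_graph H) : Type := {x : E1 | x \in graph_dom gH}.
Local Notation D := (graph_type gH).
HB.instance Definition _ := SubType.on D.
HB.instance Definition _ := Choice.on D.
HB.instance Definition _ := [SubChoice_isSubComUnitRing of D by <:].
HB.instance Definition _ := [SubComUnitRing_isSubIntegralDomain of D by <:].
HB.instance Definition _ := [SubIntegralDomain_isSubField of D by <:].

Lemma graph_fun x y z : H (x, y) -> H (x, z) -> y = z.
Proof.
have [_ HB _ H0] := gH => Hy Hz; apply/subr0_eq/H0.
by have := HB _ _ Hy Hz; rewrite /= subrr.
Qed.

(** The graph becomes a field of its own, namely its domain, so that polynomials over it and further
    extension steps make sense. *)
Lemma graph_embeddings :
  exists (D : fieldType) (k1 : {rmorphism D -> E1}) (k2 : {rmorphism D -> E2}),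
    forall u, H u <-> exists b, u = (k1 b, k2 b).
Proof.
have ex (b : D) : exists y, H (\val b, y) by have /asboolP := valP b.
have [f fP] := choice ex.
have fE (b : D) y : H (\val b, y) -> f b = y by move=> /(graph_fun (fP b)).
have [H1 HB HV _] := gH.
have HM u v : H u -> H v -> H (u.1 * v.1, u.2 * v.2).
  move=> Hu Hv; have := HV _ _ Hu (HV _ _ H1 Hv).
  by rewrite /= !div1r !invrK.
have fB : zmod_morphism f.
  by move=> x y; apply: fE; rewrite rmorphB; exact: (HB _ _ (fP x) (fP y)).
have fM : monoid_morphism f.
  split; first by apply: fE; rewrite rmorph1.
  by move=> x y; apply: fE; rewrite rmorphM; exact: (HM _ _ (fP x) (fP y)).
have [k kE] := rmorphism_exists fB fM.
exists (D : fieldType), (\val : {rmorphism D -> E1}), k => -[x y]; split.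
  move=> Hxy; have dx : x \in graph_dom gH by apply/asboolP; exists y.
  by exists (exist _ x dx); rewrite kE (fE _ y).
by move=> [b [-> ->]]; rewrite kE; exact: fP.
Qed.

End Graph.

Lemma range_field_graph (D E1 E2 : fieldType) (k1 : {rmorphism D -> E1})
  (k2 : {rmorphism D -> E2}) : field_graph (range (fun b => (k1 b, k2 b))).
Proof.
split.
- by exists 1; rewrite ?rmorph1.
- by move=> _ _ [a _ <-] [b _ <-]; exists (a - b); rewrite //= !rmorphB.
- by move=> _ _ [a _ <-] [b _ <-]; exists (a / b); rewrite //= !fmorph_div.
- by move=> y [b _ [/eqP]]; rewrite fmorph_eq0 => /eqP-> <-; rewrite rmorph0.
Qed.

Lemma min_annihilator (D E : fieldType) (k : {rmorphism D -> E}) (x : E)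
    (P : {poly D}) : P != 0 -> root (map_poly k P) x ->
  exists m : {poly D}, [/\ (1 < size m)%N, root (map_poly k m) x &
    forall g, root (map_poly k g) x -> m %| g].
Proof.
move=> P0 Px.
pose A (n : nat) := `[< exists m : {poly D}, [/\ m != 0, root (map_poly k m) x & size m = n] >].
have exA : exists n, A n by exists (size P); apply/asboolP; exists P.
have [n /asboolP[m [m0 mx sm]] nmin] := ex_minnP exA.
exists m; split=> // [|g gx].
  rewrite ltnNge; apply/negP => /size1_polyC mE; move: mx m0.
  by rewrite mE map_polyC /= rootE hornerC fmorph_eq0 polyC_eq0 => ->.
apply/modp_eq0P/eqP/contraT => r0.
have /nmin : A (size (g %% m)).
  apply/asboolP; exists (g %% m); split=> //; move: gx mx.
  rewrite {1}(divp_eq g m) rmorphD rmorphM /= !rootE hornerD hornerM.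
  by move=> + /eqP mx; rewrite mx mulr0 add0r.
by rewrite leqNgt -sm ltn_modp m0.
Qed.

(** [m] is the minimal polynomial of [x] over [D], so sending [x] to a root [y] is a partial
    isomorphism. Only quotients need an argument: a denominator that does not vanish at [x] is
    coprime to [m] and has a Bezout inverse modulo [m]. *)
Lemma adjoin_root (D E1 E2 : fieldType) (k1 : {rmorphism D -> E1})
    (k2 : {rmorphism D -> E2}) (x : E1) (y : E2) (m : {poly D}) :
  m != 0 -> root (map_poly k1 m) x -> root (map_poly k2 m) y ->
  (forall g, root (map_poly k1 g) x -> m %| g) ->
  field_graph (range (fun g : {poly D} => ((map_poly k1 g).[x], (map_poly k2 g).[y]))).
Proof.
move=> m0 mx my mmin; split.
- by exists 1; rewrite // !rmorph1 !hornerC.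
- by move=> _ _ [g _ <-] [h _ <-]; exists (g - h); rewrite //= !rmorphB !hornerE.
- move=> _ _ [g _ <-] [h _ <-] /=.
  (* The inverse of zero is zero, and [m] divides [h], so both quotients vanish. *)
  have [hx0|hx0] := boolP (root (map_poly k1 h) x).
    exists 0; rewrite // !rmorph0 !horner0; move: (hx0); rewrite rootE => /eqP->.
    have /dvdpP[q ->] := mmin _ hx0.
    by rewrite rmorphM hornerM (eqP my) mulr0 !invr0 !mulr0.
  have /Bezout_eq1_coprimepP[[u v] /= uv] : coprimep h m.
    have /dvdpP[q qE] := dvdp_gcdr h m.
    have := mx; rewrite {1}qE rmorphM rootM => /orP[qx|gx]; last first.
      have /dvdpP[r rE] := dvdp_gcdl h m.
      by move: hx0; rewrite rE rmorphM rootM gx orbT.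
    have := mmin _ qx; rewrite {1}qE => dq.
    have q0 : q != 0 by apply: contraNneq m0 => q0; rewrite qE q0 mul0r.
    by rewrite coprimep_def -dvdp1 -(dvdp_mul2l _ _ q0) mulr1.
  have inv (E : fieldType) (k : {rmorphism D -> E}) z : root (map_poly k m) z ->
      (map_poly k h).[z]^-1 = (map_poly k u).[z].
    move=> /eqP mz; have := congr1 (fun p => (map_poly k p).[z]) uv.
    rewrite rmorphD !rmorphM rmorph1 /= hornerD !hornerM mz mulr0 addr0 hornerC.
    by move=> uh; apply: (mulIf (x := (map_poly k h).[z]));
      [apply: contra_eq_neq uh => ->; rewrite mulr0 eq_sym oner_eq0|
       rewrite uh mulVf //; apply: contra_eq_neq uh => ->; rewrite mulr0 eq_sym oner_eq0].
  by exists (g * u) => //; rewrite !rmorphM !hornerM !inv.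
- by move=> z [g _ [gx <-]]; have /dvdpP[q ->] : m %| g;
    [apply: mmin; rewrite rootE gx | rewrite rmorphM hornerM (eqP my) mulr0].
Qed.

Lemma embedding_adjoin (D E1 E2 : fieldType) (k1 : {rmorphism D -> E1})
    (k2 : {rmorphism D -> E2}) (x : E1) (y : E2) (m : {poly D}) :
  m != 0 -> root (map_poly k1 m) x -> root (map_poly k2 m) y ->
  (forall g, root (map_poly k1 g) x -> m %| g) ->
  exists (D' : fieldType) (i : {rmorphism D -> D'}) (j1 : {rmorphism D' -> E1})
         (j2 : {rmorphism D' -> E2}) (b : D'),
    [/\ forall c, j1 (i c) = k1 c, forall c, j2 (i c) = k2 c, j1 b = x & j2 b = y].
Proof.
move=> m0 mx my mmin; have gH := adjoin_root m0 mx my mmin.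
have [D' [j1 [j2 jP]]] := graph_embeddings gH.
have ex c : exists b, j1 b = k1 c.
  have [|b [-> _]] := (jP (k1 c, k2 c)).1; last by exists b.
  by exists c%:P; rewrite //= !map_polyC !hornerC.
have [i iE] := rmorph_factor ex.
have [|b [-> ->]] := (jP (x, y)).1.
  by exists 'X; rewrite //= !map_polyX !hornerX.
exists D', i, j1, j2, b; split=> // c.
have [|b' [bE ->]] := (jP (k1 c, k2 c)).1.
  by exists c%:P; rewrite //= !map_polyC !hornerC.
by congr (j2 _); apply: (fmorph_inj j1); rewrite iE -bE.
Qed.

(** Zorn's lemma gives a maximal partial isomorphism between [E1] and [E2] over [k]. The last clause
    is what maximality is used for: an element that is algebraic over [D] through a polynomial
    splitting on the side of [E2] already lies in [D]. With [E2 = M] this extends automorphisms;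
    with Laurent series it yields places. *)
Lemma embedding_extension (k E1 E2 : fieldType) (i1 : {rmorphism k -> E1})
    (i2 : {rmorphism k -> E2}) :
  exists (D : fieldType) (i : {rmorphism k -> D}) (k1 : {rmorphism D -> E1})
         (k2 : {rmorphism D -> E2}),
    [/\ forall c, k1 (i c) = i1 c, forall c, k2 (i c) = i2 c &
      forall x (P : {poly D}), P != 0 -> root (map_poly k1 P) x ->
        (forall g, g %| map_poly k2 P -> (1 < size g)%N -> exists y, root g y) ->
        exists b, k1 b = x].
Proof.
pose H0 := range (fun c => (i1 c, i2 c)).
pose P (H : set (E1 * E2)) := H = set0 \/ (H0 `<=` H /\ field_graph H).
have gH0 : field_graph H0 := range_field_graph i1 i2.
have [] := @Zorn_bigcup _ P.
  move=> F FP tF.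
  have [FE|/existsNP[Z /not_implyP[FZ Z0]]] := pselect (forall Z, F Z -> Z = set0).
    by left; apply/seteqP; split=> // u [Z /FE ->].
  have PZ W : F W -> W !=set0 -> H0 `<=` W /\ field_graph W.
    by move=> /FP[->[]//|].
  have Zn0 : Z !=set0 by apply/set0P/eqP.
  have [H0Z gZ] := PZ _ FZ Zn0.
  have dir u v : (\bigcup_(X in F) X) u -> (\bigcup_(X in F) X) v ->
      exists W, [/\ F W, W u & W v].
    by move=> [U FU Uu] [V FV Vv]; have [UV|VU] := tF _ _ FU FV;
      [exists V; split=> //; exact: UV | exists U; split=> //; exact: VU].
  right; split; first by move=> u /H0Z Zu; exists Z.
  split.
  - by exists Z => //; case: gZ.
  - move=> u v Fu Fv; have [W [FW Wu Wv]] := dir _ _ Fu Fv.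
    by exists W => //; have [|_ [_ WB _ _]] := PZ _ FW _; [exists u | exact: WB].
  - move=> u v Fu Fv; have [W [FW Wu Wv]] := dir _ _ Fu Fv.
    by exists W => //; have [|_ [_ _ WV _]] := PZ _ FW _; [exists u | exact: WV].
  - move=> y [W FW Wy]; have [|_ [_ _ _]] := PZ _ FW _; first by exists (0, y).
    exact.
move=> H [[HE|[H0H gH]] Hmax].
  exfalso; apply: (Hmax H0); last by right; split.
  rewrite HE; split=> // /(_ (i1 1, i2 1)) H0n; apply: H0n.
  by exists 1.
have [D [k1 [k2 kP]]] := graph_embeddings gH.
have ex c : exists b, k1 b = i1 c.
  by have [|b [-> _]] := (kP (i1 c, i2 c)).1; [apply: H0H; exists c | exists b].
have [i iE] := rmorph_factor ex.
exists D, i, k1, k2; split=> // [c|x Q Q0 Qx Qsplit].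
  have [|b [bE ->]] := (kP (i1 c, i2 c)).1; first by apply: H0H; exists c.
  by congr (k2 _); apply: (fmorph_inj k1); rewrite iE -bE.
have [m [m1 mx mmin]] := min_annihilator Q0 Qx.
have m0 : m != 0 by rewrite -size_poly_gt0 ltnW.
have [||y my] := Qsplit (map_poly k2 m); rewrite ?size_map_poly ?dvdp_map ?mmin //.
have gH' := adjoin_root m0 mx my mmin.
set H' := (X in field_graph X) in gH'.
have HH' : H `<=` H'.
  move=> u /kP[b ->]; exists b%:P => //=.
  by rewrite !map_polyC !hornerC.
have H'x : H' (x, y) by exists 'X; rewrite //= !map_polyX !hornerX.
have [/seteqP[_ H'H]|nHH'] := pselect (H = H').
  by have [b [-> _]] := (kP _).1 (H'H _ H'x); exists b.
exfalso; apply: (Hmax H'); first by split=> // H'H; apply: nHH'; apply/seteqP.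
by right; split=> //; apply: subset_trans HH'.
Qed.

(** * Separability and purely inseparable elements *)

Lemma closed_field_pack (E : fieldType) : GRing.closed_field_axiom E ->
  exists E' : closedFieldType, E = E' :> fieldType.
Proof.
case: E => T cT /= closedE; pose K : fieldType := GRing.Field.Pack cT.
pose Kcc := Field_isAlgClosed.Build K closedE.
by exists (HB.pack_for closedFieldType T K Kcc).
Qed.

Lemma closed_axiom_root (E : fieldType) (p : {poly E}) : GRing.closed_field_axiom E ->
  (1 < size p)%N -> exists x, root p x.
Proof.
by move=> /closed_field_pack[E' EE]; move: p; rewrite EE => p p1; apply/closed_rootP; rewrite gtn_eqF.
Qed.

Lemma closed_axiom_split (E : fieldType) : GRing.closed_field_axiom E ->
  forall p : {poly E}, exists rs : seq E, p = lead_coef p *: \prod_(z <- rs) ('X - z%:P).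
Proof.
move=> /closed_field_pack[E' ->] p; have [rs pE] := closed_field_poly_normal p.
by exists rs.
Qed.

Lemma deriv_eq0_pchar (F : fieldType) (m : {poly F}) : (1 < size m)%N ->
  m^`() = 0 -> exists p (q : {poly F}),
    [/\ p \in [pchar F], (size q < size m)%N, q != 0 & m = q \Po 'X^p].
Proof.
move=> m1 dm; have cm i : m`_i.+1 * i.+1%:R = 0.
  by have := congr1 (fun q : {poly F} => q`_i) dm; rewrite coef_deriv coef0 mulr_natr.
have nat0 i : (0 < i)%N -> m`_i != 0 -> i%:R == 0 :> F.
  by case: i => // i _ mi; have /eqP := cm i; rewrite mulf_eq0 (negPf mi).
have m0 : m != 0 by rewrite -size_poly_gt0 ltnW.
have n0 : (0 < (size m).-1)%N by rewrite -subn1 subn_gt0.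
have := nat0 _ n0; rewrite -/(lead_coef m) lead_coef_eq0 => /(_ m0).
move=> /(natf0_pchar n0)[p pF]; have p_pr := pcharf_prime pF.
(* The bound exceeds the true degree; it makes [q] visibly smaller than [m]. *)
pose q := \poly_(i < (size m).-1) m`_(i * p).
have mE : m = q \Po 'X^p.
  apply/polyP => i; rewrite coef_comp_poly_Xn ?prime_gt0 //.
  case: ifP => [/dvdnP[k ->]|pi]; last first.
    apply/eqP/contraT => mi.
    have i0 : (0 < i)%N by case: i pi mi; rewrite ?dvdn0.
    by rewrite (dvdn_pcharf pF) nat0 in pi.
  rewrite mulnK ?prime_gt0 // coef_poly; case: ltnP => // km.
  rewrite nth_default // (leq_trans (n := k * 2)) ?leq_mul ?prime_gt1 //.
  by move: km n0; case: (size m) => //= -[//|s] km _; rewrite muln2 -addnn; lia.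
exists p, q; split=> //.
  by rewrite (leq_ltn_trans (size_poly _ _)) // ltn_predL ltnW.
by apply: contraNneq m0 => q0; rewrite mE q0 comp_poly0.
Qed.

(** Induction on the degree of an annihilating polynomial. If the minimal polynomial has zero
    derivative, it is a polynomial in [X^p], and [x^p] has smaller degree. Otherwise it is
    separable, so it has a root in [L] and is linear. *)
Lemma root_purely_inseparable (L E : fieldType) (i : {rmorphism L -> E}) (x : E) :
  (forall p : {poly L}, separable_poly p -> (1 < size p)%N -> exists x : L, root p x) ->
  algebraicOver i x ->
  exists q, [pchar L].-nat q /\ exists c, x ^+ q = i c.
Proof.
move=> sepL [P P0 Px].
elim: {P}(size P) {-2}P (leqnn (size P)) P0 x Px => [|n IH] P sP P0 x Px.
  by move: sP; rewrite leqn0 size_poly_eq0 (negPf P0).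
have [m [m1 mx mmin]] := min_annihilator P0 Px.
have m0 : m != 0 by rewrite -size_poly_gt0 ltnW.
have [dm0|dm0] := eqVneq m^`() 0.
  have [p [q [pF sq q0 mE]]] := deriv_eq0_pchar m1 dm0.
  have sqn : (size q <= n)%N.
    by rewrite -ltnS (leq_trans sq) // (leq_trans _ sP) // dvdp_leq ?mmin.
  have [|r [rF [c xr]]] := IH q sqn q0 (x ^+ p).
    move: mx; rewrite mE map_comp_poly /= map_polyXn !rootE horner_comp.
    by rewrite hornerXn.
  exists (p * r)%N; split; last by exists c; rewrite exprM.
  by rewrite pnatM rF andbT pnatE // (pcharf_prime pF).
have sm : separable_poly m.
  have /dvdpP[q qE] := dvdp_gcdl m m^`().
  have := mx; rewrite {1}qE rmorphM rootM => /orP[qx|gx]; last first.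
    have := dvdp_trans (mmin _ gx) (dvdp_gcdr m m^`()).
    by move=> /(dvdp_leq dm0); rewrite leqNgt lt_size_deriv.
  have := mmin _ qx; rewrite {1}qE => dq.
  have q0 : q != 0 by apply: contraNneq m0 => q0; rewrite qE q0 mul0r.
  by rewrite unlock coprimep_def -dvdp1 -(dvdp_mul2l _ _ q0) mulr1.
have [r /factor_theorem[q mE]] := sepL _ sm m1.
have := mx; rewrite mE rmorphM rootM => /orP[qx|].
  have q0 : q != 0 by apply: contraNneq m0 => q0; rewrite mE q0 mul0r.
  have := dvdp_leq q0 (mmin _ qx).
  by rewrite mE size_mul ?polyXsubC_eq0 // size_XsubC addn2 /= ltnn.
rewrite rmorphB /= map_polyX map_polyC rootE !hornerE subr_eq0 => /eqP->.
by exists 1%N; split=> //; exists r; rewrite expr1.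
Qed.

Lemma pchar_nat_exprB (F : comNzRingType) (q : nat) (x y : F) :
  [pchar F].-nat q -> (x - y) ^+ q = x ^+ q - y ^+ q.
Proof. by move=> qF; rewrite exprDn_pchar // exprNn_pchar. Qed.

Lemma pchar_nat_exprI (F : idomainType) (q : nat) :
  [pchar F].-nat q -> injective (fun x : F => x ^+ q).
Proof.
move=> qF x y /eqP; rewrite -subr_eq0 -pchar_nat_exprB // expf_eq0.
by rewrite subr_eq0 => /andP[_ /eqP].
Qed.

(** * Power series *)

(** A record rather than a bare function, so that the Cauchy product does not compete with the
    pointwise one. *)
Record pser (F : Type) := PSer { pscoef :> nat -> F }.

Section PowerSeries.
Variable F : fieldType.
Local Notation ps := (pser F).
Implicit Types a b c : ps.

HB.instance Definition _ := gen_eqMixin ps.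
HB.instance Definition _ := gen_choiceMixin ps.

Lemma pser_eq a b : (forall i, a i = b i) -> a = b.
Proof. by case: a b => [f] [g] /= /funext ->. Qed.

Definition ps0 : ps := PSer (fun=> 0).
Definition ps1 : ps := PSer (fun i => (i == 0)%:R).
Definition psadd a b : ps := PSer (fun i => a i + b i).
Definition psopp a : ps := PSer (fun i => - a i).
Definition psmul a b : ps := PSer (fun i => \sum_(j < i.+1) a j * b (i - j)%N).

Let psaddA : associative psadd.
Proof. by move=> a b c; apply: pser_eq => i /=; rewrite addrA. Qed.
Let psaddC : commutative psadd.
Proof. by move=> a b; apply: pser_eq => i /=; rewrite addrC. Qed.
Let psadd0 : left_id ps0 psadd.
Proof. by move=> a; apply: pser_eq => i /=; rewrite add0r. Qed.
Let psaddN : left_inverse ps0 psopp psadd.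
Proof. by move=> a; apply: pser_eq => i /=; rewrite addNr. Qed.

HB.instance Definition _ := GRing.isZmodule.Build ps psaddA psaddC psadd0 psaddN.

(** A coefficient of a product depends on finitely many coefficients of the factors, so
    commutativity and associativity are read off from truncations to polynomials. *)
Let tr n a : {poly F} := \poly_(i < n) a i.

Let psmulE n a b i : (i < n)%N -> psmul a b i = (tr n a * tr n b)`_i.
Proof.
move=> ilt; rewrite coefM; apply: eq_bigr => j _; rewrite !coef_poly.
by rewrite (leq_trans (ltn_ord j) ilt) (leq_ltn_trans (leq_subr _ _) ilt).
Qed.

Let tr_coef n a i : (i < n)%N -> (tr n a)`_i = a i.
Proof. by rewrite coef_poly => ->. Qed.

Let psmulC : commutative psmul.
Proof. by move=> a b; apply: pser_eq => i; rewrite !(psmulE _ _ (ltnSn i)) mulrC. Qed.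

Let psmulA : associative psmul.
Proof.
move=> a b c; apply: pser_eq => i; rewrite [RHS](congr1 (fun d => pscoef d i) (psmulC _ _)).
have E (x y z : ps) : psmul x (psmul y z) i = (tr i.+1 x * (tr i.+1 y * tr i.+1 z))`_i.
  rewrite coefM; apply: eq_bigr => j _; rewrite tr_coef ?ltn_ord //.
  by rewrite -psmulE // ltnS leq_subr.
by rewrite !E (mulrC (tr _ c)) mulrA.
Qed.

Let psmul1 : left_id ps1 psmul.
Proof.
move=> a; apply: pser_eq => i /=.
by rewrite big_ord_recl /= mul1r subn0 big1 ?addr0 // => j _; rewrite mul0r.
Qed.

Let psmulDl : left_distributive psmul psadd.
Proof.
move=> a b c; apply: pser_eq => i /=; rewrite -big_split.
by apply: eq_bigr => j _; rewrite mulrDl.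
Qed.

Let ps10 : ps1 != 0 :> ps.
Proof. by apply/eqP => /(congr1 (fun a : ps => a 0%N))/eqP; rewrite oner_eq0. Qed.

HB.instance Definition _ :=
  GRing.Zmodule_isComNzRing.Build ps psmulA psmulC psmul1 psmulDl ps10.

Lemma psDE a b i : (a + b) i = a i + b i. Proof. by []. Qed.
Lemma psNE a i : (- a) i = - a i. Proof. by []. Qed.
Lemma psBE a b i : (a - b) i = a i - b i. Proof. by []. Qed.
Lemma psME a b i : (a * b) i = \sum_(j < i.+1) a j * b (i - j)%N. Proof. by []. Qed.
Lemma ps0E i : (0 : ps) i = 0. Proof. by []. Qed.
Lemma ps1E i : (1 : ps) i = (i == 0)%:R. Proof. by []. Qed.
Lemma psM0 a b : (a * b) 0%N = a 0%N * b 0%N.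
Proof. by rewrite psME big_ord1. Qed.

Definition psC (x : F) : ps := PSer (fun i => x *+ (i == 0)).

Fact psC_zmod : zmod_morphism psC.
Proof. by move=> x y; apply: pser_eq => i; rewrite psBE /= mulrnBl. Qed.
Lemma psCM x a i : (psC x * a) i = x * a i.
Proof.
rewrite psME big_ord_recl /= mulr1n subn0 big1 ?addr0 // => j _.
by rewrite mulr0n mul0r.
Qed.
Fact psC_monoid : monoid_morphism psC.
Proof.
split; first by apply: pser_eq => i; rewrite ps1E.
by move=> x y; apply: pser_eq => i; rewrite psCM /= mulrnAr.
Qed.
HB.instance Definition _ := GRing.isZmodMorphism.Build F ps psC psC_zmod.
HB.instance Definition _ := GRing.isMonoidMorphism.Build F ps psC psC_monoid.

Definition ps_const a : F := a 0%N.
Fact ps_const_zmod : zmod_morphism ps_const. Proof. by []. Qed.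
Fact ps_const_monoid : monoid_morphism ps_const.
Proof. by split=> // a b; rewrite /ps_const psM0. Qed.
HB.instance Definition _ := GRing.isZmodMorphism.Build ps F ps_const ps_const_zmod.
HB.instance Definition _ := GRing.isMonoidMorphism.Build ps F ps_const ps_const_monoid.

(** The substitution of [z X] for [X]; for a root of unity [z] it plays the role of an inertia
    generator. *)
Definition ps_rot (z : F) a : ps := PSer (fun i => z ^+ i * a i).
Fact ps_rot_zmod z : zmod_morphism (ps_rot z).
Proof. by move=> a b; apply: pser_eq => i; rewrite psBE /= mulrBr. Qed.
Fact ps_rot_monoid z : monoid_morphism (ps_rot z).
Proof.
split; first by apply: pser_eq => -[|i]; rewrite /= ?mul1r ?mulr0.
move=> a b; apply: pser_eq => i; rewrite -[LHS]/(z ^+ i * (a * b) i) !psME mulr_sumr.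
by apply: eq_bigr => j _; rewrite /= [RHS]mulrACA -exprD subnKC // -ltnS ltn_ord.
Qed.
HB.instance Definition _ z := GRing.isZmodMorphism.Build ps ps (ps_rot z) (ps_rot_zmod z).
HB.instance Definition _ z := GRing.isMonoidMorphism.Build ps ps (ps_rot z) (ps_rot_monoid z).

Definition psX : ps := PSer (fun i => (i == 1)%:R).

Lemma psXM a i : (psX * a) i = if i is k.+1 then a k else 0.
Proof.
rewrite psME; case: i => [|i]; first by rewrite big_ord1 mul0r.
rewrite big_ord_recl mul0r add0r big_ord_recl /= mul1r subn1 big1 ?addr0 // => j _.
by rewrite mul0r.
Qed.

Lemma psXnM n a i : (psX ^+ n * a) i = if (i < n)%N then 0 else a (i - n)%N.
Proof.
elim: n i => [|n IH] i; first by rewrite mul1r subn0.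
by rewrite exprS -mulrA psXM; case: i => // i; rewrite IH.
Qed.

Lemma psXn_dvd n a : (forall i, (i < n)%N -> a i = 0) -> exists b, a = psX ^+ n * b.
Proof.
move=> a0; exists (PSer (fun i => a (i + n)%N)); apply: pser_eq => i.
by rewrite psXnM; case: ltnP => [/a0//|ni] /=; rewrite subnK.
Qed.

Lemma psX_dvd a : a 0%N = 0 -> exists b, a = psX * b.
Proof. by move=> a0; rewrite -[psX]expr1; apply: psXn_dvd => -[]. Qed.

Lemma ps_order a : a != 0 -> exists n (u : ps), u 0%N != 0 /\ a = psX ^+ n * u.
Proof.
move=> a0; have ex : exists n, a n != 0.
  apply: contrapT => h; move/eqP: a0; apply; apply: pser_eq => i.
  by rewrite ps0E; apply: contrapT => ai; apply: h; exists i; apply/eqP.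
have [n an nmin] := ex_minnP ex.
have [|u uE] := @psXn_dvd n a.
  by move=> i ilt; apply: contraTeq ilt => ai; rewrite -leqNgt; apply: nmin.
exists n, u; split=> //.
by move: an; rewrite uE psXnM ltnn subnn.
Qed.

Definition ps_unit : {pred ps} := fun a => `[< exists b, b * a = 1 >].
Definition ps_inv a : ps :=
  if pselect (exists b, b * a = 1) is left h then projT1 (cid h) else a.

Let ps_mulVr : {in ps_unit, left_inverse 1 ps_inv *%R}.
Proof.
move=> a /asboolP ua; rewrite /ps_inv; case: pselect => [h|//].
by case: (cid h).
Qed.
Let ps_unitP a b : b * a = 1 -> ps_unit a.
Proof. by move=> ba; apply/asboolP; exists b. Qed.
Let ps_inv_out : {in [predC ps_unit], ps_inv =1 id}.
Proof. by move=> a /asboolP ua; rewrite /ps_inv; case: pselect. Qed.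

HB.instance Definition _ :=
  GRing.ComNzRing_hasMulInverse.Build ps ps_mulVr ps_unitP ps_inv_out.

Let ps_integral a b : a * b = 0 -> (a == 0) || (b == 0).
Proof.
apply: contra_eqT; rewrite negb_or => /andP[/ps_order[n [u [u0 ->]]]].
move=> /ps_order[m [w [w0 ->]]]; apply/eqP => /(congr1 (fun a : ps => a (n + m)%N)).
rewrite mulrACA -exprD psXnM ltnn subnn psM0 ps0E => /eqP.
by rewrite mulf_eq0 (negPf u0) (negPf w0).
Qed.

HB.instance Definition _ := GRing.ComUnitRing_isIntegral.Build ps ps_integral.

(** * Hensel's lemma for power series *)

Section Hensel.
Variables (g : {poly ps}) (y0 : F).
Hypothesis g0 : root (map_poly ps_const g) y0.
Hypothesis g1 : ~~ root (map_poly ps_const g)^`() y0.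
Let l := (map_poly ps_const g)^`().[y0].
(** Newton's iteration with the derivative frozen at its residue [l]; each step gains one power of
    [X]. *)
Let Phi (y : ps) := y - psC l^-1 * g.[y].

Let slope (y y' : ps) : y 0%N = y0 -> y' 0%N = y0 ->
  exists k : ps, k 0%N = l /\ g.[y] - g.[y'] = (y - y') * k.
Proof.
move=> hy hy'.
have /factor_theorem[k kE] : root (g - g.[y']%:P) y' by rewrite rootE !hornerE subrr.
exists k.[y]; split; last first.
  by have := congr1 (fun h => h.[y]) kE; rewrite !hornerE => ->; rewrite mulrC.
rewrite -[LHS]/(ps_const _) -horner_map /= -[ps_const y]/(y 0%N) hy.
have := congr1 (map_poly ps_const) kE.
rewrite rmorphM !rmorphB /= map_polyX !map_polyC /= -[ps_const y']/(y' 0%N) hy'.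
move=> /(congr1 (fun h => h^`().[y0])).
by rewrite derivM !derivB derivX !derivC !subr0 mulr1 !hornerE subrr mulr0 add0r => <-.
Qed.

(** With [k] the difference quotient of [g], the map [Phi] multiplies [y - y'] by [1 - k / l], whose
    constant term vanishes. *)
Let contract n (y y' : ps) : y 0%N = y0 -> y' 0%N = y0 ->
  (exists b, y - y' = psX ^+ n * b) -> exists b, Phi y - Phi y' = psX ^+ n.+1 * b.
Proof.
move=> hy hy' [b bE]; have [k [k0 kE]] := slope hy hy'.
have [|c cE] := @psX_dvd (1 - psC l^-1 * k).
  by rewrite psBE psCM ps1E k0 mulVf ?subrr.
exists (b * c); rewrite exprSr mulrACA -bE -cE.
have -> : Phi y - Phi y' = (y - y') - psC l^-1 * (g.[y] - g.[y']) by rewrite /Phi; ring.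
by rewrite kE; ring.
Qed.

Lemma hensel_unique (y y' : ps) : y 0%N = y0 -> y' 0%N = y0 ->
  root g y -> root g y' -> y = y'.
Proof.
move=> hy hy' /eqP gy /eqP gy'; have [k [k0 kE]] := slope hy hy'.
move: kE; rewrite gy gy' subrr => /esym/eqP; rewrite mulf_eq0 => /orP[|/eqP k00].
  by rewrite subr_eq0 => /eqP.
by move: g1; rewrite rootE -/l -k0 k00 ps0E eqxx.
Qed.

Lemma hensel : exists y : ps, y 0%N = y0 /\ root g y.
Proof.
pose s n := iter n Phi (psC y0).
have Phi0 (y : ps) : y 0%N = y0 -> Phi y 0%N = y0.
  move=> hy; rewrite /Phi psBE psCM -[g.[y] 0%N]/(ps_const g.[y]) -horner_map /=.
  by rewrite -[ps_const y]/(y 0%N) hy (eqP g0) mulr0 subr0.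
have s0 n : s n 0%N = y0 by elim: n => //= n; exact: Phi0.
have sS n : exists b, s n.+1 - s n = psX ^+ n.+1 * b.
  elim: n => [|n IH]; last by apply: contract => //; exact: (s0 n.+1).
  by rewrite expr1; apply: psX_dvd; rewrite psBE s0 (s0 0) subrr.
have sD n m i : (i <= n)%N -> s (n + m)%N i = s n i.
  move=> ilen; elim: m => [|m IH]; rewrite ?addn0 // addnS.
  have [b /(congr1 (fun a : ps => a i))] := sS (n + m)%N.
  by rewrite psBE psXnM ltnS (leq_trans ilen (leq_addr _ _)) IH => /subr0_eq.
(* The coefficient of index [i] is final from the [i]-th iterate on, so the limit is read off the
   diagonal. *)
pose y : ps := PSer (fun i => s i i).
have ys n : exists b, y - s n = psX ^+ n.+1 * b.
  apply: psXn_dvd => i; rewrite ltnS => ilen; rewrite psBE -[y i]/(s i i).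
  by have := sD i (n - i)%N i (leqnn i); rewrite subnKC // => ->; rewrite subrr.
have yP : Phi y = y.
  apply: pser_eq => i; apply/eqP; rewrite -subr_eq0 -psBE.
  have [b bE] := contract (erefl : y 0%N = y0) (s0 i) (ys i).
  have [c cE] := ys i.+1.
  have -> : Phi y - y = psX ^+ i.+2 * (b - c).
    rewrite mulrBr -bE -cE -[s i.+1]/(Phi (s i)).
    by move: (Phi y) (Phi (s i)) => u w; ring.
  by rewrite psXnM ltnW.
exists y; split=> //; apply/eqP.
have /eqP : psC l^-1 * g.[y] = 0 by apply: oppr_inj; apply: (addrI y); rewrite oppr0 addr0.
rewrite mulf_eq0 => /orP[|/eqP//]; rewrite fmorph_eq0 invr_eq0.
by rewrite -[l == 0]/(root _ _) (negPf g1).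
Qed.

End Hensel.
End PowerSeries.

(** * Laurent series *)

Notation laurent F := {fraction (pser F)}.

Section Laurent.
Variable F : fieldType.
Local Notation ps := (pser F).
Local Notation lau := (laurent F).
Implicit Types (a b u : ps) (x y : lau).

Definition lauC : F -> lau := @tofrac (pser F) \o @psC F.
HB.instance Definition _ := GRing.RMorphism.on lauC.
Definition lauX : lau := tofrac (psX F).

Lemma psX_neq0 : psX F != 0.
Proof. by apply/eqP => /(congr1 (fun a : ps => a 1%N))/eqP; rewrite ps0E oner_eq0. Qed.
Lemma lauX_neq0 : lauX != 0. Proof. by rewrite tofrac_eq0 psX_neq0. Qed.
#[local] Hint Resolve lauX_neq0 psX_neq0 : core.

(** Hensel's lemma for the linear polynomial [u Y - 1]. *)
Lemma ps_unitE u : u 0%N != 0 -> exists b, b * u = 1.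
Proof.
move=> u0; have [||b [_ /eqP]] := @hensel _ (u *: 'X - 1) (u 0%N)^-1.
- by rewrite rootE rmorphB rmorph1 /= map_polyZ map_polyX !hornerE mulfV ?subrr.
- rewrite rootE rmorphB rmorph1 /= map_polyZ map_polyX derivB derivC subr0.
  by rewrite derivZ derivX hornerE hornerC mulr1.
- by rewrite !hornerE => /eqP; rewrite subr_eq0 mulrC => /eqP; exists b.
Qed.

Lemma tofrac_unit u : u 0%N != 0 ->
  exists b, b 0%N = (u 0%N)^-1 /\ (tofrac u)^-1 = tofrac b :> lau.
Proof.
move=> u0; have [b bu] := ps_unitE u0; exists b; split.
  apply: (mulIf u0); rewrite mulVf // -psM0 bu //.
apply: (mulIf (x := tofrac u)); last rewrite mulVf -?tofracM ?bu ?tofrac1 //.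
  by rewrite tofrac_eq0; apply: contraNneq u0 => ->.
by rewrite tofrac_eq0; apply: contraNneq u0 => ->.
Qed.

Lemma laurent_form x : x != 0 ->
  exists (n : int) u, u 0%N != 0 /\ x = lauX ^ n * tofrac u.
Proof.
have [a [b [b0 ->]]] := frac_numden x => x0.
have a0 : a != 0 by apply: contraNneq x0 => ->; rewrite tofrac0 mul0r.
have [n [u [u0 ->]]] := ps_order a0; have [m [w [w0 ->]]] := ps_order b0.
have [c [c0 cE]] := tofrac_unit w0.
exists (n%:Z - m%:Z), (u * c); split.
  by rewrite psM0 c0 mulf_neq0 ?invr_eq0.
rewrite !tofracM !tofracXn invfM cE expfzDr // -exprnN mulrACA.
by rewrite -/lauX -exprnP.
Qed.

Definition lau_reg x : Prop := exists a, x = tofrac a.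
(* The value at [0] of a regular [x]; a junk value otherwise. *)
Definition lau_res x : F :=
  if pselect (lau_reg x) is left h then (projT1 (cid h)) 0%N else 0.

Lemma reg_tofrac a : lau_reg (tofrac a). Proof. by exists a. Qed.
Lemma tofrac_inj (R : idomainType) : injective (@tofrac R).
Proof. by move=> a b /eqP; rewrite tofrac_eq => /eqP. Qed.
Lemma res_tofrac a : lau_res (tofrac a) = a 0%N.
Proof.
rewrite /lau_res; case: pselect => [h|[]]; last exact: reg_tofrac.
by case: (cid h) => b /= /tofrac_inj ->.
Qed.
Lemma reg_C c : lau_reg (lauC c). Proof. exact: reg_tofrac. Qed.
Lemma reg_X : lau_reg lauX. Proof. exact: reg_tofrac. Qed.
Lemma reg0 : lau_reg 0. Proof. by exists 0; rewrite tofrac0. Qed.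
Lemma reg1 : lau_reg 1. Proof. by exists 1; rewrite tofrac1. Qed.
Lemma regD x y : lau_reg x -> lau_reg y -> lau_reg (x + y).
Proof. by move=> [a ->] [b ->]; exists (a + b); rewrite tofracD. Qed.
Lemma regN x : lau_reg x -> lau_reg (- x).
Proof. by move=> [a ->]; exists (- a); rewrite tofracN. Qed.
Lemma regB x y : lau_reg x -> lau_reg y -> lau_reg (x - y).
Proof. by move=> rx /regN; exact: regD. Qed.
Lemma regM x y : lau_reg x -> lau_reg y -> lau_reg (x * y).
Proof. by move=> [a ->] [b ->]; exists (a * b); rewrite tofracM. Qed.
Lemma regXn x n : lau_reg x -> lau_reg (x ^+ n).
Proof. by move=> [a ->]; exists (a ^+ n); rewrite tofracXn. Qed.
Lemma reg_sum (I : Type) (r : seq I) (P : pred I) (f : I -> lau) :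
  (forall i, P i -> lau_reg (f i)) -> lau_reg (\sum_(i <- r | P i) f i).
Proof. by move=> h; apply: big_ind => //; [exact: reg0|exact: regD]. Qed.
Lemma reg_prod (I : Type) (r : seq I) (P : pred I) (f : I -> lau) :
  (forall i, P i -> lau_reg (f i)) -> lau_reg (\prod_(i <- r | P i) f i).
Proof. by move=> h; apply: big_ind => //; [exact: reg1|exact: regM]. Qed.

Lemma res0 : lau_res 0 = 0. Proof. by rewrite -tofrac0 res_tofrac. Qed.
Lemma res1 : lau_res 1 = 1. Proof. by rewrite -tofrac1 res_tofrac. Qed.
Lemma res_C c : lau_res (lauC c) = c. Proof. by rewrite res_tofrac. Qed.
Lemma res_X : lau_res lauX = 0. Proof. by rewrite res_tofrac. Qed.
Lemma resD x y : lau_reg x -> lau_reg y -> lau_res (x + y) = lau_res x + lau_res y.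
Proof. by move=> [a ->] [b ->]; rewrite -tofracD !res_tofrac. Qed.
Lemma resN x : lau_reg x -> lau_res (- x) = - lau_res x.
Proof. by move=> [a ->]; rewrite -tofracN !res_tofrac. Qed.
Lemma resB x y : lau_reg x -> lau_reg y -> lau_res (x - y) = lau_res x - lau_res y.
Proof. by move=> [a ->] [b ->]; rewrite -tofracB !res_tofrac. Qed.
Lemma resM x y : lau_reg x -> lau_reg y -> lau_res (x * y) = lau_res x * lau_res y.
Proof. by move=> [a ->] [b ->]; rewrite -tofracM !res_tofrac psM0. Qed.
Lemma resXn x n : lau_reg x -> lau_res (x ^+ n) = lau_res x ^+ n.
Proof.
move=> rx; elim: n => [|n IH]; first by rewrite res1.
by rewrite !exprS resM ?IH //; exact: regXn.
Qed.
Lemma res_sum (I : Type) (r : seq I) (P : pred I) (f : I -> lau) :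
  (forall i, P i -> lau_reg (f i)) ->
  lau_res (\sum_(i <- r | P i) f i) = \sum_(i <- r | P i) lau_res (f i).
Proof.
move=> h; suff [] : lau_reg (\sum_(i <- r | P i) f i) /\
  lau_res (\sum_(i <- r | P i) f i) = \sum_(i <- r | P i) lau_res (f i) by [].
apply: (big_ind2 (fun x c => lau_reg x /\ lau_res x = c)).
- by split; [exact: reg0 | exact: res0].
- by move=> x c y d [rx <-] [ry <-]; split; [exact: regD | exact: resD].
- by move=> i /h.
Qed.
Lemma res_prod (I : Type) (r : seq I) (P : pred I) (f : I -> lau) :
  (forall i, P i -> lau_reg (f i)) ->
  lau_res (\prod_(i <- r | P i) f i) = \prod_(i <- r | P i) lau_res (f i).
Proof.
move=> h; suff [] : lau_reg (\prod_(i <- r | P i) f i) /\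
  lau_res (\prod_(i <- r | P i) f i) = \prod_(i <- r | P i) lau_res (f i) by [].
apply: (big_ind2 (fun x c => lau_reg x /\ lau_res x = c)).
- by split; [exact: reg1 | exact: res1].
- by move=> x c y d [rx <-] [ry <-]; split; [exact: regM | exact: resM].
- by move=> i /h.
Qed.

Lemma reg_inv x : lau_reg x -> lau_res x != 0 ->
  lau_reg x^-1 /\ lau_res x^-1 = (lau_res x)^-1.
Proof.
move=> [a ->]; rewrite res_tofrac => /tofrac_unit[b [b0 ->]].
by rewrite res_tofrac; split=> //; exact: reg_tofrac.
Qed.

Lemma nreg_inv x : ~ lau_reg x -> lau_reg x^-1 /\ lau_res x^-1 = 0.
Proof.
move=> nx; have x0 : x != 0 by apply/eqP => x0; apply: nx; rewrite x0; exact: reg0.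
have [[n|n] [u [u0 xE]]] := laurent_form x0.
  by case: nx; rewrite xE; apply: regM; [apply: regXn; exact: reg_X|exact: reg_tofrac].
have [b [_ bE]] := tofrac_unit u0.
rewrite xE invfM bE NegzE -exprnN invrK; split.
  by apply: regM; [apply: regXn; exact: reg_X|exact: reg_tofrac].
rewrite resM ?resXn ?res_X ?expr0n ?mul0r //; try exact: reg_tofrac.
by apply: regXn; exact: reg_X.
Qed.

(** The valuation ring is integrally closed: for [y] not regular, [1 / y] has residue zero, and the
    equation divided by [y^n] reduces to [1 = 0]. *)
Lemma reg_integral (P : {poly lau}) y : P \is monic ->
  (forall i, lau_reg P`_i) -> root P y -> lau_reg y.
Proof.
move=> mP rP /eqP Py; apply: contrapT => ny.
have [ry y0] := nreg_inv ny.
have yn0 : y != 0 by apply/eqP => y0'; apply: ny; rewrite y0'; exact: reg0.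
have P0 : P != 0 := monic_neq0 mP.
move: Py; rewrite horner_coef; have := mP; rewrite monicE /lead_coef.
rewrite -[in X in _ -> X](prednK (_ : 0 < size P)%N) ?size_poly_gt0 //.
move: (size P).-1 => n Pn; rewrite big_ord_recr /= (eqP Pn) mul1r => h.
have : (\sum_(i < n) P`_i * y ^+ i) * y ^- n + 1 = 0.
  by rewrite -[1](mulfV (expf_neq0 n yn0)) -mulrDl h mul0r.
have rt i : (i < n)%N -> lau_reg (P`_i * (y^-1) ^+ (n - i)).
  by move=> _; apply: regM => //; exact: regXn.
rewrite mulr_suml (eq_bigr (fun i : 'I_n => P`_i * (y^-1) ^+ (n - i))); last first.
  move=> i _; rewrite -mulrA exprVn; congr (_ * _).
  apply: (mulIf (expf_neq0 (n - i) yn0)); rewrite mulVf ?expf_neq0 //.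
  by rewrite mulrAC -exprD subnKC ?mulfV ?expf_neq0 // ltnW.
move=> /(congr1 lau_res); rewrite res0 resD; last 2 first.
- by apply: reg_sum => i _; exact: rt.
- exact: reg1.
rewrite res1 res_sum => [|i _]; last exact: rt.
rewrite big1 ?add0r => [/eqP|i _]; first by rewrite oner_eq0.
by rewrite resM ?resXn ?y0 ?expr0n ?subn_eq0 1?leqNgt ?ltn_ord ?mulr0 //; exact: regXn.
Qed.

Lemma lau_rot_exists (z : F) : z != 0 ->
  exists t : {rmorphism lau -> lau}, forall a, t (tofrac a) = tofrac (ps_rot z a).
Proof.
move=> z0.
have inj : injective (@tofrac ps \o ps_rot z : ps -> lau).
  move=> a b /tofrac_inj ab; apply: pser_eq => i.
  by have /(mulfI (expf_neq0 i z0)) := congr1 (fun a : ps => a i) ab.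
exact: frac_lift inj.
Qed.

Definition is_rot (z : F) (t : {rmorphism lau -> lau}) : Prop :=
  forall a, t (tofrac a) = tofrac (ps_rot z a).

(** * Rotations of the Laurent variable *)

Section Rot.
Variables (z : F) (t : {rmorphism lau -> lau}).
Hypothesis tz : is_rot z t.

Lemma rot_C c : t (lauC c) = lauC c.
Proof.
rewrite tz; congr tofrac; apply: pser_eq => -[|i] /=; first by rewrite mul1r.
by rewrite mulr0.
Qed.
Lemma rot_X : t lauX = lauC z * lauX.
Proof.
rewrite tz -tofracM; congr tofrac; apply: pser_eq => i.
by rewrite psCM /=; case: i => [|[|i]]; rewrite /= ?mulr0 ?expr1.
Qed.
Lemma rot_reg x : lau_reg x -> lau_reg (t x).
Proof. by move=> [a ->]; rewrite tz; exact: reg_tofrac. Qed.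
Lemma rot_res x : lau_reg x -> lau_res (t x) = lau_res x.
Proof. by move=> [a ->]; rewrite tz !res_tofrac /= mul1r. Qed.

(** A series fixed by the rotation involves only exponents divisible by [e]; without constant term
    it starts at [X^e] or later. *)
Lemma rot_fixed_div e x : (0 < e)%N -> e.-primitive_root z -> t x = x ->
  lau_reg x -> lau_res x = 0 -> exists y, lau_reg y /\ x = lauX ^+ e * y.
Proof.
move=> e0 ze tx [a xE]; move: tx; rewrite xE tz res_tofrac => /tofrac_inj ta a0.
have [|b ->] := @psXn_dvd _ e a.
  move=> i ie; apply/eqP/contraT => ai.
  have := congr1 (fun a : ps => a i) ta; rewrite /= -{2}[a i]mul1r => /(mulIf ai) zi.
  have := prim_order_dvd ze i; rewrite zi eqxx => /dvdnP[k iE].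
  move: ie ai; rewrite iE; case: k {iE} => [|k]; first by rewrite mul0n a0 eqxx.
  by rewrite mulSn ltnNge leq_addr.
by exists (tofrac b); rewrite tofracM tofracXn; split=> //; exact: reg_tofrac.
Qed.

End Rot.

(* The local coordinate [x] at [y], read as a point of the projective line. *)
Definition chart (y : P1 F) (x : lau) : lau := if y is Some c then lauC c + x else x^-1.

(* [x] lies over [y] with multiplicity [N]. *)
Definition at_pt (x : lau) (y : P1 F) (N : nat) : Prop :=
  (0 < N)%N /\ exists u, u 0%N != 0 /\ x = chart y (tofrac (psX F ^+ N * u)).

Lemma at_pt_unique x (y y' : P1 F) N N' : at_pt x y N -> at_pt x y' N' -> y = y' /\ N = N'.
Proof.
have X0 n u : (0 < n)%N -> (psX F ^+ n * u) 0%N = 0 by move=> n0; rewrite psXnM n0.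
have XI n m (u w : ps) : u 0%N != 0 -> w 0%N != 0 -> psX F ^+ n * u = psX F ^+ m * w -> (n <= m)%N.
  move=> u0 w0 E; rewrite leqNgt; apply/negP => mn.
  have := congr1 (fun a : ps => a m) E; rewrite !psXnM mn ltnn subnn.
  by move/eqP; rewrite eq_sym (negPf w0).
have E n m (u w : ps) : u 0%N != 0 -> w 0%N != 0 -> psX F ^+ n * u = psX F ^+ m * w -> n = m.
  by move=> u0 w0 h; apply/eqP; rewrite eqn_leq (XI n m u w) // (XI m n w u).
have no n m c (u w : ps) : (0 < n)%N -> (0 < m)%N -> w 0%N != 0 ->
    lauC c + tofrac (psX F ^+ n * u) <> (tofrac (psX F ^+ m * w))^-1.
  move=> n0 m0 w0; set A := _ * w => h.
  have A0 : tofrac A != 0 :> lau.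
    by rewrite tofrac_eq0 mulf_neq0 ?expf_neq0 //; apply: contraNneq w0 => ->.
  have := mulfV A0; rewrite -h -tofracD -tofracM -tofrac1 => /tofrac_inj.
  by move/(congr1 (fun a : ps => a 0%N))/eqP; rewrite psM0 X0 // mul0r eq_sym oner_eq0.
move=> [N0 [u [u0 xE]]] [N0' [w [w0]]]; rewrite xE.
case: y {xE} => [c|]; case: y' => [c'|] /= h.
- have := h; rewrite -!tofracD => /tofrac_inj h1.
  have := congr1 (fun a : ps => a 0%N) h1; rewrite !psDE !X0 // !addr0 /= !mulr1n => cc.
  by move: h1; rewrite cc => /addrI /E ->.
- by case: (no _ _ _ _ _ N0 N0' w0 h).
- by case: (no _ _ _ _ _ N0' N0 u0 (esym h)).
- by move/invr_inj: h => /tofrac_inj /E ->.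
Qed.

End Laurent.

(** * Local form of a rational map *)

Lemma map_lauC_eval (F : fieldType) (A : {poly F}) (a : pser F) :
  (map_poly (@lauC F) A).[tofrac a] = tofrac (map_poly (@psC F) A).[a].
Proof. by rewrite -horner_map -map_poly_comp. Qed.

Lemma psC_eval0 (F : fieldType) (A : {poly F}) (a : pser F) :
  (map_poly (@psC F) A).[a] 0%N = A.[a 0%N].
Proof.
rewrite -[LHS]/(ps_const _) -horner_map -map_poly_comp.
by rewrite (eq_map_poly (g := idfun)) ?map_poly_id // => x /=; rewrite /ps_const /= mulr1n.
Qed.

Lemma tofrac_neq0 (F : fieldType) (a : pser F) : a 0%N != 0 -> tofrac a != 0 :> laurent F.
Proof. by move=> a0; rewrite tofrac_eq0; apply: contraNneq a0 => ->. Qed.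

(* [revp n r] is the polynomial [X^n r(1/X)]. *)
Definition revp (R : nzRingType) (n : nat) (r : {poly R}) : {poly R} :=
  \poly_(i < n.+1) r`_(n - i).

Lemma revp_map (R S : nzRingType) (g : {rmorphism R -> S}) n r :
  map_poly g (revp n r) = revp n (map_poly g r).
Proof.
apply/polyP => i; rewrite coef_map /revp [in LHS]coef_poly [in RHS]coef_poly.
by case: ifP => _; [rewrite coef_map | exact: raddf0].
Qed.

Lemma revp_horner (E : fieldType) (n : nat) (r : {poly E}) (x : E) :
  x != 0 -> (size r <= n.+1)%N -> (revp n r).[x] = x ^+ n * r.[x^-1].
Proof.
move=> x0 sr; rewrite (horner_coef_wide _ sr) (horner_coef_wide _ (size_poly _ _)).
rewrite mulr_sumr (reindex_inj rev_ord_inj); apply: eq_bigr => i _.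
have ilen : (i <= n)%N by rewrite -ltnS.
rewrite coef_poly /= subSS ltnS leq_subr subKn //.
rewrite mulrCA; congr (_ * _); rewrite exprVn; apply: (mulIf (expf_neq0 i x0)).
by rewrite -exprD subnK ?mulfVK ?expf_neq0 // -ltnS.
Qed.

Lemma revp_neq0 (E : fieldType) (n : nat) (r : {poly E}) (x : E) :
  x != 0 -> (size r <= n.+1)%N -> (revp n r).[x] != 0 -> r.[x^-1] != 0.
Proof. by move=> x0 sr; rewrite revp_horner // mulf_eq0 negb_or => /andP[]. Qed.

Lemma revp0 (R : nzRingType) n (r : {poly R}) : (revp n r).[0] = r`_n.
Proof. by rewrite horner_coef0 coef_poly subn0. Qed.

Section LocalForm.
Variables (F : fieldType) (p q : {poly F}).
Hypotheses (cop : coprimep p q) (d0 : (0 < pair_degree p q)%N).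
Local Notation d := (pair_degree p q).
Local Notation f := (P1map p q).
Local Notation lau := (laurent F).
Local Notation C := (map_poly (@lauC F)).
Local Notation fL := (P1map (C p) (C q)).
Local Notation ld := (pair_local_degree p q).

Lemma coprime_nroot c : q.[c] = 0 -> p.[c] != 0.
Proof.
move=> qc; apply/negP => pc; have := coprimep_root cop pc.
by rewrite qc eqxx.
Qed.

Lemma size_pair : (size p <= d.+1)%N /\ (size q <= d.+1)%N.
Proof.
by rewrite /pair_degree; split; rewrite (leq_trans (leqSpred _)) // ltnS ?leq_maxl ?leq_maxr.
Qed.

(** Otherwise both polynomials would have degree below [d], the maximum of their degrees. *)
Lemma coef_pair : q`_d = 0 -> p`_d != 0.
Proof.
move=> qd; apply/negP => /eqP pd; move: d0; have [sp sq] := size_pair.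
have lt (r : {poly F}) : (size r <= d.+1)%N -> r`_d = 0 -> ((size r).-1 < d)%N.
  move=> sr rd; have sr' : ((size r).-1 <= d)%N by rewrite -subn1 leq_subLR add1n.
  rewrite ltn_neqAle sr' andbT.
  apply/eqP => E; move: rd; rewrite -E -/(lead_coef r) => /eqP; rewrite lead_coef_eq0.
  by move=> r0; move: E d0; rewrite (eqP r0) size_poly0 /= => <-.
by move: (lt _ sp pd) (lt _ sq qd); rewrite /pair_degree; lia.
Qed.

(** A vanishing fibre polynomial would make one of the coprime polynomials divide the other; then
    both are constant and the pair has degree zero. *)
Lemma fiber_neq0 w : fiber_poly p q w != 0.
Proof.
have deg0 (r s : {poly F}) : coprimep r s -> r %| s -> size r = 1%N.
  by move=> rs /dvdp_gcd_idl/eqp_size E; move: rs; rewrite /coprimep E => /eqP.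
case: w => [b|] /=; last first.
  apply/eqP => q0; move: d0; rewrite /pair_degree q0 size_poly0 maxn0.
  by rewrite (deg0 p q) // q0 dvdp0.
apply/negP => /eqP/subr0_eq pE.
have sq : size q = 1%N.
  by apply: (deg0 q p); rewrite 1?coprimep_sym // pE -mul_polyC dvdp_mull.
move: d0; rewrite /pair_degree sq maxn0 pE.
by have := size_scale_leq b q; rewrite sq; case: (size _) => [|[]].
Qed.

Lemma lau_eval_neq0 (A : {poly F}) (a : pser F) : A.[a 0%N] != 0 -> (C A).[tofrac a] != 0.
Proof. by move=> Aa; rewrite map_lauC_eval tofrac_neq0 // psC_eval0. Qed.

Lemma P1map_frac (E : fieldType) (r s : {poly E}) x : s.[x] != 0 ->
  P1map r s (Some x) = Some (r.[x] / s.[x]).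
Proof. by move=> /negPf sx; rewrite /P1map sx. Qed.

(** In the charts at [y] and at its image the map is a power times a unit, with exponent the local
    degree. This comes from the fibre polynomial: at a finite point it factors as [(X - c)^e h1]
    with [h1(c)] nonzero, at infinity reversed polynomials are used. Where the image is infinite,
    numerator and denominator exchange roles. *)
Lemma local_form (y : P1 F) : exists A B : {poly F},
  [/\ A.[0] != 0, B.[0] != 0, (0 < ld y)%N &
    forall a : pser F, a != 0 -> a 0%N = 0 ->
      fL (Some (chart y (tofrac a))) =
      Some (chart (f y) (tofrac a ^+ ld y * (C A).[tofrac a] / (C B).[tofrac a]))].
Proof.
case: y => [c|].
- have fE : f (Some c) = if q.[c] == 0 then None else Some (p.[c] / q.[c]) by [].
  pose h := fiber_poly p q (f (Some c)).
  have ldE : ld (Some c) = mup c h by [].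
  have h0 : h != 0 := fiber_neq0 _.
  have hc : root h c.
    rewrite rootE /h fE; have [qc|qc] := eqVneq q.[c] 0; first by rewrite /= qc.
    by rewrite /= !hornerE divfK ?subrr.
  have e0 : (0 < mup c h)%N by rewrite -XsubC_dvd // -root_factor_theorem.
  have : ('X - c%:P) ^+ mup c h %| h by rewrite -mup_geq.
  move=> /dvdpP[h1 hE].
  have h1c : h1.[c] != 0.
    apply/negP => /eqP/eqP/factor_theorem[h2 h2E].
    have := mup_geq c (mup c h).+1 h0; rewrite ltnn => /esym/negP; apply.
    by rewrite [X in _ %| X]hE h2E -mulrA -exprS dvdp_mull.
  (* Translation moving [c] to [0]. *)
  pose sh (r : {poly F}) := r \Po ('X + c%:P).
  have sh0 r : (sh r).[0] = r.[c] by rewrite /sh horner_comp !hornerE.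
  have shL r (x : lau) : (C (sh r)).[x] = (C r).[lauC c + x].
    rewrite /sh map_comp_poly horner_comp rmorphD /= map_polyX map_polyC /=.
    by rewrite !hornerE addrC.
  have CX (r s : {poly F}) (x : lau) : (C (r * s)).[x] = (C r).[x] * (C s).[x].
    by rewrite rmorphM hornerM.
  have hL a : (C h).[lauC c + tofrac a] = tofrac a ^+ mup c h * (C (sh h1)).[tofrac a].
    rewrite [in LHS]hE CX -shL mulrC rmorphXn /= horner_exp rmorphB /= map_polyX map_polyC.
    by rewrite !hornerE addrAC subrr add0r.
  have [qc|qc] := eqVneq q.[c] 0.
    have fc : f (Some c) = None by rewrite fE qc eqxx.
    have hq : h = q by rewrite /h fc.
    exists (sh h1), (sh p); rewrite !sh0 h1c (coprime_nroot qc); split=> // a a0 ac.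
    have := hL a; rewrite {1}hq => qL.
    rewrite fc P1map_frac qL; last first.
      rewrite mulf_neq0 ?expf_neq0 ?tofrac_eq0 // lau_eval_neq0 // ac sh0 //.
    by rewrite [chart None _]/= invf_div !shL.
  have fc : f (Some c) = Some (p.[c] / q.[c]) by rewrite fE (negPf qc).
  exists (sh h1), (sh q); rewrite !sh0 h1c qc; split=> // a a0 ac.
  have qa : (C q).[lauC c + tofrac a] != 0.
    by rewrite -shL lau_eval_neq0 // ac sh0.
  rewrite fc P1map_frac // ldE -hL shL /h fc [fiber_poly _ _ _]/=.
  rewrite [chart (Some c) _]/= [chart (Some (_ / _)) _]/=.
  rewrite rmorphB /= map_polyZ hornerD hornerN hornerZ mulrBl mulfK //; congr Some; by rewrite [RHS]addrC subrK.
- pose h := fiber_poly p q (f None).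
  have h0 : h != 0 := fiber_neq0 _.
  have [sp sq] := size_pair.
  have hE : (h = q /\ f None = None /\ q`_d = 0) \/
     (h = p - (p`_d / q`_d) *: q /\ f None = Some (p`_d / q`_d) /\ q`_d != 0).
    have fE : f None = if q`_d == 0 then None else Some (p`_d / q`_d) by [].
    by rewrite /h fE; case: eqVneq => qd; [left|right].
  (* The coefficient of index [d] vanishes, so the degree of [h] drops below [d]; the drop is the
     local degree at infinity. *)
  have hd : h`_d = 0.
    case: hE => [[-> []]//|[-> [_ qd]]]; rewrite coefB coefZ divfK // subrr //.
  have sh : (size h <= d.+1)%N.
    case: hE => [[-> _]//|[-> _]]; rewrite (leq_trans (size_polyD _ _)) //.
    by rewrite size_polyN geq_max sp (leq_trans (size_scale_leq _ _)).
  have hlt : ((size h).-1 < d)%N.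
    rewrite ltn_neqAle -ltnS prednK ?size_poly_gt0 // sh andbT.
    by apply: contraNneq h0 => E; rewrite -lead_coef_eq0 /lead_coef E hd.
  have ldE : ld None = (d - (size h).-1)%N by [].
  have CE (r : {poly F}) n (x : lau) : x != 0 -> (size r <= n.+1)%N ->
      (C r).[x^-1] = x ^- n * (C (revp n r)).[x].
    move=> x0 sr; rewrite revp_map revp_horner ?size_map_poly //.
    by rewrite mulKf // expf_neq0.
  have hl : (revp (size h).-1 h).[0] != 0 by rewrite revp0 -/(lead_coef h) lead_coef_eq0.
  have hL (x : lau) : x != 0 ->
      (C h).[x^-1] = x ^- d * (x ^+ ld None * (C (revp (size h).-1 h)).[x]).
    move=> x0; rewrite (CE _ (size h).-1) ?prednK ?size_poly_gt0 // mulrA; congr (_ * _).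
    apply: (mulfI (expf_neq0 d x0)); rewrite mulVKf ?expf_neq0 // ldE.
    by rewrite -{1}(subnK (ltnW hlt)) exprD mulfK ?expf_neq0.
  have a0' a : a != 0 -> tofrac a != 0 :> lau by rewrite tofrac_eq0.
  case: hE => [[hq [fN qd]]|[hq [fN qd]]].
    exists (revp (size h).-1 h), (revp d p); rewrite !revp0 coef_pair // -[h`__]/(lead_coef h).
    rewrite lead_coef_eq0 h0 ldE subn_gt0; split=> // a aN ac.
    have x0 := a0' _ aN.
    have := hL (tofrac a) x0; rewrite {1}hq => qL.
    rewrite fN P1map_frac [chart None _]/= qL; last first.
      rewrite !mulf_neq0 ?invr_eq0 ?expf_neq0 // lau_eval_neq0 // ac //.
    rewrite [chart None _]/= ldE (CE p d) // invfM invrK mulrACA mulVf ?expf_neq0 // mul1r.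
    by rewrite invf_div.
  exists (revp (size h).-1 h), (revp d q); rewrite !revp0 qd -[h`__]/(lead_coef h).
  rewrite lead_coef_eq0 h0 ldE subn_gt0; split=> // a aN ac.
  have x0 := a0' _ aN.
  have qa : (C (revp d q)).[tofrac a] != 0 by rewrite lau_eval_neq0 // ac revp0.
  have qx : (C q).[(tofrac a)^-1] != 0.
    by apply: (revp_neq0 (n := d)) => //; rewrite ?size_map_poly // -revp_map.
  rewrite fN /= P1map_frac //; congr Some.
  have pE : (C p).[(tofrac a)^-1] = lauC (p`_d / q`_d) * (C q).[(tofrac a)^-1] + (C h).[(tofrac a)^-1].
    rewrite hq rmorphB /= map_polyZ hornerD hornerN hornerZ. by rewrite [RHS]addrC subrK.
  rewrite pE mulrDl mulfK //; congr (_ + _).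
  rewrite hL // (CE q d) // invfM invrK mulrACA mulVf ?expf_neq0 // mul1r //.
Qed.

End LocalForm.

Lemma chart_inj (F : fieldType) (y : P1 F) : injective (chart y).
Proof. by case: y => [c|] x x' /=; [move/addrI | move/invr_inj]. Qed.

Lemma psX_pow_mul0 (F : fieldType) n (u : pser F) : (0 < n)%N -> (psX F ^+ n * u) 0%N = 0.
Proof. by move=> n0; rewrite psXnM n0. Qed.

Lemma ps_neq0 (F : fieldType) (u : pser F) : u 0%N != 0 -> u != 0.
Proof. by move=> u0; apply: contraNneq u0 => ->. Qed.

Lemma psX_pow_mul_neq0 (F : fieldType) n (u : pser F) : u 0%N != 0 -> psX F ^+ n * u != 0.
Proof. by move=> /ps_neq0 u0; rewrite mulf_neq0 // expf_neq0 // psX_neq0. Qed.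

Lemma roots_Xn (F : fieldType) (e : nat) (c : F) : GRing.closed_field_axiom F ->
  (e%:R : F) != 0 -> c != 0 ->
  exists rs : seq F, [/\ uniq rs, size rs = e & forall z, z \in rs -> z ^+ e = c].
Proof.
move=> clF e0 c0; have e1 : (0 < e)%N by case: e e0 => //; rewrite eqxx.
have sP : size ('X^e - c%:P : {poly F}) = e.+1 by rewrite size_XnsubC.
have lP : lead_coef ('X^e - c%:P : {poly F}) = 1 by rewrite lead_coefXnsubC.
have [rs rsE] := closed_axiom_split clF ('X^e - c%:P).
rewrite lP scale1r in rsE; exists rs; split.
- rewrite -separable_prod_XsubC -rsE unlock derivB derivC subr0 derivXn -scaler_nat.
  rewrite coprimepZr // coprimep_sym; apply: coprimep_expl; rewrite coprimep_sym.
  rewrite coprimepX rootE !hornerE expr0n gtn_eqF //.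
  by rewrite sub0r oppr_eq0.
- by apply/succn_inj; rewrite -sP rsE size_prod_XsubC.
- move=> z; rewrite -root_prod_XsubC -rsE rootE !hornerE subr_eq0 => /eqP //.
Qed.

(** * Preimages of a Laurent series near a given point *)

Section Solve.
Variables (F : fieldType) (p q : {poly F}).
Hypotheses (cop : coprimep p q) (d0 : (0 < pair_degree p q)%N).
Local Notation d := (pair_degree p q).
Local Notation f := (P1map p q).
Local Notation lau := (laurent F).
Local Notation C := (map_poly (@lauC F)).
Local Notation fL := (P1map (C p) (C q)).
Local Notation ld := (pair_local_degree p q).

Lemma local_degree_gt0 y : (0 < ld y)%N.
Proof. by have [A [B []]] := local_form cop d0 y. Qed.

Lemma at_pt_map x y N : at_pt x y N ->
  exists x', fL (Some x) = Some x' /\ at_pt x' (f y) (ld y * N).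
Proof.
move=> [N0 [u [u0 ->]]]; have [A [B [A0 B0 e0 E]]] := local_form cop d0 y.
have a0 := psX_pow_mul0 u N0.
rewrite E //; last exact: psX_pow_mul_neq0.
eexists; split; first by []; split; first by rewrite muln_gt0 e0.
set a := _ * u in a0 *.
have Aa : (map_poly (@psC F) A).[a] 0%N != 0 by rewrite psC_eval0 a0.
have Ba : (map_poly (@psC F) B).[a] 0%N != 0 by rewrite psC_eval0 a0.
have [b [b0 bE]] := tofrac_unit Ba.
exists (u ^+ ld y * (map_poly (@psC F) A).[a] * b); split.
  rewrite !psM0 b0 !mulf_neq0 ?invr_eq0 //.
  by rewrite -[_ 0%N]/(ps_const _) rmorphXn expf_neq0.
congr chart; rewrite !map_lauC_eval bE -tofracXn -!tofracM; congr tofrac.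
by rewrite /a exprMn -exprM mulnC !mulrA.
Qed.

(** Substituting [X^n U] for the unknown and cancelling the common power of [X] leaves an equation
    for the unit part [U]. Its reduction is a binomial of degree [ld y], so its nonzero roots are
    simple when [ld y] is invertible in [F]. *)
Lemma local_equation y n (xi : pser F) : (0 < n)%N -> xi 0%N != 0 ->
  exists (g : {poly pser F}) (a b : F), [/\ a != 0, b != 0,
    map_poly (@ps_const F) g = a *: 'X^(ld y) - (xi 0%N * b)%:P &
    forall U : pser F, U 0%N != 0 ->
      (root g U <-> fL (Some (chart y (tofrac (psX F ^+ n * U)))) =
                    Some (chart (f y) (tofrac (psX F ^+ (n * ld y) * xi))))].
Proof.
move=> n0 xi0; have [A [B [A0 B0 e0 E]]] := local_form cop d0 y.
pose PC := map_poly (@psC F); pose S := psX F ^+ n *: 'X.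
have PC0 (r : {poly F}) : map_poly (@ps_const F) (PC r \Po S) = r.[0]%:P.
  rewrite map_comp_poly -map_poly_comp (eq_map_poly (g := idfun)); last first.
    by move=> x /=; rewrite /ps_const /= mulr1n.
  rewrite map_poly_id // map_polyZ map_polyX rmorphXn /=.
  by rewrite expr0n gtn_eqF // scale0r comp_poly0r horner_coef0.
exists ('X^(ld y) * (PC A \Po S) - xi *: (PC B \Po S)), A.[0], B.[0]; split=> //.
  rewrite rmorphB rmorphM /= map_polyZ /= !PC0 map_polyXn mulrC mul_polyC.
  by congr (_ - _); rewrite -mul_polyC -polyCM.
move=> U U0; set a := psX F ^+ n * U.
have a0 : a 0%N = 0 := psX_pow_mul0 U n0.
have an0 : a != 0 := psX_pow_mul_neq0 n U0.
rewrite E //.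
have gE : ('X^(ld y) * (PC A \Po S) - xi *: (PC B \Po S)).[U] =
    U ^+ ld y * (PC A).[a] - xi * (PC B).[a].
  rewrite !hornerE !horner_comp !hornerE //.
have Ba : tofrac (PC B).[a] != 0 :> lau by rewrite tofrac_neq0 // psC_eval0 a0.
have Xn0 : tofrac (psX F ^+ (n * ld y)) != 0 :> lau.
  by rewrite tofrac_eq0 expf_neq0 ?psX_neq0.
have key : tofrac a ^+ ld y * (C A).[tofrac a] / (C B).[tofrac a] =
    tofrac (psX F ^+ (n * ld y) * xi) <-> U ^+ ld y * (PC A).[a] = xi * (PC B).[a].
  rewrite !map_lauC_eval -tofracXn.
  have -> : a ^+ ld y = psX F ^+ (n * ld y) * U ^+ ld y by rewrite exprMn -exprM.
  rewrite !(tofracM (psX F ^+ (n * ld y))) -!mulrA.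
  split=> [/(mulfI Xn0)|h].
    move=> /(congr1 (fun x => x * tofrac (PC B).[a])).
    by rewrite mulrA divfK // -!tofracM => /tofrac_inj.
  congr (_ * _); apply: (mulIf Ba).
  by rewrite mulrA divfK // -!tofracM h.
rewrite rootE gE subr_eq0; split=> [/eqP/key ->//|[/chart_inj/key ->]].
by rewrite eqxx.
Qed.

(** A solution is determined by its leading coefficient, by uniqueness in Hensel's lemma. This is
    how rotations are later seen to fix solutions. *)
Lemma at_pt_same_lead y n (u u' : pser F) x : (0 < n)%N -> (ld y)%:R != 0 :> F ->
  u 0%N != 0 -> u 0%N = u' 0%N ->
  fL (Some (chart y (tofrac (psX F ^+ n * u)))) = Some x ->
  fL (Some (chart y (tofrac (psX F ^+ n * u')))) = Some x -> u = u'.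
Proof.
move=> n0 e0 u0 uu' h h'.
have h1 : at_pt (chart y (tofrac (psX F ^+ n * u))) y n by split=> //; exists u.
have [x' [xE [_ [xi [xi0 x'E]]]]] := at_pt_map h1.
move: xE; rewrite h => -[xx']; rewrite {}xx' {}x'E mulnC in h h'.
have [g [a [b [a0 b0 gE gP]]]] := local_equation y n0 xi0.
have /gP ru := h; have /gP ru' := h'.
have gu : map_poly (@ps_const F) g = a *: 'X^(ld y) - (xi 0%N * b)%:P := gE.
apply: (@hensel_unique _ g (u 0%N)); rewrite ?uu' //; last 2 first.
- exact: ru.
- by apply: ru'; rewrite -uu'.
rewrite rootE gu derivB derivC subr0 derivZ derivXn !hornerE.
by rewrite hornerMn hornerXn -mulr_natr !mulf_neq0 // expf_neq0 // -uu'.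
Qed.

Hypothesis clF : GRing.closed_field_axiom F.

(** Each of the [ld y] roots of the reduced equation lifts by Hensel's lemma. Divisibility of [N]
    keeps the solutions in the same Laurent series field. *)
Lemma local_solutions x y N : at_pt x (f y) N -> (ld y %| N)%N -> (ld y)%:R != 0 :> F ->
  exists rs : seq lau, [/\ uniq rs, size rs = ld y &
    forall r, r \in rs -> fL (Some r) = Some x /\ at_pt r y (N %/ ld y)].
Proof.
move=> [N0 [xi [xi0 ->]]] /dvdnP[n NE] e0; have e1 := local_degree_gt0 y.
have n0 : (0 < n)%N by move: N0; rewrite NE muln_gt0 => /andP[].
rewrite NE mulnK //.
have [g [a [b [a0 b0 gE gP]]]] := local_equation y n0 xi0.
have c0 : xi 0%N * b / a != 0 by rewrite !mulf_neq0 ?invr_eq0.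
have [zs [uz sz zP]] := roots_Xn clF e0 c0.
have z0 z : z \in zs -> z != 0.
  move=> /zP; apply: contra_eq_neq => ->; rewrite expr0n gtn_eqF // eq_sym //.
have ex z : exists U : pser F, z \in zs -> U 0%N = z /\ root g U.
  have [zz|_] := boolP (z \in zs); last by exists 0.
  have [||U [UE rU]] := @hensel _ g z.
  - by rewrite rootE gE !hornerE zP // mulrC divfK // subrr.
  - rewrite rootE gE derivB derivC subr0 derivZ derivXn !hornerE.
    by rewrite hornerMn hornerXn -mulr_natr !mulf_neq0 // expf_neq0 // z0.
  - by exists U.
have [U UP] := choice ex.
exists [seq chart y (tofrac (psX F ^+ n * U z)) | z <- zs]; split.
- rewrite map_inj_in_uniq // => z z' zz zz' /chart_inj/tofrac_inj.
  move=> /(mulfI (expf_neq0 n (psX_neq0 F))) UU.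
  by rewrite -(UP z zz).1 UU (UP z' zz').1.
- by rewrite size_map.
- move=> r /mapP[z zz ->]; have [Uz rU] := UP z zz.
  have Uz0 : U z 0%N != 0 by rewrite Uz z0.
  split; first by apply/gP.
  by split=> //; exists (U z).
Qed.

End Solve.

(** * Fibres over Laurent series *)

Lemma mup_prod_XsubC (F : fieldType) (rs : seq F) c :
  mup c (\prod_(z <- rs) ('X - z%:P)) = count_mem c rs.
Proof.
have pn0 r : \prod_(z <- r) ('X - z%:P) != 0 :> {poly F}.
  by apply/monic_neq0/monic_prod_XsubC.
elim: rs => [|z rs IH]; first by rewrite big_nil mupNroot // rootE hornerC oner_eq0.
rewrite big_cons mupM ?polyXsubC_eq0 // IH /= -['X - z%:P]expr1 mup_XsubCX.
by rewrite eq_sym; case: eqP.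
Qed.

Lemma sum_count_undup (T : eqType) (rs : seq T) :
  (\sum_(z <- undup rs) count_mem z rs = size rs)%N.
Proof.
rewrite -[RHS]sum1_size [RHS](eq_big_seq (fun z => \sum_(y <- undup rs | y == z) 1)%N).
  rewrite [RHS](exchange_big_dep xpredT) //=; apply: eq_big_seq => z _.
  by rewrite -sum1_count; apply: eq_bigl => y; rewrite eq_sym.
move=> z zr; rewrite -big_filter.
have -> : [seq i <- undup rs | i == z] = [:: z].
  by rewrite (eq_filter (a2 := pred1 z)) // filter_pred1_uniq ?undup_uniq ?mem_undup.
by rewrite big_seq1.
Qed.

Lemma uniq_flatten_fibers (T : eqType) (U : eqType) (g : T -> U) (s : seq U) (h : U -> seq T) :
  uniq s -> (forall y, y \in s -> uniq (h y) /\ forall x, x \in h y -> g x = y) ->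
  uniq (flatten (map h s)).
Proof.
elim: s => //= y s IH /andP[ys us] hP.
rewrite cat_uniq (hP y _).1 ?mem_head // IH // ?andbT; last first.
  by move=> z zs; apply: hP; rewrite inE zs orbT.
apply/hasPn => x /flattenP[_ /mapP[z zs ->] xz]; apply/negP => xy.
move: ys; rewrite -((hP y _).2 x xy) ?mem_head // ((hP z _).2 x xz) ?zs //.
by rewrite inE zs orbT.
Qed.

Lemma P1map_root (E : fieldType) (P Q : {poly E}) (r x : E) :
  P1map P Q (Some r) = Some x -> Q.[r] != 0 /\ root (P - x *: Q) r.
Proof.
rewrite /P1map; case: eqP => // /eqP Q0 -[<-]; split=> //.
by rewrite rootE !hornerE divfK // subrr.
Qed.

Lemma root_P1map (E : fieldType) (P Q : {poly E}) (r x : E) : coprimep P Q ->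
  root (P - x *: Q) r -> P1map P Q (Some r) = Some x.
Proof.
move=> PQ; rewrite rootE !hornerE subr_eq0 => /eqP Px.
have Qr : Q.[r] != 0.
  apply/negP => /eqP Qr; have := coprime_nroot PQ Qr.
  by rewrite Px Qr mulr0 eqxx.
by rewrite /P1map (negPf Qr) Px mulfK.
Qed.

Lemma fiber_splits (E : fieldType) (P Q : {poly E}) (rs : seq E) (x : E) :
  coprimep P Q -> (0 < pair_degree P Q)%N -> uniq rs -> size rs = pair_degree P Q ->
  (forall r, r \in rs -> P1map P Q (Some r) = Some x) ->
  P - x *: Q = lead_coef (P - x *: Q) *: \prod_(r <- rs) ('X - r%:P).
Proof.
move=> PQ d0 urs srs rP; have n0 : P - x *: Q != 0 := fiber_neq0 PQ d0 (Some x).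
have ar : all (root (P - x *: Q)) rs.
  by apply/allP => r /rP /P1map_root[].
apply: all_roots_prod_XsubC => //; last by rewrite uniq_rootsE.
apply/eqP; rewrite eqn_leq max_poly_roots // andbT srs.
have [sP sQ] := size_pair P Q.
rewrite (leq_trans (size_polyD _ _)) // size_polyN geq_max sP.
by rewrite (leq_trans (size_scale_leq _ _)).
Qed.

Lemma split_divisor_root (E : fieldType) (c : E) (rs : seq E) (g : {poly E}) :
  c != 0 -> g %| c *: \prod_(r <- rs) ('X - r%:P) -> (1 < size g)%N ->
  exists y, root g y.
Proof.
move=> c0; rewrite dvdpZr // => /dvdp_prod_XsubC[m gE] g1.
case ms : (mask m rs) gE => [|y s] gE.
  by move: g1; rewrite (eqp_size gE) big_nil size_poly1.
by exists y; rewrite (eqp_root gE) root_prod_XsubC mem_head.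
Qed.

Section Count.
Variables (F : fieldType) (p q : {poly F}).
Hypotheses (cop : coprimep p q) (d0 : (0 < pair_degree p q)%N).
Hypothesis clF : GRing.closed_field_axiom F.
Local Notation d := (pair_degree p q).
Local Notation f := (P1map p q).
Local Notation lau := (laurent F).
Local Notation C := (map_poly (@lauC F)).
Local Notation fL := (P1map (C p) (C q)).
Local Notation ld := (pair_local_degree p q).

(** The roots of the fibre polynomial account for the finite points, its defect in degree for the
    point at infinity. *)
Lemma fiber_list (w : P1 F) : exists ys : seq (option F),
  [/\ uniq ys, forall y, y \in ys -> f y = w & (\sum_(y <- ys) ld y = d)%N].
Proof.
pose h := fiber_poly p q w; have h0 : h != 0 := fiber_neq0 cop d0 w.
have [rs rsE] := closed_axiom_split clF h.
have l0 : lead_coef h != 0 by rewrite lead_coef_eq0.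
have srs : (size h).-1 = size rs by rewrite rsE size_scale // size_prod_XsubC.
have fin c : c \in rs -> f (Some c) = w.
  move=> crs; have : root h c by rewrite rsE rootZ // root_prod_XsubC.
  rewrite /h; case: w {h h0 rsE l0 srs} => [b|] /= hc; first exact: root_P1map.
  by rewrite /P1map (eqP hc) eqxx.
have ldfin c : c \in rs -> ld (Some c) = count_mem c rs.
  move=> crs; rewrite /pair_local_degree (fin c crs) -/h rsE -mul_polyC mupMr.
    exact: mup_prod_XsubC.
  by rewrite rootE hornerC.
have [sp sq] := size_pair p q.
have sh : (size h <= d.+1)%N.
  rewrite /h; case: w {h h0 rsE l0 srs fin ldfin} => [b|] //=.
  rewrite (leq_trans (size_polyD _ _)) // size_polyN geq_max sp.
  by rewrite (leq_trans (size_scale_leq _ _)).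
have inf : (size h <= d)%N -> f None = w.
  rewrite /h /P1map; case: w {h h0 rsE l0 srs fin ldfin sh} => [b|] /= hd; last first.
    by rewrite (nth_default _ hd) eqxx.
  have := nth_default 0 hd; rewrite coefB coefZ => /subr0_eq pd.
  have [qd|qd] := eqVneq q`_d 0; last by rewrite pd mulfK.
  by have := coef_pair cop d0 qd; rewrite pd qd mulr0 eqxx.
pose ys := map Some (undup rs) ++ (if (size h <= d)%N then [:: None] else [::]).
exists ys; split.
- rewrite cat_uniq map_inj_uniq ?undup_uniq //.
  by case: ifP => _ //=; rewrite orbF andbT; apply/mapP => -[].
- move=> y; rewrite mem_cat => /orP[/mapP[c]|]; first by rewrite mem_undup => /fin + ->.
  by case: ifP => // hd; rewrite inE => /eqP ->; exact: inf.
- rewrite big_cat big_map /= (eq_big_seq (fun c => count_mem c rs)); last first.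
    by move=> c; rewrite mem_undup; exact: ldfin.
  rewrite sum_count_undup -srs; case: ifP => hd.
    rewrite big_seq1 /pair_local_degree (inf hd) -/h subnKC //.
    by rewrite -subn1 leq_subLR (leq_trans hd) // add1n.
  rewrite big_nil addn0; apply/eqP; rewrite eqn_leq -subn1 leq_subLR add1n sh /=.
  by rewrite leq_subRL ?size_poly_gt0 // add1n ltnNge hd.
Qed.

Lemma P1map_surj w : exists y, f y = w.
Proof.
have [[|y ys] [_ yP dE]] := fiber_list w; last by exists y; apply: yP; rewrite mem_head.
by move: d0; rewrite -dE big_nil.
Qed.

(** The local solutions over the points of the fibre of [w] number [d] in total, so no preimage of
    [x] is missing. *)
Lemma full_fiber x w N : at_pt x w N ->
  (forall y, f y = w -> (ld y %| N)%N /\ (ld y)%:R != 0 :> F) ->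
  exists rs : seq lau, [/\ uniq rs, size rs = d &
    forall r, r \in rs -> fL (Some r) = Some x /\
      exists y n, [/\ at_pt r y n, f y = w & (n * ld y = N)%N]].
Proof.
move=> xw yN; have [ys [uys yP dE]] := fiber_list w.
have ex (y : option F) : exists rs : seq lau, y \in ys -> [/\ uniq rs, size rs = ld y &
    forall r, r \in rs -> fL (Some r) = Some x /\ at_pt r y (N %/ ld y)].
  have [/yP fy|_] := boolP (y \in ys); last by exists [::].
  have [dN e0] := yN y fy; rewrite -fy in xw.
  by have [rs rsP] := local_solutions cop d0 clF xw dN e0; exists rs.
have [sol solP] := choice ex.
(* The point to which a series reduces; it separates the solutions found over different [y]. *)
have ex2 (r : lau) : exists y : option F, forall y' N', at_pt r y' N' -> y = y'.
  have [[y [n rn]]|nr] := pselect (exists y n, at_pt r y n).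
    by exists y => y' N' /(at_pt_unique rn)[].
  by exists None => y' N' ry; case: nr; exists y', N'.
have [red redP] := choice ex2.
exists (flatten (map sol ys)); split.
- apply: (uniq_flatten_fibers (g := red)) => // y /solP[us _ rP]; split=> // r /rP[_ /redP].
  exact.
- rewrite size_flatten /shape -map_comp sumnE big_map -dE.
  by apply: eq_big_seq => y /= /solP[].
- move=> r /flattenP[_ /mapP[y yys ->]]; have [_ _ rP] := solP y yys.
  move=> /rP[fr rN]; split=> //; exists y, (N %/ ld y)%N; split=> //; first exact: yP.
  by rewrite divnK //; have [] := yN y (yP y yys).
Qed.

End Count.

(** * Automorphisms of a separable closure *)

Lemma P1map_map (E E' : fieldType) (g : {rmorphism E -> E'}) (P Q : {poly E}) (z : P1 E) :
  P1map (map_poly g P) (map_poly g Q) (omap g z) = omap g (P1map P Q z).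
Proof.
have dE : pair_degree (map_poly g P) (map_poly g Q) = pair_degree P Q.
  by rewrite /pair_degree !size_map_poly.
rewrite /P1map dE; case: z => [x|] /=.
  rewrite !horner_map fmorph_eq0; case: ifP => //= _.
  by rewrite fmorph_div.
by rewrite !coef_map fmorph_eq0; case: ifP => //= _; rewrite fmorph_div.
Qed.

Lemma coprime_numer_denom (K : fieldType) (f : {fraction {poly K}}) :
  coprimep (numer f) (denom f).
Proof.
rewrite /numer /denom; apply/Bezout_coprimepP.
set a := (frac _).1; set b := (frac _).2; have b0 : b != 0 := denom_ratioP _.
have [[u v] /= uv] := Bezoutp a b; exists (u, v) => /=.
have g0 : gcdp a b != 0 by rewrite gcdp_eq0 (negPf b0) andbF.
rewrite -(eqp_mul2r _ _ g0) mul1r mulrDl -!mulrA !divpK ?dvdp_gcdl ?dvdp_gcdr //.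
Qed.

Lemma poly_root_seq (E : idomainType) (P : {poly E}) : P != 0 ->
  exists rs : seq E, uniq rs /\ forall y, (y \in rs) = root P y.
Proof.
elim: {P}(size P) {-2}P (leqnn (size P)) => [|n IH] Q sQ Q0.
  by move: sQ; rewrite leqn0 size_poly_eq0 (negPf Q0).
have [[y yQ]|nr] := pselect (exists y, root Q y); last first.
  by exists [::]; split=> // y; apply/esym/negP => yQ; apply: nr; exists y.
have /factor_theorem[q qE] := yQ.
have q0 : q != 0 by apply: contraNneq Q0 => q0; rewrite qE q0 mul0r.
have [|rs [urs rsP]] := IH q _ q0.
  by move: sQ; rewrite qE size_mul ?polyXsubC_eq0 // size_XsubC addn2.
exists (undup (y :: rs)); split; first exact: undup_uniq.
by move=> z; rewrite mem_undup inE qE rootM root_XsubC -rsP orbC.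
Qed.

Section SepExtension.
Variables (k M : fieldType) (j : {rmorphism k -> M}) (hM : is_sep_closure j).

(** A maximal common extension of [g] and [h] has all of [M] as its source: every element of [M] is
    a root of a separable polynomial over [k], whose nonconstant divisors have roots in [M]. *)
Lemma sep_closure_extension (D : fieldType) (i : {rmorphism k -> D})
    (g h : {rmorphism D -> M}) : (forall a, g (i a) = j a) ->
  exists s : {rmorphism M -> M}, forall b, s (g b) = h b.
Proof.
move=> gi; have [D' [i' [k1 [k2 [k1E k2E ext]]]]] := embedding_extension g h.
have surj x : exists b, k1 b = x.
  have [P sP Px] := hM.1 x.
  apply: (ext x (map_poly (i' \o i) P)).
  - by rewrite map_poly_eq0 separable_poly_neq0.
  - rewrite -map_poly_comp (eq_map_poly (g := j)) // => a /=.
    by rewrite k1E gi.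
  - move=> q qP q1; apply: hM.2 => //; apply: dvdp_separable qP _.
    by rewrite !separable_map.
have [r rE] := rmorph_factor (i := idfun) surj.
exists (k2 \o r) => b; rewrite -[LHS]/(k2 (r (g b))) -k2E; congr (k2 _).
by apply: (fmorph_inj k1); rewrite rE k1E.
Qed.

(** [s] is injective and preserves the finite set of roots of a polynomial over [k], hence permutes
    it. *)
Lemma sep_closure_aut_surj (s : {rmorphism M -> M}) : (forall a, s (j a) = j a) ->
  forall x, exists y, s y = x.
Proof.
move=> sj x; have [P sP Px] := hM.1 x; pose PM := map_poly j P.
have P0 : PM != 0 by rewrite map_poly_eq0 separable_poly_neq0.
have sPM : map_poly s PM = PM.
  by rewrite -map_poly_comp; apply: eq_map_poly => a /=.
have [rs [urs rsP]] := poly_root_seq P0.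
have sub y : y \in map s rs -> y \in rs.
  by move=> /mapP[z]; rewrite !rsP => rz ->; rewrite -sPM; apply: rmorph_root.
have us : uniq (map s rs) by rewrite map_inj_uniq //; exact: fmorph_inj.
have [|_ E] := uniq_min_size us sub; first by rewrite size_map.
have : x \in map s rs by rewrite E rsP.
by move=> /mapP[y _ ->]; exists y.
Qed.

Lemma sep_closure_aut_inv (s : {rmorphism M -> M}) : (forall a, s (j a) = j a) ->
  exists r : {rmorphism M -> M},
    [/\ cancel s r, cancel r s & forall a, r (j a) = j a].
Proof.
move=> sj.
have [r rE] := rmorph_factor (i := idfun) (sep_closure_aut_surj sj).
have rK : cancel s r by move=> x; apply: (fmorph_inj s); rewrite rE.
by exists r; split=> // a; rewrite -{1}sj rK.
Qed.

End SepExtension.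

(** * The tree of iterated preimages *)

Section Dynamics.
Variables (K : fieldType) (f : {fraction {poly K}}) (L : fieldType)
  (iL : {rmorphism K -> L}) (M : fieldType)
  (j : {rmorphism {fraction {poly L}} -> M}) (hM : is_sep_closure j)
  (lam : labeling f iL j).
Local Notation d := (ratdeg f).
Local Notation t := (tvar j).
Local Notation ev := (const_emb iL j).
Local Notation fM := (ratmap ev f).
Local Notation V := (preimages f iL j).

Definition const_rm : {rmorphism K -> M} := j \o @tofrac _ \o @polyC L \o iL.

Lemma map_const (P : {poly K}) : map_poly ev P = map_poly const_rm P.
Proof. by []. Qed.

Lemma tvar_nconst (c : L) : t <> j (tofrac c%:P).
Proof.
move=> /fmorph_inj/tofrac_inj/(congr1 (fun p : {poly L} => size p)).
by rewrite size_polyX size_polyC; case: eqP.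
Qed.

Lemma ratmap_equivariant (s : {rmorphism M -> M}) :
  (forall c : L, s (j (tofrac c%:P)) = j (tofrac c%:P)) ->
  forall n z, iter n fM (omap s z) = omap s (iter n fM z).
Proof.
move=> sc; elim=> //= n IH z; rewrite IH -P1map_map /ratmap.
by congr P1map; rewrite map_const -map_poly_comp; apply: eq_map_poly => c;
  rewrite /= sc.
Qed.

(** Infinity has an orbit of constants. As [t] is not constant, no path from a preimage down to [t]
    passes through infinity, and vertices can be treated as elements of [M]. *)
Lemma iter_None_const n (z : M) : iter n fM None = Some z -> exists c : L, z = j (tofrac c%:P).
Proof.
have E k : iter k fM None = omap const_rm (iter k (P1map (numer f) (denom f)) None).
  by elim: k => //= k ->; rewrite /ratmap !map_const P1map_map.
by rewrite E; case: (iter _ _ _) => //= a [<-]; exists (iL a).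
Qed.

Lemma orbit_split k l s x : (forall c : L, x <> j (tofrac c%:P)) ->
  iter (k + l) fM (Some s) = Some x ->
  exists s', iter l fM (Some s) = Some s' /\ iter k fM (Some s') = Some x.
Proof.
rewrite iterD => xc; case E : (iter l fM (Some s)) => [s'|] h; first by exists s'.
by have [c /xc] := iter_None_const h.
Qed.

(** The isomorphism carrying the tree over [t] onto the subtree over the vertex labelled [w]; [pt]
    is the inverse of the labeling. *)
Fixpoint Lam (w : word d) : {rmorphism M -> M} :=
  if w is x :: w' then lab_iso lam x \o Lam w' else idfun.

Definition pt (w : word d) : M := Lam w t.

Lemma Lam_cat u w x : Lam (u ++ w) x = Lam u (Lam w x).
Proof. by elim: u => //= a u IH; rewrite IH. Qed.

Lemma Lam_const w (c : L) : Lam w (j (tofrac c%:P)) = j (tofrac c%:P).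
Proof. by elim: w => //= a w ->; exact: lab_iso_const. Qed.

Lemma Lam_inv w : exists r : {rmorphism M -> M}, [/\ cancel (Lam w) r, cancel r (Lam w) &
  forall c : L, r (j (tofrac c%:P)) = j (tofrac c%:P)].
Proof.
have surj x : exists y, Lam w y = x.
  elim: w x => [|a w IH] x; first by exists x.
  by have [y yE] := IH (lab_inv lam a x); exists y; rewrite /= yE lab_invK.
have [r rE] := rmorph_factor (i := idfun) surj.
have rK : cancel (Lam w) r by move=> x; apply: (fmorph_inj (Lam w)); rewrite rE.
by exists r; split=> // c; rewrite -{1}(Lam_const w) rK.
Qed.

Lemma lab_pt_V x : fM (Some (lab_pt lam x)) = Some t.
Proof. by have [h _ _] := lab_pt_bij lam; exact: (h x I). Qed.

Lemma lab_pt_inj : injective (lab_pt lam).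
Proof.
move=> x y xy; have [_ h _] := lab_pt_bij lam.
by apply: h; rewrite ?in_setT ?inE.
Qed.

Lemma lab_pt_surj s : fM (Some s) = Some t -> exists x, lab_pt lam x = s.
Proof. by move=> h; have [_ _ /(_ s h)[x _ <-]] := lab_pt_bij lam; exists x. Qed.

Lemma Lam_iter u n z : iter n fM (omap (Lam u) z) = omap (Lam u) (iter n fM z).
Proof. by apply: ratmap_equivariant; exact: Lam_const. Qed.

Lemma pt_cat_iter u w : iter (size w) fM (Some (pt (u ++ w))) = Some (pt u).
Proof.
have base v : iter (size v) fM (Some (pt v)) = Some t.
  elim: v => //= a v IH.
  rewrite /pt /= -/(pt v) -[Some _]/(omap (lab_iso lam a) (Some (pt v))).
  rewrite (ratmap_equivariant (lab_iso_const lam a)) IH /= lab_iso_t.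
  exact: lab_pt_V.
by rewrite /pt Lam_cat -[Some _]/(omap (Lam u) (Some (pt w))) Lam_iter base.
Qed.

Lemma pt_V w : V (size w) t (pt w).
Proof. exact: (pt_cat_iter [::] w). Qed.

Lemma pt_cons_iter x w :
  iter (size w) fM (Some (pt (x :: w))) = Some (lab_pt lam x).
Proof. by have := pt_cat_iter [:: x] w; rewrite /pt /= lab_iso_t. Qed.

Lemma pt_inj u w : size u = size w -> pt u = pt w -> u = w.
Proof.
elim: u w => [|x u IH] [|y w] //= [suw] uw.
have := pt_cons_iter x u; rewrite uw suw pt_cons_iter => -[/lab_pt_inj yx].
rewrite yx in uw *; congr (_ :: _); apply: IH => //.
by move: uw; rewrite /pt /= => /fmorph_inj.
Qed.

Lemma pt_surj n s : V n t s -> exists w, size w = n /\ pt w = s.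
Proof.
elim: n s => [|n IH] s; first by move=> [->]; exists [::].
move=> h; have [t' [ht' /= ht]] := @orbit_split 1 n s t tvar_nconst h.
have [x xE] := lab_pt_surj ht.
have [|w [wn wE]] := IH (lab_inv lam x s); last first.
  by exists (x :: w); rewrite /= wn /pt /= -/(pt w) wE lab_invK.
have := ht'; rewrite -xE -lab_iso_t -{1}(lab_invK lam x s).
rewrite -[Some (lab_iso _ _ _)]/(omap (lab_iso lam x) (Some (lab_inv lam x s))).
rewrite (ratmap_equivariant (lab_iso_const lam x)) /preimages /=.
by case: (iter _ _ _) => //= y [/fmorph_inj ->].
Qed.

Lemma lab_word_pt w : lab_word lam (size w) (pt w) = w.
Proof.
elim: w => // x w IH; have hx := pt_cons_iter x w.
have -> : lab_word lam (size (x :: w)) (pt (x :: w)) =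
    if [pick y | `[< V (size w) (lab_pt lam y) (pt (x :: w)) >]] is Some y
    then y :: lab_word lam (size w) (lab_inv lam y (pt (x :: w))) else [::] by [].
case: pickP => [y /asboolP|/(_ x)/negP[]]; last by apply/asboolP.
rewrite /preimages /= hx => -[/lab_pt_inj <-].
by rewrite /pt /= lab_isoK -/(pt w) IH.
Qed.

Definition gal_auto (s : {rmorphism M -> M}) : Prop := forall a, s (j a) = j a.

Lemma gal_t (s : {rmorphism M -> M}) : gal_auto s -> s t = t.
Proof. by move=> sg; exact: sg. Qed.

Lemma gal_iter (s : {rmorphism M -> M}) : gal_auto s -> forall n z, iter n fM (omap s z) = omap s (iter n fM z).
Proof. by move=> sg; apply/ratmap_equivariant => c; exact: sg. Qed.

Lemma galI (s : {rmorphism M -> M}) : (forall c : L, s (j (tofrac c%:P)) = j (tofrac c%:P)) -> s t = t -> gal_auto s.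
Proof.
move=> sc st a; have [p [q [q0 ->]]] := frac_numden a.
have sp (r : {poly L}) : s (j (tofrac r)) = j (tofrac r).
  pose g := (j \o @tofrac {poly L} : {rmorphism _ -> _}).
  suff : (s \o g) r = g r by [].
  rewrite -[r]coefK poly_def !rmorph_sum; apply: eq_bigr => i _.
  rewrite -mul_polyC !rmorphM !rmorphXn /= sc; congr (_ * _ ^+ _).
  exact: st.
by rewrite !fmorph_div !sp.
Qed.

Definition acts_by (s : {rmorphism M -> M}) (g : word d -> word d) : Prop :=
  forall w, size (g w) = size w /\ s (pt w) = pt (g w).

Lemma acts_exists (s : {rmorphism M -> M}) : gal_auto s -> exists g, acts_by s g.
Proof.
move=> sg; have ex w : exists w', size w' = size w /\ s (pt w) = pt w'.
  have [|w' [sw wE]] := @pt_surj (size w) (s (pt w)); last by exists w'.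
  rewrite /preimages /= -[Some (s _)]/(omap s (Some (pt w))) gal_iter //.
  by rewrite pt_V /= gal_t.
by have [g gP] := choice ex; exists g.
Qed.

Lemma acts_cat s g u w : gal_auto s -> acts_by s g -> exists w', g (u ++ w) = g u ++ w'.
Proof.
move=> sg gP; have [su _] := gP u; have [suw gE] := gP (u ++ w).
pose u1 := take (size u) (g (u ++ w)); pose w1 := drop (size u) (g (u ++ w)).
have E : g (u ++ w) = u1 ++ w1 by rewrite cat_take_drop.
have sw1 : size w1 = size w by rewrite size_drop suw size_cat addKn.
have su1 : size u1 = size u by rewrite size_takel // suw size_cat leq_addr.
exists w1; rewrite E; congr (_ ++ _); apply: pt_inj; first by rewrite su1 su.
have := pt_cat_iter u1 w1; rewrite -E -gE -[Some (s _)]/(omap s (Some (pt (u ++ w)))).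
by rewrite gal_iter // sw1 pt_cat_iter /= (gP u).2 => -[->].
Qed.

Lemma acts_section s g u w : gal_auto s -> acts_by s g ->
  g (u ++ w) = g u ++ section g u w.
Proof.
move=> sg gP; have [w' E] := acts_cat u w sg gP.
by rewrite /section E drop_size_cat // (gP u).1.
Qed.

End Dynamics.

Lemma subfield_mem (M : fieldType) (S : set M) x : x \in gen_subfield S ->
  exists b : subfield_of S, \val b = x.
Proof. by move=> xS; exists (exist (fun x => x \in gen_subfield S) x xS). Qed.

(** * The iterated Galois group and its self-similarity *)

Section Fractal.
Variables (K : fieldType) (f : {fraction {poly K}}) (L : fieldType)
  (iL : {rmorphism K -> L}) (M : fieldType)
  (j : {rmorphism {fraction {poly L}} -> M}) (hM : is_sep_closure j)
  (lam : labeling f iL j).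
Local Notation d := (ratdeg f).
Local Notation t := (tvar j).
Local Notation fM := (ratmap (const_emb iL j) f).
Local Notation V := (preimages f iL j).
Local Notation pt := (pt lam).
Local Notation Lam := (Lam lam).
Local Notation acts_by := (acts_by lam).
Local Notation G := (G_infty lam).

Lemma gal_comp (s r : {rmorphism M -> M}) : gal_auto j s -> gal_auto j r ->
  gal_auto j (s \o r : {rmorphism M -> M}).
Proof. by move=> sg rg a /=; rewrite rg sg. Qed.

Lemma acts_comp (s r : {rmorphism M -> M}) g h : acts_by s g -> acts_by r h ->
  acts_by (s \o r : {rmorphism M -> M}) (g \o h).
Proof.
move=> gP hP w /=; have [sh hE] := hP w; have [sg gE] := gP (h w).
by rewrite sg sh hE gE.
Qed.

Lemma acts_cancel (s r : {rmorphism M -> M}) g h : acts_by s g -> acts_by r h ->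
  cancel s r -> cancel g h.
Proof.
move=> gP hP sr w; have E : (r \o s : {rmorphism M -> M}) =1 idfun by move=> x /=.
have hg := acts_comp hP gP.
have [sw wE] := hg w; apply: (pt_inj (lam := lam)) => //.
by rewrite -[h (g w)]/((h \o g) w) -wE E.
Qed.

Lemma acts_tree_aut (s : {rmorphism M -> M}) g : gal_auto j s -> acts_by s g -> tree_aut g.
Proof.
move=> sg gP; have [r [sr rs rg]] := sep_closure_aut_inv hM sg.
have [h hP] := acts_exists lam rg.
have gh := acts_cancel gP hP sr; have hg := acts_cancel hP gP rs.
have adj (s' : {rmorphism M -> M}) g' u v : gal_auto j s' -> acts_by s' g' ->
    Defs.adjacent u v -> Defs.adjacent (g' u) (g' v).
  move=> s'g g'P; wlog [x ->] : u v / exists x, v = rcons u x.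
    move=> wl [] E; first by apply: wl => //; left.
    by have [] := wl v u E (or_introl E); [right|left].
  move=> _; left; rewrite -cats1; have [w' E] := acts_cat u [:: x] s'g g'P.
  have := (g'P (u ++ [:: x])).1; rewrite E !size_cat (g'P u).1 => /addnI.
  by case: w' {E} => [|y [|]] //= _; exists y; rewrite cats1.
split; first by exists h.
- by apply: size0nil; rewrite (gP [::]).1.
- move=> u v; split; last exact: adj.
  by move=> /(adj _ _ _ _ rg hP); rewrite !gh.
Qed.

Lemma K_infty_embed : exists i : {rmorphism {fraction {poly L}} -> K_infty f iL j},
  forall a, \val (i a) = j a.
Proof.
apply: (@rmorph_factor _ _ _ j (\val : {rmorphism K_infty f iL j -> M})) => a.
apply: subfield_mem.
by apply/asboolP => k kc kS; apply: kS; left; exists a.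
Qed.

Lemma V_K_infty n s : V n t s -> exists b : K_infty f iL j, \val b = s.
Proof.
move=> sV; apply: subfield_mem.
by apply/asboolP => k kc kS; apply: kS; right; exists n.
Qed.

Lemma gal_K_infty_stable (s : {rmorphism M -> M}) : gal_auto j s ->
  exists r : {rmorphism K_infty f iL j -> K_infty f iL j},
    forall b, \val (r b) = s (\val b).
Proof.
move=> sg; set S := range j `|` \bigcup_(n in [set: nat]) V n t.
have st x : x \in gen_subfield S -> s x \in gen_subfield S.
  move=> /asboolP/(_ (fun y => s y \in gen_subfield S)); apply.
    have [k1 kB kV] := gen_subfield_divring_closed S.
    split; first by rewrite unfold_in rmorph1.
    - by move=> y z; rewrite !unfold_in rmorphB; exact: kB.
    - by move=> y z; rewrite !unfold_in fmorph_div; exact: kV.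
  move=> y [[a _ <-]|[n _ yV]]; apply/asboolP => k kc kS; apply: kS.
    by left; exists a; rewrite ?sg.
  right; exists n => //; rewrite /preimages /= -[Some (s y)]/(omap s (Some y)).
  by rewrite gal_iter // yV /= gal_t.
pose sK : {rmorphism K_infty f iL j -> M} := s \o (\val : {rmorphism K_infty f iL j -> M}).
have ex c : exists b : K_infty f iL j, (\val : {rmorphism _ -> M}) b = sK c.
  exact/subfield_mem/st/valP.
by have [r rE] := rmorph_factor ex; exists r => b; rewrite rE.
Qed.

(** Automorphisms of [M] replace those of [K_infty] from here on. The latter extend because [M] is
    separably closed; the former restrict because [K_infty] is generated by sets stable under
    them. *)
Lemma G_inftyP g : G g <-> exists2 s : {rmorphism M -> M}, gal_auto j s & acts_by s g.
Proof.
have [i iE] := K_infty_embed; split.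
  move=> [_ [s0 [_ s0j] s0g]].
  pose v : {rmorphism K_infty f iL j -> M} := \val.
  have [s sE] := sep_closure_extension hM (v \o s0) iE.
  have sg : gal_auto j s.
    by move=> a; rewrite -iE (sE (i a)) /= (s0j a (i a) (iE a)) iE.
  exists s => // w; have [b bE] := V_K_infty (pt_V lam w).
  have := s0g (size w) b; rewrite bE => /(_ (pt_V lam w)).
  rewrite lab_word_pt => ->.
  have sb : \val (s0 b) = s (pt w) by rewrite -bE (sE b).
  have [h hP] := acts_exists lam sg; have [hw hE] := hP w.
  by rewrite sb hE -hw lab_word_pt.
move=> [s sg gP]; split; first exact: acts_tree_aut gP.
have [r [sr rs rg]] := sep_closure_aut_inv hM sg.
have [s0 s0E] := gal_K_infty_stable sg; have [r0 r0E] := gal_K_infty_stable rg.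
exists s0; first split.
- by exists r0 => b; apply: val_inj; rewrite /= ?r0E ?s0E ?r0E ?sr ?rs.
- by move=> a x xE; apply: val_inj; rewrite s0E xE sg.
- move=> n b bV; have [w [wn wE]] := pt_surj lam bV.
  by rewrite s0E -wE (gP w).2 -wn lab_word_pt -(gP w).1 lab_word_pt.
Qed.

(* Conjugating by the labeling isomorphisms turns automorphisms fixing a vertex
   into automorphisms of the subtree above it. *)
Lemma gal_section (s : {rmorphism M -> M}) g v : gal_auto j s -> acts_by s g ->
  exists s' : {rmorphism M -> M}, [/\ gal_auto j s', acts_by s' (section g v) &
    forall x, s (Lam v x) = Lam (g v) (s' x)].
Proof.
move=> sg gP; have [r [_ Lr rc]] := Lam_inv lam (g v).
pose s' : {rmorphism M -> M} := r \o (s \o Lam v).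
have sE x : s (Lam v x) = Lam (g v) (s' x) by rewrite /= Lr.
exists s'; split=> //.
  apply: galI; first by move=> c /=; rewrite Lam_const (sg (tofrac c%:P)) rc.
  apply: (fmorph_inj (Lam (g v))); rewrite -sE.
  by rewrite -/(pt v) (gP v).2.
move=> w; have cE := acts_section v w sg gP; split.
  have := (gP (v ++ w)).1; rewrite cE !size_cat (gP v).1 => /addnI //.
apply: (fmorph_inj (Lam (g v))); rewrite -sE -!Lam_cat.
by rewrite -[LHS]/(s (pt (v ++ w))) (gP _).2 cE.
Qed.

(** Conjugation by [Lam v] in the opposite direction. The conjugate fixes the constants and [pt v],
    hence also [t], which is an iterate of [pt v]. *)
Lemma gal_lift (s : {rmorphism M -> M}) g v : gal_auto j s -> acts_by s g ->
  exists (s' : {rmorphism M -> M}) h, [/\ gal_auto j s', acts_by s' h,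
    forall x, s' (Lam v x) = Lam v (s x), h v = v & forall w, h (v ++ w) = v ++ g w].
Proof.
move=> sg gP; have [r [rL Lr rc]] := Lam_inv lam v.
pose s' : {rmorphism M -> M} := Lam v \o (s \o r).
have sE x : s' (Lam v x) = Lam v (s x) by rewrite /= rL.
have s'v : s' (pt v) = pt v by rewrite /pt sE gal_t.
have s'c (c : L) : s' (j (tofrac c%:P)) = j (tofrac c%:P).
  by rewrite /= rc (sg (tofrac c%:P)) Lam_const.
have s'g : gal_auto j s'.
  apply: galI => //; apply: Some_inj.
  have : iter (size v) fM (omap s' (Some (pt v))) = omap s' (iter (size v) fM (Some (pt v))).
    exact: ratmap_equivariant.
  by rewrite -[omap s' (Some (pt v))]/(Some (s' (pt v))) s'v (pt_V lam v) => ->.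
have [h hP] := acts_exists lam s'g.
have hv w : h (v ++ w) = v ++ g w.
  apply: (pt_inj (lam := lam)); first by rewrite (hP _).1 !size_cat (gP w).1.
  by rewrite -(hP _).2 /pt !Lam_cat sE -/(pt w) (gP w).2.
exists s', h; split=> //.
by have := hv [::]; rewrite cats0 (size0nil (gP [::]).1) cats0.
Qed.

Lemma G_fractal : fractal G.
Proof.
have secG g v : G g -> G (section g v).
  move=> /G_inftyP[s sg gP]; have [s' [s'g gP' _]] := gal_section v sg gP.
  by apply/G_inftyP; exists s'.
split=> //.
- move=> u v suv; have [r [rL Lr rc]] := Lam_inv lam u.
  (* This isomorphism sends [pt u] to [pt v]; as both lie at the same level over [t], it fixes
     [t]. *)
  pose s : {rmorphism M -> M} := Lam v \o r.
  have suE : s (pt u) = pt v by rewrite /= rL.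
  have sc (c : L) : s (j (tofrac c%:P)) = j (tofrac c%:P) by rewrite /= rc Lam_const.
  have sg : gal_auto j s.
    apply: galI => //; apply: Some_inj.
    have : iter (size u) fM (omap s (Some (pt u))) = omap s (iter (size u) fM (Some (pt u))).
      exact: ratmap_equivariant.
    rewrite -[omap s (Some (pt u))]/(Some (s (pt u))) suE (pt_V lam u).
    by rewrite suv (pt_V lam v) => ->.
  have [g gP] := acts_exists lam sg; exists g; first by apply/G_inftyP; exists s.
  by apply: (pt_inj (lam := lam)); rewrite ?(gP u).1 // -(gP u).2.
- move=> v; apply/seteqP; split.
    by move=> _ [h [hG hv] <-]; exact: secG.
  move=> g /G_inftyP[s sg gP]; have [s' [h [s'g hP _ hv hE]]] := gal_lift v sg gP.
  exists h; first by split=> //; apply/G_inftyP; exists s'.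
  by apply/funext => w; rewrite /section hE drop_size_cat.
Qed.

End Fractal.

(** * Sections of level stabilizers *)

Section TreeGroup.
Variables (d : nat) (G : set (word d -> word d)).
Hypotheses (G1 : G id) (Gcomp : forall g h, G g -> G h -> G (g \o h))
  (Ginv : forall g, G g -> exists h, [/\ G h, cancel g h & cancel h g])
  (Gsize : forall g w, G g -> size (g w) = size w)
  (Gcat : forall g u w, G g -> exists w', g (u ++ w) = g u ++ w').

Lemma level_stab_mono n k h : (n <= k)%N -> level_stab G k h -> level_stab G n h.
Proof.
(* In general [v] is prolonged to level [k] by a fixed letter; with an empty alphabet only the empty
   word exists. *)
move=> nk [Gh hk]; split=> // v vn; case: d v vn G Gcat Gsize h Gh hk => [|d'] v vn G' Gcat' Gsize' h Gh hk.
  case: v vn => [|[]//] n0; have := Gsize' h [::] Gh.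
  by case: (h [::]).
pose u := v ++ nseq (k - n) ord0.
have := hk u; rewrite size_cat size_nseq vn subnKC // => /(_ erefl).
have [w' E] := Gcat' _ v (nseq (k - n) ord0) Gh; rewrite /u E.
move/(congr1 (take (size v))); rewrite !take_size_cat //; exact: Gsize'.
Qed.

Lemma level_stab_conj n q q' h : G q -> G q' -> cancel q' q -> level_stab G n h ->
  level_stab G n (q \o h \o q').
Proof.
move=> Gq Gq' qK [Gh hn]; split; first by do 2!apply: Gcomp.
by move=> v vn; rewrite /= hn ?qK // Gsize.
Qed.

Lemma level_stab_comp n g h : level_stab G n g -> level_stab G n h -> level_stab G n (g \o h).
Proof.
by move=> [Gg gn] [Gh hn]; split=> [|v vn]; [exact: Gcomp | rewrite /= hn ?gn].
Qed.

Lemma level_stab_inv n g h : G h -> cancel g h -> level_stab G n g -> level_stab G n h.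
Proof. by move=> Gh gK [_ gn]; split=> // v vn; rewrite -{1}(gn v vn) gK. Qed.

(** Induction on the length of [w]: once all letters but the last agree, the last one is corrected
    by an element fixing the whole level just above it, which disturbs nothing before. *)
Lemma level_stab_transitive :
  (forall n v x y, size v = n -> exists2 h, level_stab G n h & h (rcons v x) = rcons v y) ->
  forall k n u w w', size u = n -> size w = k -> size w' = k ->
    exists2 h, level_stab G n h & h (u ++ w) = u ++ w'.
Proof.
move=> tr; elim=> [|k IH] n u w w' un; first by do 2!move/size0nil => ->; exists id.
case/lastP: w => [//|w x]; rewrite size_rcons => -[wk].
case/lastP: w' => [//|w' y]; rewrite size_rcons => -[wk'].
have [h hn hE] := IH n u w w' un wk wk'.
have [w1 w1E] := Gcat (u ++ w) [:: x] hn.1; rewrite cats1 hE in w1E.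
have sw1 : size w1 = 1%N.
  have := congr1 size w1E; rewrite Gsize ?size_rcons; last exact: hn.1.
  by rewrite !size_cat wk wk' -addn1 => /addnI.
case: w1 w1E sw1 => [|x' []] // w1E _; rewrite cats1 in w1E.
have [h' hn' hE'] := tr (n + k)%N (u ++ w') x' y (ltac:(by rewrite size_cat un wk')).
exists (h' \o h); first by apply: level_stab_comp hn; apply: level_stab_mono hn'; rewrite leq_addr.
by rewrite /= -!rcons_cat w1E hE'.
Qed.

(** Only the action of [g] down to level [m] is constrained, but the set is kept inside [G], where
    it is a normal subgroup and its elements come from automorphisms of [M]. *)
Definition level_sections n v m : set (word d -> word d) :=
  [set g | G g /\ exists2 h, stab (level_stab G n) v h &
    forall w, (size w <= m)%N -> h (v ++ w) = v ++ g w].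

Lemma level_sections1 n v m : level_sections n v m id.
Proof. by split=> //; exists id. Qed.

Lemma level_sections_comp n v m g h :
  level_sections n v m g -> level_sections n v m h -> level_sections n v m (g \o h).
Proof.
move=> [Gg [g' [g'n g'v] g'E]] [Gh [h' [h'n h'v] h'E]]; split; first exact: Gcomp.
exists (g' \o h'); first by split; [exact: level_stab_comp | rewrite /= h'v].
by move=> w wm; rewrite /= h'E // g'E // Gsize.
Qed.

Lemma level_sections_inv n v m g h : G h -> cancel g h -> cancel h g ->
  level_sections n v m g -> level_sections n v m h.
Proof.
move=> Gh gK hK [Gg [g' [g'n g'v] g'E]]; split=> //.
have [h' [Gh' g'K h'K]] := Ginv g'n.1.
exists h'; first by split; [exact: level_stab_inv g'n | rewrite -{1}g'v g'K].
by move=> w wm; rewrite -{1}(hK w) -g'E ?g'K // Gsize.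
Qed.

Hypothesis Glift : forall g v, G g -> exists h, [/\ G h & forall w, h (v ++ w) = v ++ g w].

(** The lift of [q] below [v] conjugates the witness [g'], and level stabilizers are normal. *)
Lemma level_sections_conj n v m g q q' : G q -> G q' -> cancel q q' -> cancel q' q ->
  level_sections n v m g -> level_sections n v m (q \o g \o q').
Proof.
move=> Gq Gq' qK q'K [Gg [g' [g'n g'v] g'E]]; split; first by do 2!apply: Gcomp.
have [Q [GQ QE]] := Glift v Gq; have [Q' [GQ' QK Q'K]] := Ginv GQ.
have Q'E w : Q' (v ++ w) = v ++ q' w by rewrite -{1}(q'K w) -QE QK.
have qnil g0 : G g0 -> g0 [::] = [::] by move=> G0; apply/nilP; rewrite /nilp Gsize.
exists (Q \o g' \o Q').
  split; first exact: level_stab_conj g'n.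
  rewrite /= -{1}(cats0 v) Q'E qnil // cats0 g'v -{1}(cats0 v) QE qnil // cats0 //.
by move=> w wm; rewrite /= Q'E g'E ?Gsize // QE.
Qed.

(* The commutator of a lift of [q] with an [h] moving [v1 v'] to [v1 v2] acts as [q] below
   [v1 v2], since [q] is trivial below [v']. *)
Lemma commutator_section n v1 v2 v' m g q : (n <= size v1)%N -> size v' = size v2 ->
  (forall k u w w', size w = k -> size w' = k ->
    exists2 h, level_stab G (size u) h & h (u ++ w) = u ++ w') ->
  G g -> G q -> (forall w, q (v2 ++ w) = v2 ++ g w) ->
  (forall w, (size w <= m)%N -> q (v' ++ w) = v' ++ w) ->
  level_sections n (v1 ++ v2) m g.
Proof.
move=> nv1 sv tr Gg Gq q2 q'; split=> //.
have [Q [GQ QE]] := Glift v1 Gq; have [Q' [GQ' QK Q'K]] := Ginv GQ.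
have [h hn hE] := tr _ v1 v' v2 sv erefl.
have [h' [Gh' hK h'K]] := Ginv hn.1.
have hn' := level_stab_mono nv1 hn.
have kn : level_stab G n (Q \o h \o Q' \o h').
  apply: level_stab_comp; first exact: level_stab_conj hn'.
  exact: level_stab_inv hn'.
have kE w : (size w <= m)%N -> (Q \o h \o Q' \o h') ((v1 ++ v2) ++ w) = (v1 ++ v2) ++ g w.
  move=> wm; have [w' w'E] := Gcat (v1 ++ v2) w Gh'.
  have sw : size w' = size w.
    have := congr1 size w'E; rewrite Gsize // !size_cat (Gsize _ Gh') size_cat.
    by move/addnI.
  rewrite -hE hK in w'E.
  have Q'w : Q' (v1 ++ (v' ++ w')) = v1 ++ (v' ++ w').
    by rewrite -{1}(q' w') ?sw // -QE QK.
  rewrite /= -hE w'E -catA Q'w catA -w'E h'K hE -!catA QE q2.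
  by [].
exists (Q \o h \o Q' \o h') => //; split=> //.
have := kE [::] isT; rewrite !cats0 => ->.
by have /nilP -> : nilp (g [::]) by [rewrite /nilp Gsize]; rewrite cats0.
Qed.
End TreeGroup.

(** * The martingale condition *)

Section Martingale.
Variables (R : realType) (d : nat) (G : set (word d -> word d)) (G1 : G id)
  (mu : probability (borel_group G1) R).
Hypotheses (Gcomp : forall g h, G g -> G h -> G (g \o h))
  (Ginv : forall g, G g -> exists h, [/\ G h, cancel g h & cancel h g])
  (Gsize : forall g w, G g -> size (g w) = size w)
  (Gcat : forall g u w, G g -> exists w', g (u ++ w) = g u ++ w').
Hypothesis hmu : is_haar mu.
Local Notation T := (borel_group G1).

Lemma level_measurable n (A : set T) :
  (forall g h : T, pi_level n (sval h) = pi_level n (sval g) -> A g -> A h) ->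
  measurable A.
Proof.
move=> AP; apply: sub_sigma_algebra => g Ag; exists n => h gh.
exact: AP gh Ag.
Qed.

Lemma pi_levelE n (g h : word d -> word d) w :
  pi_level n g = pi_level n h -> (size w <= n)%N -> g w = h w.
Proof.
by move=> gh wn; have := congr1 (fun k => k (Bseq wn)) gh.
Qed.

Lemma integral_sum_indic (I : finType) (E : I -> set T) (A : set T) :
  measurable A -> (forall i, measurable (E i)) ->
  (\int[mu]_(x in A) (\sum_i \1_(E i) x)%:E = \sum_i mu (E i `&` A))%E.
Proof.
move=> mA mE; under eq_integral do rewrite -sumEFin.
rewrite ge0_integral_sum //.
- by apply: eq_bigr => i _; rewrite integral_indic.
- by move=> i; apply/measurable_EFinP/measurable_indic.
Qed.

Lemma mu_partition (I : finType) (E : I -> set T) (A : set T) :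
  measurable A -> (forall i, measurable (E i)) ->
  (forall x, A x -> exists! i, E i x) -> (\sum_i mu (E i `&` A) = mu A)%E.
Proof.
move=> mA mE EP; rewrite -integral_sum_indic //.
transitivity (\int[mu]_(x in A) (cst 1 x))%E; last first.
  by rewrite integral_cst // mul1e.
apply: eq_integral => x; rewrite inE => /EP[i [Ei iU]].
rewrite (bigD1 i) //= big1 ?addr0 => [|k ki]; first by rewrite indicE mem_set.
rewrite indicE memNset // => Ek; move: ki; rewrite (iU k Ek) eqxx //.
Qed.

Definition lstab n : set T := [set h : T | forall v : word d, size v = n -> sval h v = v].

Lemma lstab_measurable n : measurable (lstab n).
Proof.
by apply: (@level_measurable n) => g h gh gn v vn; rewrite (pi_levelE gh) ?vn // gn.
Qed.

Lemma mu_translate (g : T) (A B : set T) : measurable A ->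
  (forall h : T, B h <-> exists2 a : T, A a & sval h = sval a \o sval g) -> mu B = mu A.
Proof.
move=> mA BE; rewrite -(hmu g mA); congr (mu _); apply/seteqP; split => h /=.
  by move=> /BE.
by move=> ?; apply/BE.
Qed.

Lemma lift_comp (h g : T) : exists a : T,
  sval h = sval a \o sval g.
Proof.
case: h g => h Gh [g Gg]; have [k [Gk gk kg]] := Ginv Gg.
exists (exist _ (h \o k) (Gcomp Gh Gk)) => /=.
by apply/funext => w /=; rewrite gk.
Qed.

Lemma tuple_word n (w : word d) : size w = n -> exists u : n.-tuple 'I_d, w = u.
Proof. by move=> /eqP wn; exists (Tuple wn). Qed.

(** The cosets of the level stabilizer are finitely many translates of it and cover a space of
    measure one. *)
Lemma mu_lstab_neq0 n : (0 < mu (lstab n))%E.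
Proof.
rewrite lt0e measure_ge0 andbT; apply/eqP => mu0.
(* Cosets are indexed by the maps they induce on level [n]; some of these sets may be empty. *)
pose E (r : {ffun n.-tuple 'I_d -> n.-tuple 'I_d}) : set T :=
  [set h : T | forall w : n.-tuple 'I_d, sval h w = r w].
have mE r : measurable (E r).
  apply: (@level_measurable n) => g h gh Eg w.
  by rewrite (pi_levelE gh) ?size_tuple // Eg.
have := @mu_partition _ E setT measurableT mE.
rewrite big1 => [|r _].
  rewrite probability_setT => H; have : (0%:E = 1%:E :> \bar R); last first.
    by case=> h; have := oner_neq0 R; rewrite -h eqxx.
  apply: H => x _.
  have ex (w : n.-tuple 'I_d) : exists u : n.-tuple 'I_d, sval x w = u.
    by apply: tuple_word; rewrite (Gsize _ (svalP x)) size_tuple.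
  have [r rP] := choice ex; exists (finfun r); split => [w|r' r'P].
    by rewrite ffunE rP.
  by apply/ffunP => w; apply: val_inj; rewrite ffunE /= -rP r'P.
rewrite setIT; have [->|/set0P[g Eg]] := eqVneq (E r) set0; first exact: measure0.
rewrite -mu0; apply: (mu_translate (g := g)); first exact: lstab_measurable.
move=> h; split.
  move=> Eh; have [a aE] := lift_comp h g; exists a => // v vn.
  have [k [Gk gk kg]] := Ginv (svalP g).
  have [u uE] : exists u : n.-tuple 'I_d, k v = u by apply: tuple_word; rewrite Gsize.
  have := Eh u; rewrite -(Eg u) aE /= -uE kg //.
by move=> [a an aE] w; rewrite aE /= an ?Eg ?size_tuple.
Qed.

Lemma lstab_mono n m : (n <= m)%N -> lstab m `<=` lstab n.
Proof.
move=> nm h hm; have hs : level_stab G m (sval h) by split; [exact: svalP | exact: hm].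
by have [] := level_stab_mono Gsize Gcat nm hs.
Qed.

Local Notation X := (@fixed_points R _ _ G1).

Lemma fixed_points_card n (g : T) :
  X n g = #|[pred w : n.-tuple 'I_d | sval g w == w :> word d]|%:R.
Proof.
rewrite /fixed_points; congr (_%:R); apply: eq_card => w; rewrite [RHS]inE /=.
by apply/idP/idP; [move/set_mem|move=> ?; apply/mem_set].
Qed.

Lemma fixed_pointsE n (g : T) :
  X n g = \sum_(w : n.-tuple 'I_d) \1_[set h : T | sval h w = w] g.
Proof.
rewrite fixed_points_card -sum1_card natr_sum big_mkcond /=.
apply: eq_bigr => w _; rewrite indicE inE /=.
case: eqP => [h|h]; first by rewrite mem_set.
by rewrite memNset.
Qed.

(** Maximal values of the process mean that the level is fixed pointwise; this is the event to which
    the martingale property is applied. *)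
Lemma martingale_event n : (1 <= n)%N ->
  [set x : T | forall i, (1 <= i <= n)%N -> X i x = (d ^ i)%:R] = lstab n.
Proof.
move=> n1; apply/seteqP; split=> h.
  move=> /(_ n); rewrite n1 leqnn => /(_ isT) /eqP; rewrite fixed_points_card eqr_nat => /eqP hn v vn.
  have [u ->] := tuple_word vn.
  have /subset_cardP : #|[pred w : n.-tuple 'I_d | sval h w == w :> word d]| = #|{: n.-tuple 'I_d}|.
    by rewrite hn card_tuple card_ord.
  by move=> /(_ (subset_predT _))/(_ u); rewrite !inE => /eqP.
move=> hn i /andP[i1 le]; rewrite fixed_points_card.
have -> : (d ^ i)%N = #|{: i.-tuple 'I_d}| by rewrite card_tuple card_ord.
congr (_%:R); apply: eq_card => w; rewrite !inE.
by apply/eqP; rewrite (lstab_mono le hn) ?size_tuple.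
Qed.

Hypothesis hmart : is_martingale mu (@fixed_points R _ _ G1).

Lemma martingale_sum n : (1 <= n)%N ->
  (\sum_(w : n.+1.-tuple 'I_d) mu ([set h : T | sval h w = w] `&` lstab n) =
   (d ^ n)%:R%:E * mu (lstab n))%E.
Proof.
move=> n1; have := hmart.2 n (fun i => (d ^ i)%:R) n1.
rewrite martingale_event // => /(_ (mu_lstab_neq0 n)).
have mw (w : n.+1.-tuple 'I_d) : measurable [set h : T | sval h w = w].
  by apply: (@level_measurable n.+1) => g h gh gw; rewrite /= (pi_levelE gh) ?size_tuple.
rewrite /cond_expectation; under eq_integral do rewrite fixed_pointsE.
rewrite integral_sum_indic //; last exact: lstab_measurable.
have : mu (lstab n) \is a fin_num by exact: fin_num_measure (lstab_measurable n).
have := mu_lstab_neq0 n; case: (mu (lstab n)) => // m; rewrite lte_fin => m0 _ <-.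
rewrite inver gt_eqF // -muleA -EFinM mulVf ?gt_eqF // mule1 //.
Qed.

(** Orbit counting written with measures. Below a vertex [u], the elements of [St_G(n)] moving child
    [a] to child [b] form the empty set or a translate of those fixing [b]. Summing over [b], the
    expected number of fixed children on [St_G(n)] is at least one, and more than one at [v] if [y]
    is not reached from [x]. This contradicts the martingale equality summed over level [n]. *)
Lemma martingale_transitive n v x y : (1 <= n)%N -> size v = n ->
  exists2 h, level_stab G n h & h (rcons v x) = rcons v y.
Proof.
move=> n1 vn; apply: contrapT => no.
pose A := lstab n; pose F (w w' : word d) : set T := [set h : T | sval h w = w'].
have mA : measurable A := lstab_measurable n.
have mF w w' : measurable (F w w').
  by apply: (@level_measurable (size w)) => g h gh gw; rewrite /F /= (pi_levelE gh).
have fin B : measurable B -> mu B \is a fin_num by move=> mB; exact: fin_num_measure.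
pose m (B : set T) : R := fine (mu B).
have mE B : measurable B -> mu B = (m B)%:E by move=> /fin; rewrite /m => /fineK.
have m0 B : 0 <= m B by rewrite fine_ge0.
have mFA w w' : measurable (F w w' `&` A) by exact: measurableI.
have part u a : size u = n -> \sum_(b : 'I_d) m (F (rcons u a) (rcons u b) `&` A) = m A.
  move=> un; apply: EFin_inj; rewrite -sumEFin -mE //.
  under eq_bigr do rewrite -mE //.
  apply: mu_partition => // h Ah.
  have [w' E] := Gcat u [:: a] (svalP h).
  have := Gsize (u ++ [:: a]) (svalP h); rewrite E Ah // !size_cat => /addnI.
  case: w' E => [|b [|]] // E _; exists b; split.
    by rewrite /F /= -!cats1 E Ah.
  move=> b' Fb'; apply: (@rcons_injr _ u).
  by rewrite -[RHS](Fb' : sval h (rcons u a) = _) -!cats1 E Ah.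
have le u a b : size u = n -> m (F (rcons u a) (rcons u b) `&` A) <=
                              m (F (rcons u b) (rcons u b) `&` A).
  move=> un; have [->|/eqP/set0P[g [Fg Ag]]] := pselect (F (rcons u a) (rcons u b) `&` A = set0).
    by rewrite /m measure0 m0.
  rewrite /m (mu_translate (g := g) (A := F (rcons u b) (rcons u b) `&` A)) // => h; split.
    move=> [Fh Ah]; have [c cE] := lift_comp h g.
    have [k [Gk gk kg]] := Ginv (svalP g).
    have hk w : sval c w = sval h (k w) by rewrite cE /= kg.
    exists c => //; split.
      by rewrite /F /= hk -{1}Fg gk Fh.
    by move=> w wn; rewrite hk -{1}(Ag w wn) gk Ah.
  move=> [c [Fc Ac] cE]; split; first by rewrite /F /= cE /= Fg Fc.
  by move=> w wn; rewrite cE /= Ag // Ac.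
have A0 : 0 < m A by rewrite fine_gt0 // mu_lstab_neq0 /= ltey_eq fin.
have gt0 u b : size u = n -> 0 < m (F (rcons u b) (rcons u b) `&` A).
  move=> un; have := mu_lstab_neq0 n.+1; rewrite mE; last exact: lstab_measurable.
  rewrite lte_fin => /lt_le_trans; apply; apply: fine_le; rewrite ?fin //.
    exact: lstab_measurable.
  apply: le_measure; rewrite ?inE //; first exact: lstab_measurable.
  by move=> h hn; split; [apply: hn; rewrite size_rcons un|apply: lstab_mono hn].
have := martingale_sum n1; rewrite mE // -EFinM.
rewrite (eq_bigr (fun w : n.+1.-tuple 'I_d => (m (F w w `&` A))%:E)); last first.
  by move=> w _; rewrite -mE.
rewrite sumEFin => -[].
pose rc (z : n.-tuple 'I_d * 'I_d) : n.+1.-tuple 'I_d := [tuple of rcons z.1 z.2].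
have rc_bij : bijective rc.
  apply: inj_card_bij; last by rewrite card_prod !card_tuple card_ord expnSr.
  by move=> [u a] [u' a'] /(congr1 val) /= /rcons_inj[uu ->]; congr (_, _); apply: val_inj.
rewrite (reindex rc) /=; last exact: onW_bij.
rewrite -(pair_bigA _ (fun (u : n.-tuple 'I_d) a => m (F (rcons u a) (rcons u a) `&` A))) /=.
have [v' vE] := tuple_word vn; rewrite {v}vE in vn no.
have ge (u : n.-tuple 'I_d) : m A <= \sum_(b : 'I_d) m (F (rcons u b) (rcons u b) `&` A).
  by rewrite -(part u x) ?size_tuple //; apply: ler_sum => b _; apply: le; rewrite size_tuple.
(* The term of [y] on the left is zero, as [y] is not reached from [x], while the one on the right
   is positive. *)
have gt : m A < \sum_(b : 'I_d) m (F (rcons v' b) (rcons v' b) `&` A).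
  rewrite -(part v' x) ?size_tuple // (bigD1 y) //= [ltRHS](bigD1 y) //=.
  apply: ltr_leD; last by apply: ler_sum => b _; apply: le; rewrite size_tuple.
  have -> : F (rcons v' x) (rcons v' y) `&` A = set0; last first.
    by rewrite {1}/m measure0 gt0 // size_tuple.
  apply/seteqP; split=> // h [Fh Ah]; apply: no; exists (sval h) => //.
  by split; [exact: svalP|].
move=> E; have : \sum_(u : n.-tuple 'I_d) m A <
   \sum_(u : n.-tuple 'I_d) \sum_(b : 'I_d) m (F (rcons u b) (rcons u b) `&` A).
  by rewrite (bigD1 v') //= [ltRHS](bigD1 v') //=; apply: ltr_leD => //; apply: ler_sum.
by rewrite [ltRHS]E sumr_const card_tuple card_ord mulr_natl ltxx.
Qed.

End Martingale.

(** * Ramification along orbits *)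

Section Exceptional.
Variables (K : fieldType) (f : {fraction {poly K}}) (F : fieldType) (e : {rmorphism K -> F}).
Hypotheses (clF : GRing.closed_field_axiom F) (hd : (0 < ratdeg f)%N).
Local Notation p := (map_poly e (numer f)).
Local Notation q := (map_poly e (denom f)).
Local Notation fF := (ratmap e f).
Local Notation ld := (local_degree e f).

Lemma cop_F : coprimep p q.
Proof. by rewrite coprimep_map; exact: coprime_numer_denom. Qed.

Lemma pair_degree_F : pair_degree p q = ratdeg f.
Proof. by rewrite /pair_degree !size_map_poly. Qed.

Lemma pair_degree_F_gt0 : (0 < pair_degree p q)%N.
Proof. by rewrite pair_degree_F. Qed.

Lemma ld_gt0 z : (0 < ld z)%N.
Proof. exact: local_degree_gt0 cop_F pair_degree_F_gt0 z. Qed.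

Lemma ld1 z : ~ crit e f z -> ld z = 1%N.
Proof. by move=> /negP; rewrite -ltnNge; have := ld_gt0 z; case: (ld z) => [|[]]. Qed.

(** The local degree of the [n]-th iterate at [z], by the chain rule. *)
Definition iter_ld (n : nat) (z : P1 F) : nat := \prod_(i < n) ld (iter i fF z).

Lemma iter_ld0 z : iter_ld 0 z = 1%N.
Proof. by rewrite /iter_ld big_ord0. Qed.

Lemma iter_ldS n z : iter_ld n.+1 z = (ld z * iter_ld n (fF z))%N.
Proof.
rewrite /iter_ld big_ord_recl /=; congr (_ * _)%N.
by apply: eq_bigr => i _; rewrite /= -iterSr.
Qed.

Lemma iter_ld1 n z : (forall i, (i < n)%N -> ~ crit e f (iter i fF z)) -> iter_ld n z = 1%N.
Proof. by move=> h; apply: big1 => i _; apply/ld1/h. Qed.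

Lemma postcrit_iter n z : (1 <= n)%N -> crit e f z -> postcrit e f (iter n fF z).
Proof. by move=> n1 cz; exists n => //; exists z. Qed.

Lemma postcrit_map z : postcrit e f z -> postcrit e f (fF z).
Proof. by move=> [n n1 [c cc <-]]; exists n.+1 => //; exists c. Qed.

Lemma iter_ld_npostcrit i z y : ~ postcrit e f y -> iter i fF z = y -> iter_ld i z = 1%N.
Proof.
move=> ny zy; apply: iter_ld1 => k ki ck; apply: ny.
by rewrite -zy -(subnK (ltnW ki)) iterD; apply: postcrit_iter; rewrite ?subn_gt0.
Qed.

Lemma npostcrit_back i z y : ~ postcrit e f y -> iter i fF z = y -> ~ postcrit e f z.
Proof.
move=> ny zy pz; apply: ny; rewrite -zy {zy y}.
by elim: i => //= i IH; exact: postcrit_map.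
Qed.

Lemma fF_surj n w : exists z, iter n fF z = w.
Proof.
elim: n w => [|n IH] w; first by exists w.
have [y yw] := P1map_surj cop_F pair_degree_F_gt0 clF w.
by have [z zy] := IH y; exists z; rewrite /= zy.
Qed.

Lemma card_le1_eq (T : Type) (A : set T) x y : (A #<= `I_1)%card -> A x -> A y -> x = y.
Proof.
move=> /card_leP[g] Ax Ay.
pose x' : A := SigSub (mem_set Ax); pose y' : A := SigSub (mem_set Ay).
have gI (z : A) : val (g z) = 0%N.
  by have := set_mem (valP (g z)); rewrite /= ltnS leqn0 => /eqP.
have xy : x' = y' by apply: ('inj_g); rewrite ?inE //; apply: val_inj; rewrite !gI.
exact: (congr1 val xy).
Qed.

(** If from index [m] on all preimages of points of the orbit of [z] are critical or postcritical,
    this tail of the orbit is critically exceptional. So either some [f^i(z)], [i >= 1], has a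
    preimage outside, above which a [y] with trivial ramification is found; or [f(z)] and [f^2(z)]
    are exceptional, hence equal. In that case [z] itself has a preimage [y] outside,
    [f^2(y) = f^2(z)], and the local degree of [f^2] at [y] is that of [f] at [z]. *)
Lemma nexceptional_witness z : (Upsilon e f #<= `I_1)%card ->
  postcrit e f z -> ~ Upsilon e f z ->
  exists k y, [/\ (1 <= k)%N, iter k fF y = iter k fF z, ~ postcrit e f y &
    (iter_ld k y %| iter_ld k z)%N].
Proof.
move=> U1 pz nU.
have orbit_exc m : (forall i y, (m <= i)%N -> fF y = iter i fF z -> crit e f y \/ postcrit e f y) ->
    forall i, (m <= i)%N -> Upsilon e f (iter i fF z).
  move=> h i mi; exists [set iter k fF z | k in [set k | (m <= k)%N]]; last by exists i.
  split.
    by move=> _ [k _ <-]; elim: k => //= k; exact: postcrit_map.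
  apply/seteqP; split.
    move=> _ [k mk <-]; split; last by case=> _; apply; exists k.
    by exists k.+1; rewrite //= ltnW.
  move=> y [[k mk yE] ny]; apply: contrapT => nY; apply: ny; split=> //.
  by case: (h k y mk (esym yE)); [left|right].
have [[i [y [i1 [yE [ncy npy]]]]]|no] := pselect (exists i y, (1 <= i)%N /\
    (fF y = iter i fF z /\ (~ crit e f y /\ ~ postcrit e f y))).
  have [y' y'E] := fF_surj i.-1 y.
  have iE : iter i fF y' = fF y by rewrite -(prednK i1) iterS y'E.
  exists i, y'; split=> //; first by rewrite iE.
    exact: npostcrit_back npy y'E.
  suff -> : iter_ld i y' = 1%N by rewrite dvd1n.
  rewrite -(prednK i1) /iter_ld big_ord_recr /= y'E ld1 // muln1.
  exact: iter_ld_npostcrit npy y'E.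
have U i : (1 <= i)%N -> Upsilon e f (iter i fF z).
  apply: orbit_exc => k y k1 yE; apply: contrapT => /not_orP[ncy npy].
  by apply: no; exists k, y.
have zz : iter 2 fF z = iter 1 fF z by apply: card_le1_eq U1 _ _; apply: U.
have [y [yz [ncy npy]]] : exists y, fF y = z /\ (~ crit e f y /\ ~ postcrit e f y).
  apply: contrapT => no0; apply: nU; apply: (orbit_exc 0%N _ 0%N) => // k y _ yE.
  apply: contrapT => /not_orP[ncy npy]; case: k yE => [|k] yE.
    by apply: no0; exists y.
  by apply: no; exists k.+1, y.
exists 2, y; split=> //; first by rewrite /= yz; exact: esym.
rewrite !iter_ldS yz ld1 // mul1n /iter_ld !big_ord0 !muln1 dvdn_mulr //.
Qed.

(** The fibre polynomial has a double zero at [c]; eliminating the value between it and its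
    derivative leaves the Wronskian. *)
Lemma crit_wronskian c : crit e f (Some c) ->
  root ((map_poly e (numer f)^`()) * q - p * (map_poly e (denom f)^`())) c.
Proof.
rewrite /crit /= /local_degree /pair_local_degree; set h := fiber_poly p q _.
have h0 : h != 0 := fiber_neq0 cop_F pair_degree_F_gt0 _.
rewrite mup_geq // => /dvdpP[h1 hE].
have hc : h.[c] = 0 by rewrite hE hornerM horner_exp hornerXsubC subrr expr0n mulr0.
have h'c : (h^`()).[c] = 0.
  rewrite hE derivM deriv_exp derivXsubC mul1r /= expr1 hornerD !hornerM hornerMn.
  by rewrite !hornerXsubC subrr mul0rn !mulr0 addr0.
move: hc h'c; rewrite /h; case: (P1map p q _) => [b|] /=.
  rewrite derivB derivZ !deriv_map !hornerE => /subr0_eq pc /subr0_eq p'c.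
  by rewrite rootE !hornerE pc p'c mulrAC subrr.
by rewrite deriv_map rootE !hornerE => -> ->; rewrite !mulr0 subrr.
Qed.

Lemma crit_finite : (numer f)^`() * denom f - numer f * (denom f)^`() != 0 ->
  exists cs : seq (option F), forall c, crit e f c -> c \in cs.
Proof.
move=> W0; pose W := map_poly e ((numer f)^`() * denom f - numer f * (denom f)^`()).
have [|rs [_ rsP]] := @poly_root_seq _ W; first by rewrite map_poly_eq0.
exists (None :: map Some rs) => -[c|] // /crit_wronskian.
by rewrite -!rmorphM -rmorphB -rsP => crs; rewrite inE; apply/orP; right; apply: map_f.
Qed.

End Exceptional.

(** * Functions on the line *)

Section RegularFunctions.
Variables (F : fieldType) (clF : GRing.closed_field_axiom F) (e : nat) (e0 : (0 < e)%N).
Local Notation lau := (laurent F).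
Variables (kT : fieldType) (emb : {rmorphism {poly F} -> kT}).
Hypotheses (emb0 : forall P, (emb P == 0) = (P == 0))
  (emb_frac : forall x, exists a b : {poly F}, b != 0 /\ x = emb a / emb b).
Variable th : P1 F -> {rmorphism kT -> lau}.
Hypothesis th_C : forall z c, th z (emb c%:P) = lauC c.
Hypothesis th_fin : forall z, th (Some z) (emb 'X) = lauC z + lauX F ^+ e.
Hypothesis th_inf : th None (emb 'X) = (lauX F ^+ e)^-1.

Lemma th_poly z (P : {poly F}) : th z (emb P) = (map_poly (@lauC F) P).[th z (emb 'X)].
Proof.
pose g := (th z \o emb : {rmorphism _ -> _}).
rewrite -[LHS]/(g P) -{1}[P]coefK poly_def rmorph_sum horner_coef size_map_poly.
apply: eq_bigr => i _; rewrite -mul_polyC rmorphM rmorphXn coef_map /=.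
by rewrite th_C.
Qed.

Lemma regE_fin z (P : {poly F}) : lau_reg (th (Some z) (emb P)) /\
  lau_res (th (Some z) (emb P)) = P.[z].
Proof.
rewrite th_poly th_fin -[lauX F ^+ e]tofracXn -tofracD map_lauC_eval.
split; first exact: reg_tofrac.
rewrite res_tofrac psC_eval0 psDE -[psX F ^+ e]mulr1 psX_pow_mul0 // addr0 /=.
by rewrite mulr1n.
Qed.

Lemma reg_lauX n : lau_reg (lauX F ^+ n).
Proof. exact/regXn/reg_X. Qed.

Lemma res_lauX n : (0 < n)%N -> lau_res (lauX F ^+ n) = 0.
Proof. by move=> n0; rewrite resXn ?res_X ?expr0n ?gtn_eqF //; exact: reg_X. Qed.

Lemma th_inf_poly (P : {poly F}) : P != 0 ->
  exists u : lau, [/\ lau_reg u, lau_res u = lead_coef P &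
    th None (emb P) = (lauX F ^+ (e * (size P).-1))^-1 * u].
Proof.
move=> P0; have X0 : lauX F != 0 := lauX_neq0 F.
exists (map_poly (@lauC F) (revp (size P).-1 P)).[lauX F ^+ e]; split.
- by rewrite -[lauX F ^+ e]tofracXn map_lauC_eval; exact: reg_tofrac.
- rewrite -[lauX F ^+ e]tofracXn map_lauC_eval res_tofrac psC_eval0.
  by rewrite -[psX F ^+ e]mulr1 psX_pow_mul0 // revp0.
- rewrite revp_map revp_horner ?expf_neq0 ?size_map_poly ?prednK ?size_poly_gt0 //.
  by rewrite -exprM mulKf ?expf_neq0 // th_poly th_inf.
Qed.

Lemma frac_coprime (x : kT) : exists P Q : {poly F},
  [/\ Q != 0, coprimep P Q & x = emb P / emb Q].
Proof.
have [a [b [b0 xE]]] := emb_frac x.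
have g0 : gcdp a b != 0 by rewrite gcdp_eq0 (negPf b0) andbF.
have aE : a = a %/ gcdp a b * gcdp a b by rewrite divpK // dvdp_gcdl.
have bE : b = b %/ gcdp a b * gcdp a b by rewrite divpK // dvdp_gcdr.
exists (a %/ gcdp a b), (b %/ gcdp a b); split.
- by apply: contraNneq b0 => b0'; rewrite bE b0' mul0r.
- by rewrite coprimep_div_gcd // b0 orbT.
- have tE u w g : u = w * g -> emb u = emb w * emb g by move=> ->; rewrite rmorphM.
  by rewrite xE (tE _ _ _ aE) (tE _ _ _ bE) -mulf_div divff ?mulr1 // emb0.
Qed.

(** At a zero of the denominator the coprime numerator would have to vanish as well. *)
Lemma regular_poly (x : kT) : (forall z, lau_reg (th (Some z) x)) ->
  exists P : {poly F}, x = emb P.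
Proof.
move=> rx; have [P [Q [Q0 PQ xE]]] := frac_coprime x.
have [Q1|Q1] := leqP (size Q) 1.
  have := size1_polyC Q1; move: Q`_0 => c QE; have c0 : c != 0 by rewrite -polyC_eq0 -QE.
  exists (P * (c^-1)%:P); rewrite xE QE rmorphM; congr (_ * _).
  apply: (mulIf (x := emb c%:P)); first by rewrite emb0 polyC_eq0.
  by rewrite mulVf ?emb0 ?polyC_eq0 // -rmorphM -polyCM mulVf // rmorph1.
have [z Qz] := closed_axiom_root clF Q1.
have tQ : emb Q != 0 by rewrite emb0.
have /(congr1 (fun y => lau_res (th (Some z) y))) : x * emb Q = emb P.
  by rewrite xE divfK.
rewrite rmorphM resM //; last by have [] := regE_fin z Q.
rewrite !(regE_fin z _).2 (eqP Qz) mulr0 => /esym Pz.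
have /(coprimep_root PQ) : root P z by rewrite rootE Pz.
by rewrite (eqP Qz) eqxx.
Qed.

Lemma regular_const (P : {poly F}) : lau_reg (th None (emb P)) -> exists c, P = c%:P.
Proof.
have [->|P0] := eqVneq P 0; first by exists 0; rewrite polyC0.
have [u [ru u0 E]] := th_inf_poly P0.
move=> rP; exists P`_0; apply: size1_polyC; rewrite leqNgt; apply/negP => P1.
have n0 : (0 < e * (size P).-1)%N by rewrite muln_gt0 e0 -subn1 subn_gt0.
have : u = lauX F ^+ (e * (size P).-1) * th None (emb P).
  by rewrite E mulVKf // expf_neq0 // lauX_neq0.
move/(congr1 (@lau_res F)); rewrite u0 resM ?res_lauX ?mul0r //; last exact: reg_lauX.
by move/eqP; rewrite lead_coef_eq0 (negPf P0).
Qed.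

(** All expansions are functions of [x^e], on which the rotation is trivial. *)
Lemma rot_fixes_th zeta tau z x : zeta ^+ e = 1 -> is_rot zeta tau -> tau (th z x) = th z x.
Proof.
move=> ze tz; have tX : tau (th z (emb 'X)) = th z (emb 'X).
  have tv : tau (lauX F ^+ e) = lauX F ^+ e.
    by rewrite rmorphXn /= (rot_X tz) exprMn -rmorphXn ze rmorph1 mul1r.
  by case: z => [z|]; rewrite ?th_fin ?th_inf ?fmorphV ?rmorphD /= ?(rot_C tz) tv.
have tp P : tau (th z (emb P)) = th z (emb P).
  rewrite th_poly -horner_map tX -map_poly_comp.
  by congr (_.[_]); apply: eq_map_poly => c /=; rewrite (rot_C tz).
by have [a [b [_ ->]]] := emb_frac x; rewrite !fmorph_div !tp.
Qed.
End RegularFunctions.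

Lemma mulf_rearrange (R : fieldType) (P Q W C U X : R) : W != 0 ->
  P * Q * W * (C * (W^-1 * U) * X) = C * U * P * (Q * X).
Proof. by move=> W0; field. Qed.

(** * Determinants over Laurent series *)

Section LaurentMatrices.
Variable F : fieldType.
Local Notation lau := (laurent F).

Lemma reg_det n (A : 'M[lau]_n) : (forall i k, lau_reg (A i k)) ->
  lau_reg (\det A) /\ lau_res (\det A) = \det (\matrix_(i, k) lau_res (A i k)).
Proof.
move=> rA; have rs (b : bool) : lau_reg ((-1) ^+ b) by exact/regXn/regN/reg1.
have rp (s : {perm 'I_n}) : lau_reg (\prod_i A i (s i)) by apply: reg_prod => i _.
rewrite /determinant; split; first by apply: reg_sum => s _; exact: regM.
rewrite res_sum => [|s _]; last exact: regM.
apply: eq_bigr => s _; rewrite resM // resXn; last exact/regN/reg1.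
rewrite resN ?res1; last exact: reg1.
by rewrite res_prod //; congr (_ * _); apply: eq_bigr => i _; rewrite mxE.
Qed.

Lemma reg_vz (n : int) : 0 <= n -> lau_reg (lauX F ^ n).
Proof. by case: n => // n _; exact/regXn/reg_X. Qed.

Lemma res_vz (n : int) : 0 < n -> lau_res (lauX F ^ n) = 0.
Proof. by case: n => // n n0; exact: res_lauX. Qed.

Lemma det_row_replace (R : comNzRingType) n (c : 'I_n -> R) (i0 : 'I_n) :
  \det (\matrix_(i, k) if i == i0 then c k else (i == k)%:R) = c i0.
Proof.
set E := \matrix_(i, k) _.
rewrite (expand_det_row _ i0) (bigD1 i0) //= big1 => [|k ki].
  suff -> : cofactor E i0 i0 = 1 by rewrite mxE eqxx mulr1 addr0.
  transitivity (cofactor (1%:M : 'M[R]_n) i0 i0).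
    rewrite /cofactor; congr (_ * \det _); apply/matrixP => a b; rewrite !mxE.
    by rewrite eq_sym (negPf (neq_lift _ _)).
  by have := adj1 R n; move/matrixP/(_ i0 i0); rewrite !mxE eqxx.
suff -> : cofactor E i0 k = 0 by rewrite mulr0.
transitivity (cofactor (1%:M : 'M[R]_n) i0 k).
  rewrite /cofactor; congr (_ * \det _); apply/matrixP => a b; rewrite !mxE.
  by rewrite eq_sym (negPf (neq_lift _ _)).
by have := adj1 R n; move/matrixP/(_ k i0); rewrite !mxE (negPf ki).
Qed.

Lemma prod_vz n (d : 'I_n -> int) : \prod_i lauX F ^ d i = lauX F ^ (\sum_i d i).
Proof.
rewrite (big_morph (fun k : int => lauX F ^ k) (id1 := 1) (op1 := *%R)) //.
by move=> a b; rewrite expfzDr // lauX_neq0.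
Qed.

Lemma det_scale_rows n (d : 'I_n -> int) (X : 'M[lau]_n) :
  \det (\matrix_(i, k) (lauX F ^ d i * X i k)) = lauX F ^ (\sum_i d i) * \det X.
Proof.
rewrite -prod_vz -[RHS]/(_ * _).
have -> : \matrix_(i, k) (lauX F ^ d i * X i k) = diag_mx (\row_i lauX F ^ d i) *m X.
  by apply/matrixP => i k; rewrite mul_diag_mx !mxE.
rewrite det_mulmx det_diag; congr (_ * _); by apply: eq_bigr => i _; rewrite mxE.
Qed.

Lemma det0_rowP (R : fieldType) n (A : 'M[R]_n) : \det A = 0 ->
  exists c : 'I_n -> R, (exists i, c i != 0) /\ forall k, \sum_i c i * A i k = 0.
Proof.
move=> A0; have /det0P[v v0 vA] : \det A == 0 by rewrite A0.
exists (v 0); split.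
  by have /rV0Pn := v0.
by move=> k; have /rowP/(_ k) := vA; rewrite !mxE.
Qed.

End LaurentMatrices.

(** * Lattices of functions on a cover, minimal at infinity *)

Section Lattice.
Variables (F : fieldType) (clF : GRing.closed_field_axiom F) (e : nat) (e0 : (0 < e)%N).
Local Notation lau := (laurent F).
Variables (kT : fieldType) (emb : {rmorphism {poly F} -> kT}).
Hypotheses (emb0 : forall P, (emb P == 0) = (P == 0))
  (emb_frac : forall x, exists a b : {poly F}, b != 0 /\ x = emb a / emb b).
Variable th : P1 F -> {rmorphism kT -> lau}.
Hypothesis th_C : forall z c, th z (emb c%:P) = lauC c.
Hypothesis th_fin : forall z, th (Some z) (emb 'X) = lauC z + lauX F ^+ e.
Hypothesis th_inf : th None (emb 'X) = (lauX F ^+ e)^-1.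
Variables (zeta : F) (tau : {rmorphism lau -> lau}).
Hypotheses (zP : e.-primitive_root zeta) (tz : is_rot zeta tau) (eF : e%:R != 0 :> F).
Variables (r : nat) (A : P1 F -> 'I_r -> lau) (S : 'M[kT]_r) (m : {poly kT}).
Let V z : 'M[lau]_r := \matrix_(k, l) A z l ^+ k.
Hypotheses (gram : forall z, V z *m (V z)^T = map_mx (th z) S) (S0 : \det S != 0).
Hypotheses (mM : m \is monic) (sm : size m = r.+1)
  (mA : forall z l, root (map_poly (th z) m) (A z l)).
Hypotheses (tA : forall z l, tau (A (Some z) l) = A (Some z) l)
  (tAinf : forall l, exists l', tau (A None l) = A None l').
Hypothesis norm : forall g : {poly kT},
  (forall z l, lau_reg (map_poly (th z) g).[A z l]) ->
  forall l, exists c, (map_poly (th None) g).[A None l] = lauC c.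

(** Row [i] of [B] stands for the function [sum_k B_ik a^k] of a generator [a] of the cover, whose
    conjugates expand at [z] as the series [A z l]; the columns run over these conjugates. *)
Let X z (B : 'M[kT]_r) := map_mx (th z) B *m V z.
Let integral B := forall z i l, lau_reg (X (Some z) B i l).
(** [d i] bounds the pole order of row [i] at infinity, counted in powers of the [e]-th root of the
    local parameter. *)
Let bound B (d : 'I_r -> int) := forall i l, lau_reg (lauX F ^ d i * X None B i l).

Let v0 : lauX F != 0 := lauX_neq0 F.

Let tau_th z x : tau (th z x) = th z x.
Proof. exact: (rot_fixes_th emb_frac th_C th_fin th_inf _ _ (prim_expr_order zP) tz). Qed.

Let X_poly z B i l : X z B i l = (map_poly (th z) (\sum_k B i k *: 'X^k)).[A z l].
Proof.
rewrite rmorph_sum horner_sum mxE; apply: eq_bigr => k _.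
by rewrite !mxE /= map_polyZ map_polyXn !hornerE.
Qed.

(** The square of the determinant is the discriminant of the lattice, a function on the line. *)
Let det_X z B : \det (X z B) ^+ 2 = th z (\det B ^+ 2 * \det S).
Proof.
rewrite det_mulmx det_map_mx exprMn rmorphM rmorphXn /=; congr (_ * _).
by rewrite expr2 -{2}det_tr -det_mulmx gram det_map_mx.
Qed.

Let disc_poly B : integral B -> exists P, \det B ^+ 2 * \det S = emb P.
Proof.
move=> iB; apply: (regular_poly clF e0 emb0 emb_frac th_C th_fin) => z.
by rewrite -det_X; apply: regXn; have [] := reg_det (iB z).
Qed.

Let detXinf B d : \det (\matrix_(i, l) (lauX F ^ d i * X None B i l)) ^+ 2 =
  (lauX F ^ (\sum_i d i)) ^+ 2 * th None (\det B ^+ 2 * \det S).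
Proof. by rewrite det_scale_rows exprMn det_X. Qed.

(** A negative sum would make the discriminant, a nonzero polynomial, vanish at infinity. *)
Let sum_bound_ge0 B d : integral B -> bound B d -> \det B != 0 -> 0 <= \sum_i d i.
Proof.
move=> iB bB dB; rewrite leNgt; apply/negP => d0.
have [P PE] := disc_poly iB.
have : lau_reg ((lauX F ^ (\sum_i d i)) ^+ 2 * th None (emb P)).
  rewrite -PE -detXinf; apply: regXn.
  have rY i l : lau_reg ((\matrix_(i, l) (lauX F ^ d i * X None B i l)) i l).
    by rewrite mxE; exact: bB.
  by have [] := reg_det rY.
set N := \sum_i d i in d0 *; set x := _ * th None _ => rx.
have xE : th None (emb P) = (lauX F ^ (- N)) ^+ 2 * x.
  by rewrite /x mulrA -exprMn -expfzDr // addNr expr0z expr1n mul1r.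
have rN : lau_reg (lauX F ^ (- N)) by apply: reg_vz; rewrite oppr_ge0 ltW.
have r0 : lau_res (th None (emb P)) = 0.
  rewrite xE resM ?resXn ?res_vz ?oppr_gt0 ?expr0n ?mul0r //; exact: regXn.
have [|c cE] := @regular_const _ _ e0 _ _ th th_C th_inf P.
  by rewrite xE; apply: regM => //; exact: regXn.
move: r0; rewrite cE th_C res_C => c0; move: PE; rewrite cE c0 rmorph0 => /eqP.
by rewrite mulf_eq0 expf_eq0 (negPf dB) (negPf S0).
Qed.

Let repl (B : 'M[kT]_r) i0 (c : 'I_r -> kT) : 'M[kT]_r :=
  (\matrix_(i, k) if i == i0 then c k else (i == k)%:R) *m B.

Let det_repl B i0 c : c i0 != 0 -> \det B != 0 -> \det (repl B i0 c) != 0.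
Proof.
move=> ci dB; rewrite /repl det_mulmx.
rewrite (det_row_replace c i0).
exact: mulf_neq0.
Qed.

Let X_repl z B i0 c i l : X z (repl B i0 c) i l =
  if i == i0 then \sum_k th z (c k) * X z B k l else X z B i l.
Proof.
rewrite /X /repl map_mxM -mulmxA mxE.
case: eqP => [->|/eqP ii]; first by apply: eq_bigr => k _; rewrite !mxE eqxx.
rewrite (bigD1 i) //= big1 ?addr0 => [|k ki].
  by rewrite !mxE (negPf ii) eqxx rmorph1 mul1r.
by rewrite !mxE (negPf ii) eq_sym (negPf ki) rmorph0 mul0r.
Qed.

(** The row to be replaced has the largest pole bound among those occurring in the relation, so the
    new row can respect it. *)
Let arg_max (c : 'I_r -> F) (d : 'I_r -> int) : (exists i, c i != 0) ->
  exists i0, c i0 != 0 /\ forall i, c i != 0 -> d i <= d i0.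
Proof.
move=> [i ci]; case: (Order.TotalTheory.arg_maxP (P := fun i => c i != 0) d ci) => i0 ci0 h.
by exists i0.
Qed.

Let sum_upd (d d' : 'I_r -> int) i0 (n : int) : d' i0 = d i0 - n ->
  (forall i, i != i0 -> d' i = d i) -> \sum_i d' i = \sum_i d i - n.
Proof.
move=> h0 h; rewrite (bigD1 i0) //= [in RHS](bigD1 i0) //= h0 (eq_bigr d) //.
by rewrite addrAC.
Qed.

(* A relation between the values at [z] can be divided by [X - z]: being [tau]-invariant, its
   left side vanishes to order [e], not only [1]. *)
Let reduce_fin B d z : integral B -> bound B d -> \det B != 0 ->
  \det (\matrix_(i, l) lau_res (X (Some z) B i l)) = 0 ->
  exists B' d', [/\ integral B', bound B' d', \det B' != 0 &
    \sum_i d' i = \sum_i d i - e%:Z].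
Proof.
move=> iB bB dB /det0_rowP[c [c0 cE]].
have [i0 [ci0 imax]] := arg_max d c0.
(* Dividing by [X - z] also lowers the pole order at infinity by [e], since [1 / (X - z)] is there
   [x^e] times a unit. *)
pose c' i : kT := emb (c i)%:P / emb ('X - z%:P).
pose d' i := if i == i0 then d i0 - e%:Z else d i.
exists (repl B i0 c'), d'; split.
- move=> z' i l; rewrite X_repl; case: eqP => // _.
  have -> : \sum_k th (Some z') (c' k) * X (Some z') B k l =
      (th (Some z') (emb ('X - z%:P)))^-1 * \sum_k lauC (c k) * X (Some z') B k l.
    rewrite mulr_sumr; apply: eq_bigr => k _.
    by rewrite /c' fmorph_div th_C; ring.
  have rsum : lau_reg (\sum_k lauC (c k) * X (Some z') B k l).
    by apply: reg_sum => k _; apply: regM => //; exact: reg_C.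
  have [zz|zz] := eqVneq z' z.
    have [||y [ry ->]] := rot_fixed_div tz (x := \sum_k lauC (c k) * X (Some z') B k l) e0 zP _ rsum.
    - rewrite rmorph_sum; apply: eq_bigr => k _; rewrite rmorphM /= (rot_C tz); congr (_ * _).
      rewrite !X_poly -horner_map tA -map_poly_comp; congr (_.[_]).
      by apply: eq_map_poly => x /=; rewrite tau_th.
    - rewrite res_sum => [|k _]; last by apply: regM => //; exact: reg_C.
      rewrite -[RHS](cE l); apply: eq_bigr => k _; rewrite resM //; last exact: reg_C.
      by rewrite res_C mxE zz.
    rewrite rmorphB rmorphB /= th_fin th_C zz addrAC subrr add0r mulKf ?expf_neq0 //.
  apply: regM => //.
  have [rX xE] := regE_fin e0 th_C th_fin z' ('X - z%:P).
  by have [] := reg_inv rX _; rewrite ?xE ?hornerXsubC ?subr_eq0.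
- move=> i l; rewrite X_repl /d'; case: eqP => _; last exact: bB.
  rewrite mulr_sumr; apply: reg_sum => k _.
  have [ck|ck] := eqVneq (c k) 0.
    by rewrite /c' ck polyC0 rmorph0 mul0r rmorph0 mul0r mulr0; exact: reg0.
  have thE : th None (emb ('X - z%:P)) = lauX F ^ (- e%:Z) * (1 - lauC z * lauX F ^+ e).
    rewrite rmorphB rmorphB /= th_inf th_C mulrBr mulr1 -exprnN.
    by rewrite mulrCA mulVf ?expf_neq0 ?mulr1.
  have [||ru _] := @reg_inv _ (1 - lauC z * lauX F ^+ e).
  + by apply: regB; [exact: reg1|apply: regM; [exact: reg_C|exact/regXn/reg_X]].
  + rewrite resB ?res1; [|exact: reg1|by apply: regM; [exact: reg_C|exact/regXn/reg_X]].
    rewrite resM ?res_lauX ?mulr0 ?subr0 ?oner_neq0 //; [exact: reg_C|exact/regXn/reg_X].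
  have -> : lauX F ^ (d i0 - e%:Z) * (th None (c' k) * X None B k l) =
      lauC (c k) * (1 - lauC z * lauX F ^+ e)^-1 * lauX F ^ (d i0 - d k) *
      (lauX F ^ d k * X None B k l).
    have wE : lauX F ^ (- e%:Z) != 0 by rewrite expfz_neq0.
    have dE : lauX F ^ (d i0 - e%:Z) = lauX F ^ (d i0 - d k) * lauX F ^ d k * lauX F ^ (- e%:Z).
      by rewrite -!expfzDr // subrK.
    rewrite /c' fmorph_div th_C thE dE invfM.
    exact: mulf_rearrange.
  apply: regM; last exact: bB.
  apply: regM; first by apply: regM => //; exact: reg_C.
  by apply: reg_vz; rewrite subr_ge0; exact: imax.
- by apply: det_repl => //; rewrite /c' mulf_neq0 ?invr_eq0 // emb0 ?polyC_eq0 // polyXsubC_eq0.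
- apply: (sum_upd (i0 := i0)); rewrite /d' ?eqxx // => i /negPf -> //.
Qed.

Let X_tau B l l' i : tau (A None l) = A None l' -> X None B i l' = tau (X None B i l).
Proof.
move=> ll'; rewrite !X_poly -ll' -horner_map -map_poly_comp; congr (_.[_]).
by apply: eq_map_poly => x /=; rewrite tau_th.
Qed.

Let zeta0 : zeta != 0.
Proof.
apply/negP => /eqP z0; have := prim_expr_order zP.
by rewrite z0 expr0n gtn_eqF // => /eqP; rewrite eq_sym oner_eq0.
Qed.

Let prim_expz (k : int) : zeta ^ k = 1 -> (e %| `|k|)%N.
Proof.
case: k => n; first by rewrite -exprnP => /eqP; rewrite -(prim_order_dvd zP).
rewrite NegzE -exprnN abszN => /eqP; rewrite invr_eq1.
by rewrite -(prim_order_dvd zP).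
Qed.

Let geom_sum (k : int) : \sum_(s < e) (zeta ^ k) ^+ s = if zeta ^ k == 1 then e%:R else 0.
Proof.
case: eqP => [->|/eqP k1].
  by rewrite (eq_bigr (fun=> 1)) ?sumr_const ?card_ord // => s _; rewrite expr1n.
apply: (mulfI (x := zeta ^ k - 1)); first by rewrite subr_eq0.
by rewrite mulr0 -subrX1 (exprnP _ e) exprzAC -(exprnP zeta) (prim_expr_order zP) exp1rz subrr.
Qed.

Let reg_res0_div (x : lau) : lau_reg x -> lau_res x = 0 -> exists y, lau_reg y /\ x = lauX F * y.
Proof.
move=> [a ->]; rewrite res_tofrac => /psX_dvd[b ->]; exists (tofrac b).
by rewrite tofracM; split=> //; exact: reg_tofrac.
Qed.

(* As [tau] permutes the conjugates, a relation between leading terms can be restricted to rows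
   whose [d i] agree modulo [e]; powers of the coordinate then bring them to the same order. *)
Let reduce_inf B d : integral B -> bound B d -> \det B != 0 ->
  \det (\matrix_(i, l) lau_res (lauX F ^ d i * X None B i l)) = 0 ->
  exists B' d', [/\ integral B', bound B' d', \det B' != 0 &
    \sum_i d' i = \sum_i d i - 1].
Proof.
move=> iB bB dB /det0_rowP[c [[i1 ci1] cE]].
pose Y i l := lau_res (lauX F ^ d i * X None B i l).
(* Passing to the conjugate to which [tau] moves [l] multiplies the leading term of row [i] by
   [zeta^(- d i)], so the relation may be twisted by these factors. *)
have YE l : exists l', forall i, Y i l' = zeta ^ (- d i) * Y i l.
  have [l' ll'] := tAinf l; exists l' => i; rewrite /Y (X_tau _ _ ll').
  have -> : lauX F ^ d i * tau (X None B i l) =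
      lauC (zeta ^ (- d i)) * tau (lauX F ^ d i * X None B i l).
    rewrite rmorphM !fmorphXz (rot_X tz) expfzMl !mulrA.
    by rewrite -expfzDr ?fmorph_eq0 // addNr expr0z mul1r.
  rewrite resM ?res_C ?(rot_res tz) //; [exact: reg_C|exact: rot_reg tz _ (bB i l)].
have cs s : forall l, \sum_i c i * (zeta ^ (- d i)) ^+ s * Y i l = 0.
  elim: s => [|s IH] l.
    rewrite -[RHS](cE l); apply: eq_bigr => i _; by rewrite expr0 mulr1 mxE.
  have [l' l'E] := YE l; rewrite -[RHS](IH l'); apply: eq_bigr => i _.
  by rewrite l'E exprSr !mulrA.
(* Summing the twisted relations keeps exactly the rows with [d i] congruent to [d i1] modulo [e],
   their coefficients multiplied by [e], which is invertible in [F]. *)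
pose c' i := c i * \sum_(s < e) (zeta ^ (d i1 - d i)) ^+ s.
have c'Y l : \sum_i c' i * Y i l = 0.
  transitivity (\sum_(s < e) (zeta ^ d i1) ^+ s * \sum_i c i * (zeta ^ (- d i)) ^+ s * Y i l).
    under [RHS]eq_bigr do rewrite mulr_sumr.
    rewrite exchange_big; apply: eq_bigr => i _; rewrite /c' mulrAC mulr_sumr.
    by apply: eq_bigr => s _; rewrite expfzDr // exprMn; ring.
  by rewrite big1 // => s _; rewrite cs mulr0.
have c'0 : exists i, c' i != 0.
  by exists i1; rewrite /c' subrr geom_sum expr0z eqxx mulf_neq0.
have c'e i : c' i != 0 -> zeta ^ (d i1 - d i) = 1.
  by rewrite /c' geom_sum; case: (_ ^ _ =P 1) => // _; rewrite mulr0 eqxx.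
have [i0 [ci0 imax]] := arg_max d c'0.
(* Multiplying row [k] by this power of the variable raises its pole bound from [d k] to [d i0]. *)
pose n k := (`|d i0 - d k| %/ e)%N.
have nE k : c' k != 0 -> d i0 - d k = (e * n k)%N%:Z.
  move=> ck; rewrite /n mulnC divnK; first by rewrite gez0_abs // subr_ge0 imax.
  apply: prim_expz; have -> : d i0 - d k = (d i1 - d k) - (d i1 - d i0) by ring.
  by rewrite expfzDr // c'e // -invr_expz c'e // invr1 mulr1.
pose cc k : kT := emb ((c' k)%:P * 'X^(n k)).
pose d' i := if i == i0 then d i0 - 1 else d i.
exists (repl B i0 cc), d'; split.
- move=> z' i l; rewrite X_repl; case: eqP => // _; apply: reg_sum => k _.
  by apply: regM => //; have [] := regE_fin e0 th_C th_fin z' ((c' k)%:P * 'X^(n k)).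
- move=> i l; rewrite X_repl /d'; case: eqP => _; last exact: bB.
  pose W := \sum_k lauC (c' k) * (lauX F ^ d k * X None B k l).
  have -> : \sum_k th None (cc k) * X None B k l = lauX F ^ (- d i0) * W.
    rewrite mulr_sumr; apply: eq_bigr => k _; have [ck|ck] := eqVneq (c' k) 0.
      by rewrite /cc ck polyC0 mul0r !rmorph0 !mul0r mulr0.
    rewrite /cc rmorphM rmorphM /= th_C rmorphXn rmorphXn /= th_inf exprVn -exprM.
    rewrite -[_ ^- _]/(_^-1) (exprnP _ (e * n k)) -nE // invr_expz opprB.
    rewrite [lauX F ^ (d k - d i0)]expfzDr //; ring.
  have rW : lau_reg W by apply: reg_sum => k _; apply: regM; [exact: reg_C|exact: bB].
  have [||y [ry yE]] := @reg_res0_div W => //.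
    rewrite res_sum => [|k _]; last by apply: regM; [exact: reg_C|exact: bB].
    rewrite -[RHS](c'Y l); apply: eq_bigr => k _.
    by rewrite resM ?res_C //; exact: reg_C.
  rewrite yE mulrA -expfzDr // addrAC subrr add0r mulrA -{2}[lauX F]expr1z -expfzDr //.
  by rewrite addNr expr0z mul1r.
- by apply: det_repl => //; rewrite emb0 mulf_neq0 ?polyC_eq0 // -size_poly_gt0 size_polyXn.
- apply: (sum_upd (i0 := i0)); rewrite /d' ?eqxx // => i /negPf -> //.
Qed.

Let common_denominator : exists c0 : {poly F}, c0 != 0 /\
  forall i, exists b, emb c0 * m`_i = emb b.
Proof.
have ex (i : nat) : exists ab : {poly F} * {poly F}, ab.2 != 0 /\ m`_i = emb ab.1 / emb ab.2.
  by have [a [b [b0 E]]] := emb_frac m`_i; exists (a, b).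
have [ab abP] := choice ex.
exists (\prod_(i < size m) (ab i).2); split; first by apply/prodf_neq0 => i _; exact: (abP i).1.
move=> i; have [ilt|ige] := ltnP i (size m); last first.
  by exists 0; rewrite (nth_default _ ige) mulr0 rmorph0.
exists ((ab i).1 * \prod_(k < size m | k != Ordinal ilt) (ab k).2).
rewrite (bigD1 (Ordinal ilt)) //= (abP i).2 !rmorphM.
have b0 : emb (ab i).2 != 0 by rewrite emb0 (abP i).1.
by rewrite mulrC mulrA divfK.
Qed.

(** If [c0] clears the denominators of [m], then [c0 A] is a root of the monic polynomial with
    coefficients [c0^(r - i) m_i], which are polynomials and hence regular. *)
Let integral_scaled c0 z l : (forall i, exists b, emb c0 * m`_i = emb b) ->
  lau_reg (th (Some z) (emb c0) * A (Some z) l).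
Proof.
move=> c0P; set C := th _ (emb c0).
have mr : m`_r = 1 by have /eqP := mM; rewrite /lead_coef sm.
pose P := \poly_(i < r.+1) (C ^+ (r - i) * th (Some z) m`_i).
have sP : size P = r.+1 by apply: size_poly_eq; rewrite subnn mr rmorph1 mul1r oner_eq0.
apply: (@reg_integral _ P).
- by rewrite monicE /lead_coef sP coef_poly ltnSn subnn mr rmorph1 mul1r.
- move=> i; rewrite coef_poly; case: ifP => [|_]; last exact: reg0.
  rewrite ltnS leq_eqVlt => /predU1P[->|ir].
    by rewrite subnn mr rmorph1 mul1r; exact: reg1.
  have [b bE] := c0P i; rewrite -(prednK (_ : 0 < r - i)%N) ?subn_gt0 // exprSr -mulrA.
  rewrite /C -rmorphM bE; apply: regM; last by have [] := regE_fin e0 th_C th_fin z b.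
  by apply: regXn; have [] := regE_fin e0 th_C th_fin z c0.
- rewrite rootE horner_poly.
  transitivity (C ^+ r * (map_poly (th (Some z)) m).[A (Some z) l] == 0); last first.
    by rewrite (eqP (mA _ _)) mulr0 eqxx.
  rewrite horner_coef size_map_poly sm mulr_sumr; congr (_ == _).
  apply: eq_bigr => i _; rewrite coef_map /= exprMn.
  have ir : (i <= r)%N by rewrite -ltnS.
  have -> : C ^+ r = C ^+ (r - i) * C ^+ i by rewrite -exprD subnK.
  by ring.
Qed.

Let bound_exists B : exists d, bound B d.
Proof.
have ex (il : 'I_r * 'I_r) : exists n : nat, lau_reg (lauX F ^+ n * X None B il.1 il.2).
  have [->|x0] := eqVneq (X None B il.1 il.2) 0; first by exists 0%N; rewrite mulr0; exact: reg0.
  have [[k|k] [u [_ ->]]] := laurent_form x0.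
    exists 0%N; rewrite mul1r; apply: regM; last exact: reg_tofrac.
    exact/regXn/reg_X.
  exists k.+1; rewrite NegzE -exprnN mulVKf ?expf_neq0 //; exact: reg_tofrac.
have [n nP] := choice ex.
exists (fun i => (\sum_l n (i, l))%N%:Z) => i l.
rewrite (bigD1 l) //= addnC -exprnP exprD -mulrA; apply: regM; last exact: (nP (i, l)).
exact/regXn/reg_X.
Qed.

(** A lattice with [sum d] minimal cannot be reduced anywhere, which forces [sum d = 0]. A row with
    negative bound would be constant and zero at infinity, so every [d i] is zero and all rows are
    constant; inverting [B] expresses the generator through the base. *)
Theorem lattice_rational : (1 < r)%N -> forall l, exists x, A None l = th None x.
Proof.
move=> r1.
pose good (n : nat) := exists B d, [/\ integral B, bound B d, \det B != 0 & \sum_i d i = n%:Z].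
have exg : exists n, `[< good n >].
  have [c0 [c00 c0P]] := common_denominator.
  (* The powers of the generator, scaled: all exponents are below [r], so [c0^r] makes them
     integral. *)
  pose B : 'M[kT]_r := (emb c0 ^+ r)%:M.
  have [d bB] := bound_exists B.
  have iB : integral B.
    move=> z i l; rewrite /X map_scalar_mx mul_scalar_mx !mxE rmorphXn /=.
    have ir : (i <= r)%N by rewrite ltnW.
    set C := th _ _; have -> : C ^+ r = C ^+ (r - i) * C ^+ i by rewrite -exprD subnK.
    rewrite -mulrA -exprMn; apply: regM; apply: regXn.
      by have [] := regE_fin e0 th_C th_fin z c0.
    exact: integral_scaled.
  have dB : \det B != 0 by rewrite det_scalar !expf_neq0 // emb0.
  have := sum_bound_ge0 iB bB dB; case E : (\sum_i d i) => [n|//] _.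
  by exists n; apply/asboolP; exists B, d.
have [n /asboolP[B [d [iB bB dB dn]]] nmin] := ex_minnP exg.
have nred B' d' (k : nat) : (0 < k)%N -> integral B' -> bound B' d' -> \det B' != 0 ->
    \sum_i d' i = \sum_i d i - k%:Z -> False.
  move=> k0 iB' bB' dB' E; have := sum_bound_ge0 iB' bB' dB'.
  case E' : (\sum_i d' i) => [n'|//] _.
  have /nmin : `[< good n' >] by apply/asboolP; exists B', d'.
  by move: E; rewrite E' dn; lia.
have fin z : \det (\matrix_(i, l) lau_res (X (Some z) B i l)) != 0.
  apply/eqP => h; have [B' [d' [iB' bB' dB' E]]] := reduce_fin iB bB dB h.
  exact: (nred B' d' e).
have inf : \det (\matrix_(i, l) lau_res (lauX F ^ d i * X None B i l)) != 0.
  apply/eqP => h; have [B' [d' [iB' bB' dB' E]]] := reduce_inf iB bB dB h.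
  exact: (nred B' d' 1%N).
have [P PE] := disc_poly iB.
(* A root of [P] would be a finite point at which the determinant has residue zero. *)
have [c cP] : exists c, P = c%:P.
  have [P1|P1] := leqP (size P) 1; first by exists P`_0; exact: size1_polyC.
  have [z /eqP Pz] := closed_axiom_root clF P1.
  have := fin z; have [rd <-] := reg_det (iB z) => /negP[].
  have := congr1 (@lau_res F) (det_X (Some z) B).
  by rewrite PE (regE_fin e0 th_C th_fin z P).2 Pz resXn // => /eqP; rewrite expf_eq0.
have rY i l : lau_reg ((\matrix_(i, l) (lauX F ^ d i * X None B i l)) i l).
  by rewrite mxE; exact: bB.
have Yinf : lau_res (\det (\matrix_(i, l) (lauX F ^ d i * X None B i l))) != 0.
  rewrite (reg_det rY).2; move: inf; congr (\det _ != 0).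
  by apply/matrixP => i l; rewrite !mxE.
(* Otherwise the squared determinant at infinity, [x^(2 sum d)] times a constant, would have residue
   zero. *)
have d0 : \sum_i d i = 0.
  have := congr1 (@lau_res F) (detXinf B d); rewrite PE cP th_C dn.
  rewrite resXn; last by have [] := reg_det rY.
  case: n dn {nmin} => // n dn; rewrite resM ?res_C; last 2 first.
  - exact/regXn/reg_vz.
  - exact: reg_C.
  rewrite resXn; last exact: reg_vz.
  by rewrite res_vz // expr0n mul0r => /eqP; rewrite expf_eq0 (negPf Yinf).
have const i : d i <= 0 -> forall l, exists x, X None B i l = lauC x.
  move=> di l; rewrite X_poly; apply: norm => -[z|] l'; rewrite -X_poly //.
  have -> : X None B i l' = lauX F ^ (- d i) * (lauX F ^ d i * X None B i l').
    by rewrite mulrA -expfzDr // addNr expr0z mul1r.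
  by apply: regM; [apply: reg_vz; rewrite oppr_ge0|exact: bB].
have dge i : 0 <= d i.
  rewrite leNgt; apply/negP => di.
  have z l : X None B i l = 0.
    have [x xE] := const i (ltW di) l.
    suff x0 : x = 0 by rewrite xE x0 rmorph0.
    rewrite -(res_C x) -xE.
    have -> : X None B i l = lauX F ^ (- d i) * (lauX F ^ d i * X None B i l).
      by rewrite mulrA -expfzDr // addNr expr0z mul1r.
    rewrite resM; [|by apply: reg_vz; rewrite oppr_ge0 ltW|exact: bB].
    by rewrite res_vz ?oppr_gt0 // mul0r.
  move/negP: inf; apply; rewrite (expand_det_row _ i) big1 // => l _.
  by rewrite mxE z mulr0 res0 mul0r.
have dz i : d i = 0.
  by apply/eqP; move/eqP: d0; rewrite psumr_eq0 // => /allP/(_ i (mem_index_enum _)).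
have const' i l : exists x, X None B i l = lauC x by apply: const; rewrite dz.
move=> l; have ex i : exists x, X None B i l = lauC x by exact: const'.
have [x xE] := choice ex.
have Bu : B \in unitmx by rewrite unitmxE unitfE.
(* [Ordinal r1] is the index [1]: this row of the power matrix is the generator itself. *)
exists (\sum_i invmx B (Ordinal r1) i * emb (x i)%:P).
have : V None = map_mx (th None) (invmx B) *m X None B.
  by rewrite /X mulmxA -map_mxM mulVmx // map_mx1 mul1mx.
move/matrixP/(_ (Ordinal r1) l); rewrite !mxE expr1 => ->.
rewrite rmorph_sum; apply: eq_bigr => i _.
by rewrite rmorphM /= th_C -xE mxE.
Qed.

End Lattice.

(** * Covers unramified outside one point *)

Lemma reg_prod_XsubC (F : fieldType) r (y : 'I_r -> laurent F) :
  (forall l, lau_reg (y l)) -> forall n, lau_reg (\prod_l ('X - (y l)%:P))`_n.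
Proof.
move=> ry; elim/big_rec: _ => [|l P _ IH] n.
  by rewrite coef1; case: (n == 0)%N; [exact: reg1|exact: reg0].
rewrite mulrBl coefB coefXM coefCM; apply: regB; last exact: regM.
by case: (n == 0)%N; [exact: reg0|].
Qed.

Section FixedField.
Variables (k M : fieldType) (j : {rmorphism k -> M}) (hM : is_sep_closure j).

(** If the minimal polynomial of [x] were not linear, it would have a second root, being separable,
    and an automorphism would carry [x] there. *)
Lemma fixed_field x : (forall s : {rmorphism M -> M}, (forall c, s (j c) = j c) -> s x = x) ->
  exists c, j c = x.
Proof.
move=> fx; have [P sP Px] := hM.1 x.
have [m [m1 mx mmin]] := min_annihilator (separable_poly_neq0 sP) Px.
have m0 : m != 0 by rewrite -size_poly_gt0 ltnW.
have sm : separable_poly (map_poly j m).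
  by rewrite separable_map; apply: dvdp_separable sP; exact: mmin.
have /factor_theorem[q qE] := mx.
have q0 : q != 0 by apply: contraTneq sm => q0; rewrite qE q0 mul0r; apply/negP => /separable_poly_neq0/eqP.
have sq : (size q).+1 = size m.
  by rewrite -(size_map_poly j) qE size_mul ?polyXsubC_eq0 // size_XsubC addn2.
have [q1|q1] := leqP (size q) 1.
  have m2 : size m = 2%N by apply/eqP; rewrite eqn_leq m1 -sq ltnS q1.
  exists (- m`_0 / m`_1).
  have l0 : m`_1 != 0 by have := m0; rewrite -lead_coef_eq0 /lead_coef m2.
  move: mx; rewrite rootE horner_coef size_map_poly m2 !big_ord_recl big_ord0 addr0 /=.
  rewrite !coef_map expr0 mulr1 expr1 addrC addr_eq0 => /eqP E.
  rewrite fmorph_div rmorphN -E mulrC mulKf // fmorph_eq0 //.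
have sqq : separable_poly q by apply: dvdp_separable sm; rewrite qE dvdp_mulr.
have [y qy] := hM.2 q sqq q1.
have yx : y != x.
  apply/negP => /eqP yx; move: sm; rewrite qE separable_root -yx qy andbF //.
have my : root (map_poly j m) y by rewrite qE rootM qy.
have [D [i [j1 [j2 [b [j1E j2E bx by_]]]]]] := embedding_adjoin m0 mx my mmin.
have [s sE] := sep_closure_extension hM j2 j1E.
have := fx s; rewrite -bx sE by_ => E; move: yx; rewrite E ?bx ?eqxx // => c.
by rewrite -j1E sE j2E.
Qed.

End FixedField.

(** * The cover generated by the conjugates of an element *)

Section TrivialCover.
Variables (L M F : fieldType) (j : {rmorphism {fraction {poly L}} -> M})
  (hM : is_sep_closure j) (clF : GRing.closed_field_axiom F).
Local Notation kL := {fraction {poly L}}.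
Local Notation lau := (laurent F).
Variables (kT : fieldType) (emb : {rmorphism {poly F} -> kT}).
Hypotheses (emb0 : forall P, (emb P == 0) = (P == 0))
  (emb_frac : forall x, exists a b : {poly F}, b != 0 /\ x = emb a / emb b).
Variable io : {rmorphism kL -> kT}.
Hypothesis io_pi : forall x : kT, exists q, [pchar F].-nat q /\ exists c, x ^+ q = io c.
Variables (e : nat) (e0 : (0 < e)%N) (eF : e%:R != 0 :> F).
Variable th : P1 F -> {rmorphism kT -> lau}.
Hypothesis th_C : forall z c, th z (emb c%:P) = lauC c.
Hypothesis th_fin : forall z, th (Some z) (emb 'X) = lauC z + lauX F ^+ e.
Hypothesis th_inf : th None (emb 'X) = (lauX F ^+ e)^-1.
Variables (zeta : F) (tau : {rmorphism lau -> lau}).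
Hypotheses (zP : e.-primitive_root zeta) (tz : is_rot zeta tau).
Local Notation gal := (gal_auto j).
Variable a : M.

(** A place of the cover above [z]: [D] contains all conjugates of [a] and expands them in Laurent
    series. At finite points [tau] fixes the expansions, which expresses that these points are
    unramified; at infinity it only permutes the conjugates. *)
Hypothesis place : forall z : P1 F, exists (D : fieldType) (i : {rmorphism kL -> D})
  (k1 : {rmorphism D -> M}) (k2 : {rmorphism D -> lau}),
  [/\ forall c, k1 (i c) = j c, forall c, k2 (i c) = th z (io c),
      forall s, gal s -> exists b, k1 b = s a &
      forall s b, gal s -> k1 b = s a ->
        if z is Some _ then tau (k2 b) = k2 b
        else exists s' b', [/\ gal s', k1 b' = s' a & tau (k2 b) = k2 b']].

Lemma conjugates : exists rs : seq M, uniq rs /\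
  forall x, (x \in rs) <-> exists2 s, gal s & s a = x.
Proof.
have [P sP Pa] := hM.1 a.
have [|rs [urs rsP]] := @poly_root_seq _ (map_poly j P).
  by rewrite map_poly_eq0 separable_poly_neq0.
exists [seq x <- rs | `[< exists2 s, gal s & s a = x >]]; split; first exact: filter_uniq.
move=> x; rewrite mem_filter; split=> [/andP[/asboolP//]|sx].
apply/andP; split; first exact/asboolP.
case: sx => s sg <-; rewrite rsP.
have <- : map_poly s (map_poly j P) = map_poly j P.
  by rewrite -map_poly_comp; apply: eq_map_poly => c /=; rewrite sg.
exact: rmorph_root.
Qed.

Section Values.
Variables (r : nat) (al : 'I_r -> M).
Hypotheses (al_inj : injective al)
  (alP : forall x, (exists l, al l = x) <-> exists2 s, gal s & s a = x).

Let sym (E : zmodType) (s : {rmorphism M -> M}) : gal s ->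
  exists pi : 'I_r -> 'I_r, injective pi /\ forall l, s (al l) = al (pi l).
Proof.
move=> sg; have ex l : exists l', al l' = s (al l).
  apply/alP; have [s' s'g <-] := (alP (al l)).1 (ex_intro _ l erefl).
  by exists (s \o s') => //; move=> c /=; rewrite s'g sg.
have [pi piP] := choice ex; exists pi; split=> // l l' ll'.
by apply: al_inj; apply: (fmorph_inj s); rewrite -!piP ll'.
Qed.

Lemma power_sum_descends n : exists c, j c = \sum_l al l ^+ n.
Proof.
apply: (fixed_field hM) => s sg; have [pi [piI piE]] := sym M sg.
rewrite rmorph_sum [RHS](reindex_inj piI); apply: eq_bigr => l _.
by rewrite rmorphXn /= piE.
Qed.

Lemma char_poly_descends (g : {poly kL}) : exists Q : {poly kL},
  map_poly j Q = \prod_l ('X - ((map_poly j g).[al l])%:P).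
Proof.
set N := \prod_l _.
have ex n : exists c, j c = N`_n.
  apply: (fixed_field hM) => s sg; rewrite -coef_map.
  suff -> : map_poly s N = N by [].
  have [pi [piI piE]] := sym M sg.
  rewrite rmorph_prod [RHS](reindex_inj piI); apply: eq_bigr => l _.
  rewrite rmorphB /= map_polyX map_polyC /= -horner_map piE -map_poly_comp.
  by congr (_ - (_.[_])%:P); apply: eq_map_poly => c /=; rewrite sg.
have [c cP] := choice ex; exists (\poly_(n < size N) c n).
apply/polyP => n; rewrite coef_map coef_poly; case: ltnP => nN /=; first exact: cP.
by rewrite rmorph0 nth_default.
Qed.

(** Relations among the conjugates are polynomial identities over [L(t)], so they pass from [M] to
    Laurent series through [D]. *)
Lemma place_values z : exists A : 'I_r -> lau,
  [/\ forall n c, j c = \sum_l al l ^+ n -> \sum_l A l ^+ n = th z (io c),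
      forall g Q : {poly kL}, map_poly j Q = \prod_l ('X - ((map_poly j g).[al l])%:P) ->
        map_poly (th z \o io) Q = \prod_l ('X - ((map_poly (th z \o io) g).[A l])%:P),
      forall l q c, A l ^+ q = th z (io c) -> al l ^+ q = j c &
      forall l, if z is Some _ then tau (A l) = A l else exists l', tau (A l) = A l'].
Proof.
have [D [i [k1 [k2 [k1E k2E ka kt]]]]] := place z.
have ex l : exists b, k1 b = al l.
  by have [s sg <-] := (alP (al l)).1 (ex_intro _ l erefl); exact: ka.
have [b bP] := choice ex.
have mapE (E : fieldType) (k0 : {rmorphism D -> E}) (h : kL -> E) (g : {poly kL}) :
    (forall c, k0 (i c) = h c) -> map_poly k0 (map_poly i g) = map_poly h g.
  by move=> hE; rewrite -map_poly_comp; apply: eq_map_poly => c /=.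
have mapX (E : fieldType) (k0 : {rmorphism D -> E}) (x : D) :
    map_poly k0 ('X - x%:P) = 'X - (k0 x)%:P.
  by rewrite rmorphB /= map_polyX map_polyC.
exists (k2 \o b); split=> /=.
- move=> n c cE; have : i c = \sum_l b l ^+ n.
    apply: (fmorph_inj k1); rewrite k1E cE rmorph_sum; apply: eq_bigr => l _.
    by rewrite rmorphXn /= bP.
  move=> /(congr1 k2); rewrite k2E => ->; rewrite rmorph_sum; apply: eq_bigr => l _.
  by rewrite rmorphXn.
- move=> g Q QE; have : map_poly i Q = \prod_l ('X - ((map_poly i g).[b l])%:P).
    apply: (map_poly_inj k1); rewrite (mapE _ _ j) // QE rmorph_prod.
    by apply: eq_bigr => l _; rewrite -[RHS]/(map_poly k1 _) mapX -(horner_map k1) bP (mapE _ _ j).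
  move=> /(congr1 (map_poly k2)); rewrite (mapE _ _ (th z \o io)) // => ->.
  rewrite rmorph_prod; apply: eq_bigr => l _.
  by rewrite -[LHS]/(map_poly k2 _) mapX -(horner_map k2) (mapE _ _ (th z \o io)).
- move=> l q c; rewrite -rmorphXn -k2E => /fmorph_inj bE.
  by rewrite -bP -rmorphXn bE k1E.
- move=> l; have [s sg sl] := (alP (al l)).1 (ex_intro _ l erefl).
  have := kt s (b l) sg; rewrite bP sl => /(_ erefl).
  case: z k2E kt => // k2E kt [s' [b' [s'g b'E ->]]].
  have [l' l'E] := (alP (s' a)).2 (ex_intro2 _ _ s' s'g erefl).
  by exists l'; congr (k2 _); apply: (fmorph_inj k1); rewrite b'E bP.
Qed.

Lemma pi_family n (g : 'I_n -> kT) : exists q, [pchar F].-nat q /\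
  exists c : 'I_n -> kL, forall k, g k ^+ q = io (c k).
Proof.
have ex k : exists qc : nat * kL, [pchar F].-nat qc.1 /\ g k ^+ qc.1 = io qc.2.
  by have [q [qF [c cE]]] := io_pi (g k); exists (q, c).
have [qc qcP] := choice ex.
exists (\prod_k (qc k).1)%N; split.
  by apply: (big_ind (fun x => [pchar F].-nat x)) => // [x y xF yF|k _]; [rewrite pnatM xF yF | exact: (qcP k).1].
exists (fun k => (qc k).2 ^+ (\prod_(k' | k' != k) (qc k').1)%N) => k.
by rewrite (bigD1 k) //= exprM (qcP k).2 rmorphXn.
Qed.

Lemma const_of_algebraic (Q : {poly F}) (x : lau) : Q != 0 ->
  root (map_poly (@lauC F) Q) x -> exists c, x = lauC c.
Proof.
move=> Q0; have [rs ->] := closed_axiom_split clF Q.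
rewrite map_polyZ /= rmorph_prod rootZ ?fmorph_eq0 ?lead_coef_eq0 //.
rewrite (eq_bigr (fun c => 'X - (lauC c)%:P)); last first.
  by move=> c _; rewrite rmorphB /= map_polyX map_polyC.
by rewrite -(big_map (@lauC F) xpredT (fun x => 'X - x%:P)) root_prod_XsubC => /mapP[c _ ->]; exists c.
Qed.

Lemma pchar_lau q : [pchar F].-nat q -> [pchar lau].-nat q.
Proof.
move=> qF; rewrite (eq_pnat _ (fmorph_pchar (@lauC F))) //.
Qed.

(** The coefficients of [g] are only purely inseparable over [L(t)], so a [q]-th power is taken
    first. Its characteristic polynomial over [L(t)] has coefficients that are regular everywhere,
    hence constant; a Laurent series algebraic over the closed field [F] is constant too. *)
Lemma regular_norm (A : P1 F -> 'I_r -> lau) :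
  (forall z (g Q : {poly kL}), map_poly j Q = \prod_l ('X - ((map_poly j g).[al l])%:P) ->
        map_poly (th z \o io) Q = \prod_l ('X - ((map_poly (th z \o io) g).[A z l])%:P)) ->
  forall g : {poly kT}, (forall z l, lau_reg (map_poly (th z) g).[A z l]) ->
  forall l, exists c, (map_poly (th None) g).[A None l] = lauC c.
Proof.
move=> AQ g rg l0.
have [q [qF [c cE]]] := pi_family (fun k : 'I_(size g) => g`_k).
have qL := pchar_lau qF.
have q0 : (0 < q)%N by case/andP: qF.
(* By Frobenius, [g'] takes at each conjugate the [q]-th power of the value of [g]. *)
pose g' : {poly kL} := \sum_k c k *: 'X^(k * q).
have g'E z l : (map_poly (th z \o io) g').[A z l] = (map_poly (th z) g).[A z l] ^+ q.
  rewrite rmorph_sum horner_sum horner_coef size_map_poly.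
  rewrite (big_morph (fun x : lau => x ^+ q) (id1 := 0) (op1 := +%R)); last 2 first.
  - by move=> x y; rewrite exprDn_pchar.
  - by rewrite expr0n gtn_eqF.
  apply: eq_bigr => k _; rewrite /= map_polyZ map_polyXn !hornerE /= -cE.
  by rewrite coef_map exprMn rmorphXn exprM.
have [Q QE] := char_poly_descends g'.
have rQ z n : lau_reg (th z (io Q`_n)).
  rewrite -[th z _]/((th z \o io) Q`_n) -coef_map (AQ z g' Q QE).
  apply: (reg_prod_XsubC (y := fun l => (map_poly (th z \o io) g').[A z l])) => l.
  by rewrite g'E; exact: regXn.
have exc n : exists d, io Q`_n = emb d%:P.
  have [P PE] := regular_poly clF e0 emb0 emb_frac th_C th_fin (fun z => rQ (Some z) n).
  have [|d dE] := @regular_const _ _ e0 _ _ th th_C th_inf P; first by rewrite -PE.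
  by exists d; rewrite PE dE.
have [dc dcE] := choice exc.
pose Q0 := \poly_(n < size Q) dc n.
have Q0E : map_poly (@lauC F) Q0 = map_poly (th None \o io) Q.
  apply/polyP => n; rewrite !coef_map coef_poly /=; case: ltnP => nQ.
    by rewrite dcE th_C.
  by rewrite (nth_default _ nQ) !rmorph0.
have Q00 : Q0 != 0.
  rewrite -(map_poly_eq0 (@lauC F)) Q0E (AQ None g' Q QE).
  by apply/monic_neq0/monic_prod_XsubC.
have [|y yE] := @const_of_algebraic Q0 (map_poly (th None \o io) g').[A None l0] Q00.
  by rewrite Q0E (AQ None g' Q QE) (bigD1 l0) //= rootM root_XsubC eqxx.
have [||x] := @const_of_algebraic ('X^q - y%:P) (map_poly (th None) g).[A None l0].
- by rewrite -size_poly_eq0 size_XnsubC.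
- by rewrite rootE rmorphB /= map_polyXn map_polyC !hornerE -g'E yE subrr.
- by exists x.
Qed.

(** A single conjugate leaves nothing to prove. Otherwise the lattice argument makes the conjugates
    expansions of elements of [kT]; their [q]-th powers descend to [L(t)], and [q]-th roots are
    unique. *)
Lemma values_trivial : forall s, gal s -> forall l, s (al l) = al l.
Proof.
have [r1|r1] := leqP r 1.
  move=> s sg l; have [pi [_ ->]] := sym M sg; congr al; apply: val_inj.
  have z (x : 'I_r) : x = 0%N :> nat.
    by apply/eqP; rewrite -leqn0 -ltnS (leq_trans (ltn_ord x) r1).
  by rewrite /= !z.
have [A AP] := choice place_values.
have A1 z := let: And4 h _ _ _ := AP z in h.
have A2 z := let: And4 _ h _ _ := AP z in h.
have A3 z := let: And4 _ _ h _ := AP z in h.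
have A4 z := let: And4 _ _ _ h := AP z in h.
have [ps psE] := choice power_sum_descends.
have [m0 m0E] := char_poly_descends 'X.
(* Gram matrix of the trace form: a Vandermonde matrix times its transpose, nonsingular because the
   conjugates are distinct. *)
pose S0 : 'M[kL]_r := \matrix_(k, l) ps (k + l)%N.
have S0E : map_mx j S0 = (\matrix_(k < r, l < r) al l ^+ k) *m (\matrix_(k < r, l < r) al l ^+ k)^T.
  apply/matrixP => k l; rewrite !mxE psE; apply: eq_bigr => h _.
  by rewrite !mxE exprD.
have detS : \det S0 != 0.
  rewrite -(fmorph_eq0 j) -det_map_mx S0E det_mulmx det_tr.
  have -> : (\matrix_(k < r, l < r) al l ^+ k) = Vandermonde r (\row_l al l).
    by apply/matrixP => k l; rewrite !mxE.
  rewrite det_Vandermonde mulf_neq0 //; apply/prodf_neq0 => k _; apply/prodf_neq0 => l kl;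
    by rewrite !mxE subr_eq0 (inj_eq al_inj) -val_eqE gtn_eqF.
pose m : {poly kT} := map_poly io m0.
have mM0 : m0 \is monic.
  by rewrite -(map_monic j) m0E; exact: monic_prod_XsubC.
have sm0 : size m0 = r.+1.
  by rewrite -(size_map_poly j) m0E size_prod_XsubC /index_enum -enumT size_enum_ord.
have H := @lattice_rational F clF e e0 kT emb emb0 emb_frac th th_C th_fin th_inf zeta tau
  zP tz eF r A (map_mx io S0) m.
have [||||||||x xE] := choice (H _ _ _ _ _ _ _ _ r1).
- move=> z; apply/matrixP => k l; rewrite !mxE -(A1 z _ _ (psE (k + l)%N)).
  by apply: eq_bigr => h _; rewrite !mxE exprD.
- by rewrite det_map_mx fmorph_eq0.
- by rewrite map_monic.
- by rewrite size_map_poly.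
- move=> z l; rewrite /m -map_poly_comp (A2 z 'X m0 m0E).
  by rewrite (bigD1 l) //= map_polyX !hornerX rootM root_XsubC eqxx.
- by move=> z l; exact: (A4 (Some z) l).
- by move=> l; exact: (A4 None l).
- exact: regular_norm.
move=> s sg l; have [q [qF [c cE]]] := io_pi (x l).
have aq : al l ^+ q = j c by apply: (A3 None); rewrite xE -rmorphXn cE.
have qM : [pchar M].-nat q.
  apply: etrans qF; rewrite (eq_pnat _ (fmorph_pchar j)) -(eq_pnat _ (fmorph_pchar io)).
  by rewrite -(eq_pnat _ (fmorph_pchar (th None))) (eq_pnat _ (fmorph_pchar (@lauC F))).
by apply: (pchar_nat_exprI qM); rewrite /= -rmorphXn aq sg.
Qed.

End Values.

Theorem trivial_cover : forall s, gal s -> s a = a.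
Proof.
have [rs [urs rsP]] := conjugates.
pose al (l : 'I_(size rs)) := nth 0 rs l.
have al_inj : injective al.
  by move=> l l' /eqP; rewrite nth_uniq // => /eqP /val_inj.
have alP x : (exists l, al l = x) <-> exists2 s, gal s & s a = x.
  rewrite -rsP; split=> [[l <-]|xrs]; first exact: mem_nth.
  have xl : (index x rs < size rs)%N by rewrite index_mem.
  by exists (Ordinal xl); rewrite /al nth_index.
move=> s sg; have /alP[l <-] : exists2 s, gal s & s a = a by exists idfun.
exact: values_trivial.
Qed.

End TrivialCover.

(** * Inertia on the tree *)

Lemma at_pt_nconst (F : fieldType) (x : laurent F) (y : P1 F) N c : at_pt x y N -> x <> lauC c.
Proof.
move=> [N0 [u [u0 ->]]]; have a0 := psX_pow_mul0 u N0.
have an := psX_pow_mul_neq0 N u0; case: y => [y|] /=.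
  rewrite -tofracD => /tofrac_inj E.
  have := congr1 (fun a : pser F => a 0%N) E; rewrite psDE a0 addr0 /= !mulr1n => yc.
  by move: E an; rewrite yc -[RHS]addr0 => /addrI ->; rewrite eqxx.
move=> E; have : tofrac 1 = tofrac (psC c * (psX F ^+ N * u)) :> laurent F.
  by rewrite tofracM -[tofrac (psC c)]/(lauC c) -E mulVf ?tofrac1 // tofrac_eq0.
by move/tofrac_inj/(congr1 (fun a : pser F => a 0%N))/eqP; rewrite psM0 a0 mulr0 oner_eq0.
Qed.

(** [r] and its rotation have the same image and, since [zeta^N = 1], the same leading coefficient
    at the same point, so they coincide. *)
Lemma rot_fixes_at_pt (F : fieldType) (p q : {poly F}) (zeta : F)
    (tau : {rmorphism laurent F -> laurent F}) r x y N :
  coprimep p q -> (0 < pair_degree p q)%N -> is_rot zeta tau ->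
  (pair_local_degree p q y)%:R != 0 :> F ->
  P1map (map_poly (@lauC F) p) (map_poly (@lauC F) q) (Some r) = Some x ->
  tau x = x -> at_pt r y N -> zeta ^+ N = 1 -> tau r = r.
Proof.
move=> cop d0 tz ey fr tx [N0 [u [u0 rE]]] zN.
have rotE : ps_rot zeta (psX F ^+ N * u) = psX F ^+ N * ps_rot zeta u.
  apply: pser_eq => i; rewrite -[LHS]/(zeta ^+ i * (psX F ^+ N * u) i) !psXnM.
  case: ltnP => [_|Ni]; first by rewrite mulr0.
  by rewrite /= -{1}(subnK Ni) exprD zN mulr1.
have trE : tau r = chart y (tofrac (psX F ^+ N * ps_rot zeta u)).
  rewrite rE -rotE -tz; case: y {ey rE} => [c|] /=; last by rewrite fmorphV.
  by rewrite rmorphD /= (rot_C tz).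
have u0' : u 0%N = (ps_rot zeta u) 0%N by rewrite /= expr0 mul1r.
rewrite trE rE; congr (chart y (tofrac (_ * _))); apply/esym.
apply: (at_pt_same_lead cop d0 N0 ey u0 u0' (x := x)); rewrite -?rE -?trE //.
have := P1map_map tau (map_poly (@lauC F) p) (map_poly (@lauC F) q) (Some r).
rewrite -!map_poly_comp fr /= tx => <-; congr (P1map _ _ _).
  by apply: eq_map_poly => c /=; rewrite (rot_C tz).
by apply: eq_map_poly => c /=; rewrite (rot_C tz).
Qed.

Section Places.
Variables (K : fieldType) (f : {fraction {poly K}}) (L : fieldType)
  (iL : {rmorphism K -> L}) (M : fieldType)
  (j : {rmorphism {fraction {poly L}} -> M}) (hM : is_sep_closure j)
  (lam : labeling f iL j) (F : fieldType) (iO : {rmorphism L -> F}).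
Hypotheses (clF : GRing.closed_field_axiom F) (hd : (0 < ratdeg f)%N).
Local Notation d := (ratdeg f).
Local Notation t := (tvar j).
Local Notation kL := {fraction {poly L}}.
Local Notation lau := (laurent F).
Local Notation gal := (gal_auto j).
Local Notation fM := (ratmap (const_emb iL j) f).
Let eK : {rmorphism K -> F} := iO \o iL.
Local Notation fF := (ratmap eK f).
Local Notation ld := (local_degree eK f).
Local Notation iter_ld := (iter_ld f eK).
Hypothesis tame : forall y, (ld y)%:R != 0 :> F.

(** A common multiple of all local degrees that is invertible in [F]; one factor is reserved for
    each level of the tree. *)
Definition tame_exp : nat := (\prod_(k < d.+1 | (k%:R : F) != 0%R) k)%N.

Lemma ld_le y : (ld y <= d)%N.
Proof.
have n0 := fiber_neq0 (cop_F f eK) (pair_degree_F_gt0 eK hd).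
rewrite /local_degree /pair_local_degree; case: y => [c|]; last first.
  by rewrite (leq_trans (leq_subr _ _)) // pair_degree_F.
set h := fiber_poly _ _ _; have h0 : h != 0 := n0 _.
have : ('X - c%:P) ^+ mup c h %| h by rewrite -mup_geq.
move/(dvdp_leq h0); rewrite size_exp_XsubC -[(mup c h <= d)%N]ltnS => /leq_trans; apply.
have [sp sq] := size_pair (map_poly eK (numer f)) (map_poly eK (denom f)).
rewrite pair_degree_F in sp sq; rewrite /h; case: (P1map _ _ _) => [b|] //=.
rewrite (leq_trans (size_polyD _ _)) // size_polyN geq_max sp.
by rewrite (leq_trans (size_scale_leq _ _)).
Qed.

Lemma ld_dvd_tame y : (ld y %| tame_exp)%N.
Proof.
have lt : (ld y < d.+1)%N by rewrite ltnS ld_le.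
by rewrite /tame_exp (bigD1 (Ordinal lt)) /= ?tame // dvdn_mulr.
Qed.

Lemma tame_exp_neq0 : tame_exp%:R != 0 :> F.
Proof.
rewrite /tame_exp natr_prod; by apply/prodf_neq0 => k k0.
Qed.

Let kLau : {rmorphism K -> lau} := @lauC F \o eK.
Local Notation fL := (ratmap kLau f).
Let p := map_poly eK (numer f).
Let q := map_poly eK (denom f).

Let fLE : fL = P1map (map_poly (@lauC F) p) (map_poly (@lauC F) q).
Proof. by rewrite /ratmap /p /q -!map_poly_comp. Qed.

Lemma iter_ldD n k y : iter_ld (n + k) y = (iter_ld n y * iter_ld k (iter n fF y))%N.
Proof.
elim: n y => [|n IH] y; first by rewrite iter_ld0 mul1n.
by rewrite addSn !iter_ldS IH -iterSr mulnA.
Qed.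

Lemma at_pt_iter n x y N : at_pt x y N ->
  exists x', iter n fL (Some x) = Some x' /\ at_pt x' (iter n fF y) (iter_ld n y * N).
Proof.
elim: n => [|n IH] xy; first by exists x; rewrite iter_ld0 mul1n.
have [x' [xE x'y]] := IH xy.
have [x'' []] := at_pt_map (cop_F f eK) (pair_degree_F_gt0 eK hd) x'y.
rewrite -fLE => x''E x''y; exists x''; split; first by rewrite /= xE.
move: x''y; congr at_pt; rewrite -addn1 iter_ldD iter_ldS iter_ld0 muln1.
by rewrite mulnCA mulnA mulnC mulnA.
Qed.

(** * Laurent expansions of the tree over an iterate of [t] *)

Section Embedding.
Variables (z : P1 F) (e : nat) (zeta : F) (tau : {rmorphism lau -> lau})
  (g2 : {rmorphism kL -> lau}) (jj n0 : nat).
Hypotheses (e0 : (0 < e)%N) (zP : e.-primitive_root zeta) (tz : is_rot zeta tau)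
  (g2_C : forall c : L, g2 (tofrac c%:P) = lauC (iO c))
  (g2_tau : forall x, tau (g2 x) = g2 x)
  (g2_t : at_pt (g2 (tofrac 'X)) z e)
  (ce : (tame_exp ^ n0 %| e)%N).

Variable tst : M.
Hypothesis tstE : iter jj fM (Some t) = Some tst.

(** An isomorphism over the constants carries [t] to any preimage of [tst], so what holds for the
    fibre of [t] holds for every fibre in this tree. *)
Lemma base_iso n x : iter n fM (Some x) = Some tst ->
  exists A : {rmorphism M -> M}, A t = x /\ forall c : L, A (j (tofrac c%:P)) = j (tofrac c%:P).
Proof.
move=> xE; have [w sw] : exists w : word d, size w = jj.
  by exists (nseq jj (Ordinal hd)); rewrite size_nseq.
have [r [Lr rL rc]] := Lam_inv lam w.
have Lt : Lam lam w tst = t.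
  apply: Some_inj; have := Lam_iter lam w jj (Some t); rewrite tstE /=.
  by rewrite -[Some (Lam lam w t)]/(Some (pt lam w)) -sw (pt_V lam w) => ->.
have : preimages f iL j n t (Lam lam w x).
  by rewrite /preimages /= -[Some (Lam _ _ _)]/(omap (Lam lam w) (Some x)) Lam_iter xE /= Lt.
move=> /(pt_surj lam)[v [_ vE]].
exists (r \o Lam lam v); split; first by rewrite /= -[Lam lam v t]/(pt lam v) vE Lr.
by move=> c; rewrite /= Lam_const rc.
Qed.

Lemma orbit_nconst n x : iter n fM (Some x) = Some tst -> forall c : L, x <> j (tofrac c%:P).
Proof.
move=> /base_iso[A [<- Ac]] c; rewrite -{1}Ac => /fmorph_inj; exact: tvar_nconst.
Qed.

Lemma fiber_M n x : iter n fM (Some x) = Some tst ->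
  exists rs : seq M, [/\ uniq rs, size rs = d & forall s, s \in rs -> fM (Some s) = Some x].
Proof.
move=> /base_iso[A [<- Ac]].
exists [seq A (lab_pt lam i) | i <- enum 'I_d]; split.
- rewrite map_inj_uniq ?enum_uniq // => i i' /fmorph_inj; exact: lab_pt_inj.
- by rewrite size_map size_enum_ord.
- move=> _ /mapP[i _ ->].
  have := ratmap_equivariant f iL Ac 1 (Some (lab_pt lam i)).
  by rewrite /= lab_pt_V.
Qed.

(** The expansion of [tst]; the default [0] is never taken. *)
Let rho := xget 0 [set x | iter jj fL (Some (g2 (tofrac 'X))) = Some x].
Let w := iter jj fF z.
Let rho_spec : iter jj fL (Some (g2 (tofrac 'X))) = Some rho /\ at_pt rho w (iter_ld jj z * e).
Proof.
have [x [xE xw]] := at_pt_iter jj g2_t; rewrite /rho; case: xgetP => [y _ /= yE|/(_ x)//].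
by move: xE; rewrite yE => -[->].
Qed.

Section InD.
Variables (D : fieldType) (i : {rmorphism kL -> D}) (k1 : {rmorphism D -> M})
  (k2 : {rmorphism D -> lau}).
Hypotheses (k1E : forall c, k1 (i c) = j c) (k2E : forall c, k2 (i c) = g2 c)
  (ext : forall x (P : {poly D}), P != 0 -> root (map_poly k1 P) x ->
        (forall g, g %| map_poly k2 P -> (1 < size g)%N -> exists y, root g y) ->
        exists b, k1 b = x).
Let kD : {rmorphism K -> D} := i \o @tofrac _ \o @polyC L \o iL.
Local Notation fD := (ratmap kD f).

Let fD_M n x : iter n fM (omap k1 x) = omap k1 (iter n fD x).
Proof.
elim: n => //= n ->; rewrite /ratmap -P1map_map; congr P1map;
  by rewrite -map_poly_comp; apply: eq_map_poly => c /=; rewrite k1E.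
Qed.

Let fD_L n x : iter n fL (omap k2 x) = omap k2 (iter n fD x).
Proof.
elim: n => //= n ->; rewrite /ratmap -P1map_map; congr P1map;
  by rewrite -map_poly_comp; apply: eq_map_poly => c /=; rewrite k2E g2_C.
Qed.

Let tstD : exists b, k1 b = tst /\ k2 b = rho.
Proof.
have := fD_M jj (Some (i (tofrac 'X))); rewrite /= k1E tstE.
have := fD_L jj (Some (i (tofrac 'X))); rewrite /= k2E rho_spec.1.
by case: (iter _ _ _) => //= b [->] [->]; exists b.
Qed.

Let above n b := exists b0, [/\ iter n fD (Some b) = Some b0, k1 b0 = tst & k2 b0 = rho].

Let aboveP n b : above n b <-> iter n fM (Some (k1 b)) = Some tst.
Proof.
have [b0 [b0M b0L]] := tstD.
have := fD_M n (Some b); rewrite /= => ->; split=> [[b1 [-> <- _]]//|].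
case E : (iter n fD (Some b)) => [b1|] //= [b1E]; exists b1; split=> //.
by rewrite -b0L; congr (k2 _); apply: (fmorph_inj k1); rewrite b1E b0M.
Qed.

Let pairD : (0 < pair_degree (map_poly kD (numer f)) (map_poly kD (denom f)))%N.
Proof. by rewrite /pair_degree !size_map_poly. Qed.

Let copD : coprimep (map_poly kD (numer f)) (map_poly kD (denom f)).
Proof. by rewrite coprimep_map; exact: coprime_numer_denom. Qed.

Let copL : coprimep (map_poly kLau (numer f)) (map_poly kLau (denom f)).
Proof. by rewrite coprimep_map; exact: coprime_numer_denom. Qed.

Let pairL : pair_degree (map_poly kLau (numer f)) (map_poly kLau (denom f)) = d.
Proof. by rewrite /pair_degree !size_map_poly. Qed.

Let pairL0 : (0 < pair_degree (map_poly kLau (numer f)) (map_poly kLau (denom f)))%N.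
Proof. by rewrite pairL. Qed.

Let step_dvd l N n y : (tame_exp ^ l.+1 %| N)%N -> (n * ld y = N)%N -> (tame_exp ^ l %| n)%N.
Proof.
move=> cN nN; have /dvdnP[c' c'E] := ld_dvd_tame y.
rewrite -(@dvdn_pmul2r (ld y)) ?ld_gt0 // nN; apply: dvdn_trans cN.
by rewrite expnSr dvdn_mul // ld_dvd_tame.
Qed.

(** Going up the tree, each fibre splits over Laurent series because the multiplicity reached is
    divisible by the local degrees; maximality of [D] then puts the preimage into [D]. One factor
    [tame_exp] of the multiplicity is spent per level. *)
Lemma place_above n x : (n <= n0)%N -> iter n fM (Some x) = Some tst ->
  exists b y N, [/\ k1 b = x, at_pt (k2 b) y N, (tame_exp ^ (n0 - n) %| N)%N,
    iter n fF y = w & (N * iter_ld n y = iter_ld jj z * e)%N].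
Proof.
elim: n x => [|n IH] x nn0.
  move=> [->]; have [b [bM bL]] := tstD; exists b, w, (iter_ld jj z * e)%N; split=> //.
  - by rewrite bL; exact: rho_spec.2.
  - by rewrite subn0 dvdn_mull.
  - by rewrite iter_ld0 muln1.
move=> xE; have [x' [x1 xn]] := @orbit_split _ f _ iL _ j n 1 x tst (@orbit_nconst 0 tst erefl) (etrans (congr1 (fun k => iter k fM (Some x)) (addn1 n)) xE).
have [b' [y' [N' [b'x b'y c'N y'w N'E]]]] := IH x' (ltnW nn0) xn.
have fib y : fF y = y' -> (ld y %| N')%N /\ (ld y)%:R != 0 :> F.
  move=> _; split; last exact: tame.
  apply: dvdn_trans (ld_dvd_tame y) (dvdn_trans _ c'N).
  by rewrite -{1}(expn1 tame_exp) dvdn_exp2l // subn_gt0.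
have [rs [urs srs rP]] := full_fiber (cop_F f eK) (pair_degree_F_gt0 eK hd) clF b'y fib.
rewrite pair_degree_F in srs.
have rP' r : r \in rs -> fL (Some r) = Some (k2 b') by rewrite fLE => /rP[].
have spl := fiber_splits copL pairL0 urs (etrans srs (esym pairL)) rP'.
pose P := map_poly kD (numer f) - b' *: map_poly kD (denom f).
have P0 : P != 0 := fiber_neq0 copD pairD (Some b').
have k2P : map_poly k2 P = map_poly kLau (numer f) - k2 b' *: map_poly kLau (denom f).
  rewrite rmorphB /= map_polyZ -!map_poly_comp; congr (_ - _ *: _);
  by apply: eq_map_poly => c /=; rewrite k2E g2_C.
have k1P : map_poly k1 P = map_poly (const_rm iL j) (numer f) - x' *: map_poly (const_rm iL j) (denom f).
  rewrite rmorphB /= map_polyZ -!map_poly_comp b'x; congr (_ - _ *: _);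
  by apply: eq_map_poly => c /=; rewrite k1E.
have [||b bx] := ext (x := x) P0.
- by rewrite k1P; have [] := P1map_root x1.
- move=> g; rewrite k2P spl; apply: split_divisor_root.
  by rewrite lead_coef_eq0 -k2P map_poly_eq0.
have bD : fD (Some b) = Some b'.
  have := fD_M 1 (Some b); rewrite /= bx [fM (Some x)]x1 => E.
  by case: (fD (Some b)) E => //= b1 [E]; congr Some; apply: (fmorph_inj k1); rewrite -E b'x.
have brs : k2 b \in rs.
  have := fD_L 1 (Some b); rewrite /= bD /= => /P1map_root[_].
  rewrite spl rootZ ?root_prod_XsubC //.
  by rewrite lead_coef_eq0 -k2P map_poly_eq0.
have [_ [y [N [by_ yy' NE]]]] := rP _ brs.
exists b, y, N; split=> //.
- by apply: step_dvd NE; rewrite -subSn // subSS.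
- by rewrite iterSr [fF y]yy'.
- by rewrite iter_ldS [fF y]yy' mulnA [(N * _)%N]NE N'E.
Qed.

(** The fibre in [M] expands to [d] distinct roots of the fibre polynomial, so [r] is among them. *)
Lemma place_roots n b' r : (n < n0)%N -> iter n fM (Some (k1 b')) = Some tst ->
  fL (Some r) = Some (k2 b') -> exists b, fM (Some (k1 b)) = Some (k1 b') /\ k2 b = r.
Proof.
move=> nn0 b'E fr; have [rs [urs srs rP]] := fiber_M b'E.
have ex x : exists b, x \in rs -> k1 b = x.
  have [xrs|_] := boolP (x \in rs); last by exists 0.
  have [|b [_ [_ [bx _ _ _ _]]]] := @place_above n.+1 x nn0; last by exists b.
  by rewrite iterSr rP.
have [h hP] := choice ex.
have hrs b : b \in map h rs -> fD (Some b) = Some b'.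
  move=> /mapP[x xrs ->]; have := fD_M 1 (Some (h x)); rewrite /= hP // rP //.
  by case: (fD _) => //= b1 [/fmorph_inj ->].
have us : uniq (map k2 (map h rs)).
  rewrite -map_comp map_inj_in_uniq // => x y xrs yrs /fmorph_inj /(congr1 k1).
  by rewrite !hP.
have spl : map_poly kLau (numer f) - k2 b' *: map_poly kLau (denom f) =
    lead_coef (map_poly kLau (numer f) - k2 b' *: map_poly kLau (denom f)) *:
    \prod_(x <- map k2 (map h rs)) ('X - x%:P).
  apply: fiber_splits; rewrite ?pairL ?size_map //.
  move=> _ /mapP[b brs ->]; have := fD_L 1 (Some b).
  by rewrite /= hrs.
have := (P1map_root fr).2; rewrite spl rootZ ?root_prod_XsubC; last first.
  rewrite lead_coef_eq0; exact: (fiber_neq0 copL pairL0 (Some (k2 b'))).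
move=> /mapP[b brs ->]; exists b; split=> //.
by have := fD_M 1 (Some b); rewrite /= hrs.
Qed.

Let iter_None n : iter n fL None = omap (@lauC F) (iter n fF None).
Proof.
elim: n => //= n ->; rewrite /ratmap -P1map_map; congr P1map;
  by rewrite -map_poly_comp.
Qed.

Let rho_nconst c : rho <> lauC c.
Proof. exact: at_pt_nconst rho_spec.2. Qed.

Let iterL_succ n r : iter n.+1 fL (Some r) = Some rho ->
  exists2 r', fL (Some r) = Some r' & iter n fL (Some r') = Some rho.
Proof.
rewrite iterSr; case E : (fL (Some r)) => [r'|] => [h|]; first by exists r'.
by rewrite iter_None; case: (iter n fF None) => //= c [/esym/rho_nconst].
Qed.

Lemma place_lift n r : (n <= n0)%N -> iter n fL (Some r) = Some rho ->
  exists b, iter n fM (Some (k1 b)) = Some tst /\ k2 b = r.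
Proof.
elim: n r => [|n IH] r nn0.
  by move=> [->]; have [b [b1 b2]] := tstD; exists b; rewrite /= b1.
move=> /iterL_succ[r' fr r'E]; have [b' [b'1 b'2]] := IH _ (ltnW nn0) r'E.
rewrite -b'2 in fr; have [b [b1 b2]] := place_roots nn0 b'1 fr.
by exists b; rewrite iterSr b1.
Qed.

Let tau_fL n x : iter n fL (omap tau x) = omap tau (iter n fL x).
Proof.
elim: n => //= n ->; rewrite /ratmap -P1map_map; congr P1map;
  by rewrite -map_poly_comp; apply: eq_map_poly => c /=; rewrite (rot_C tz).
Qed.

Let tau_rho : tau rho = rho.
Proof.
have := tau_fL jj (Some (g2 (tofrac 'X))).
by rewrite /= g2_tau rho_spec.1 => -[].
Qed.

(** [tau] fixes [rho], hence permutes the series above [rho], and up to level [n0] all of these come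
    from [M]. *)
Lemma place_stable n x : (n <= n0)%N -> iter n fM (Some x) = Some tst ->
  exists b b', k1 b = x /\ k2 b' = tau (k2 b).
Proof.
move=> nn0 xE; have [b [_ [_ [bx _ _ _ _]]]] := place_above nn0 xE.
have /aboveP[b0 [bb0 _ b0r]] : iter n fM (Some (k1 b)) = Some tst by rewrite bx.
have := fD_L n (Some b); rewrite bb0 /= b0r => bL.
have := tau_fL n (Some (k2 b)); rewrite /= bL /= tau_rho => /(place_lift nn0)[b' [_ b'E]].
by exists b, b'.
Qed.

(** [tau] need not preserve the image of [D]; this is the subfield on which it induces a map back
    into [D]. *)
Definition tau_stable : set M := [set x | exists b b', k1 b = x /\ k2 b' = tau (k2 b)].

Lemma tau_stable_closed : GRing.divring_closed (fun x => `[< tau_stable x >]).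
Proof.
split.
- by apply/asboolP; exists 1, 1; rewrite !rmorph1.
- move=> _ _ /asboolP[b [b' [<- bE]]] /asboolP[c [c' [<- cE]]]; apply/asboolP.
  by exists (b - c), (b' - c'); rewrite !rmorphB bE cE.
- move=> _ _ /asboolP[b [b' [<- bE]]] /asboolP[c [c' [<- cE]]]; apply/asboolP.
  by exists (b / c), (b' / c'); rewrite !fmorph_div bE cE.
Qed.

Lemma gen_subfield_tau_stable (S : set M) x :
  (forall y, S y -> tau_stable y) -> x \in gen_subfield S -> tau_stable x.
Proof.
move=> Sst /asboolP /(_ _ tau_stable_closed) h; apply/asboolP; apply: h => y Sy.
by apply/asboolP/Sst.
Qed.

(* The decomposition group at the place: [tau] is induced by a Galois automorphism. *)
Lemma inertia : exists2 s : {rmorphism M -> M}, gal s &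
  forall x, tau_stable x -> exists b b', [/\ k1 b = x, k1 b' = s x & k2 b' = tau (k2 b)].
Proof.
pose D' := subfield_of tau_stable; pose v : {rmorphism D' -> M} := \val.
have vst (c : D') : tau_stable (v c) := gen_subfield_tau_stable (fun y h => h) (valP c).
have [h hE] : exists h : {rmorphism D' -> D}, forall c, k1 (h c) = v c.
  by apply: rmorph_factor => c; have [b [_ [bc _]]] := vst c; exists b.
have [h' h'E] : exists h' : {rmorphism D' -> D}, forall c, k2 (h' c) = (tau \o k2 \o h) c.
  apply: (rmorph_factor (i := tau \o k2 \o h)) => c; have [b [b' [bc b'E]]] := vst c.
  exists b'; rewrite b'E /=; congr (tau (k2 _)).
  by apply: (fmorph_inj k1); rewrite bc hE.
have jst a : tau_stable (j a).
  by exists (i a), (i a); rewrite k1E k2E g2_tau.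
have mem x : tau_stable x -> exists c : D', v c = x.
  by move=> xs; apply: subfield_mem; apply/asboolP => k _; exact.
have [i' i'E] := rmorph_factor (fun a => mem _ (jst a)).
have [s sE] := sep_closure_extension hM (g := v) (k1 \o h') i'E.
exists s.
  move=> a; rewrite -i'E sE -hE /=; congr (k1 _); apply: (fmorph_inj k2).
  rewrite h'E /=; have -> : h (i' a) = i a by apply: (fmorph_inj k1); rewrite hE i'E k1E.
  by rewrite k2E g2_tau.
move=> _ /mem[c <-]; exists (h c), (h' c); split; [exact: hE | by rewrite sE | exact: h'E].
Qed.

(** At each step up the multiplicity stays a multiple of [e], so [zeta] raised to it is [1] and the
    chosen preimage is fixed by the rotation. *)
Lemma fixed_solution k y x0 N0 N : tau x0 = x0 -> at_pt x0 (iter k fF y) N0 ->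
  N0 = (N * iter_ld k y)%N -> (e %| N)%N ->
  exists r, [/\ iter k fL (Some r) = Some x0, at_pt r y N & tau r = r].
Proof.
move=> tx; elim: k y N => [|k IH] y N xy NE eN.
  by exists x0; split=> //; move: xy; rewrite NE iter_ld0 muln1.
rewrite iterSr in xy; rewrite iter_ldS mulnA in NE.
have [r1 [r1x r1y tr1]] := IH _ _ xy NE (dvdn_mulr _ eN).
have [rs [_ srs rP]] := local_solutions (cop_F f eK) (pair_degree_F_gt0 eK hd) clF r1y
  (dvdn_mull _ (dvdnn _)) (tame y).
have [r rrs] : exists r, r \in rs.
  have : (0 < size rs)%N by rewrite srs; exact: ld_gt0.
  by case: (rs) => // r rs' _; exists r; rewrite mem_head.
have [fr ry] := rP _ rrs; rewrite mulnK in ry; last exact: ld_gt0.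
exists r; split=> //; first by rewrite iterSr fLE [P1map _ _ _]fr -fLE.
apply: (rot_fixes_at_pt (cop_F f eK) (pair_degree_F_gt0 eK hd) tz (tame y) fr tr1 ry).
by have /dvdnP[c ->] := eN; rewrite mulnC exprM (prim_expr_order zP) expr1n.
Qed.

(** Above an unramified point the multiplicity stays equal to [N], so here every preimage is fixed,
    not only a chosen one. *)
Lemma fixed_unramified m k r x0 y0 N : tau x0 = x0 -> at_pt x0 y0 N -> (e %| N)%N ->
  (forall l y, (l <= m)%N -> iter l fF y = y0 -> iter_ld l y = 1%N) -> (k <= m)%N ->
  iter k fL (Some r) = Some x0 -> exists2 y, at_pt r y N & iter k fF y = y0 /\ tau r = r.
Proof.
move=> tx xy eN ur; elim: k r => [|k IH] r km; first by move=> [->]; exists y0.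
rewrite iterSr; case fr : (fL (Some r)) => [r'|]; last first.
  rewrite iter_None; case: (iter k fF None) => //= c [/esym].
  by move/(at_pt_nconst xy).
move=> /(IH _ (ltnW km))[y' r'y' [y'E tr']].
have ld1 y : fF y = y' -> ld y = 1%N.
  move=> yy'; have := ur k.+1 y km; rewrite iterSr yy' => /(_ y'E) /eqP.
  by rewrite iter_ldS muln_eq1 => /andP[/eqP].
have fib y : fF y = y' -> (ld y %| N)%N /\ (ld y)%:R != 0 :> F.
  by move=> /ld1 ->; split; [exact: dvd1n | exact: oner_neq0].
have [rs [urs srs rP]] := full_fiber (cop_F f eK) (pair_degree_F_gt0 eK hd) clF r'y' fib.
rewrite pair_degree_F in srs.
have rP' r1 : r1 \in rs -> fL (Some r1) = Some r' by rewrite fLE => /rP[].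
have spl := fiber_splits copL pairL0 urs (etrans srs (esym pairL)) rP'.
have rrs : r \in rs.
  have := (P1map_root fr).2; rewrite spl rootZ ?root_prod_XsubC //.
  by rewrite lead_coef_eq0; exact: (fiber_neq0 copL pairL0 (Some r')).
have [_ [y [n [ry yy' nE]]]] := rP _ rrs.
have nN : n = N by rewrite -nE [pair_local_degree _ _ _]ld1 ?muln1.
rewrite nN in ry; exists y => //; split; first by rewrite iterSr [fF y]yy'.
rewrite fLE in fr.
apply: (rot_fixes_at_pt (cop_F f eK) (pair_degree_F_gt0 eK hd) tz (tame y) fr tr' ry).
by have /dvdnP[c ->] := eN; rewrite mulnC exprM (prim_expr_order zP) expr1n.
Qed.

(** The multiplicity of [rho] is [e] times the local degree at [z]. Divisibility leaves a multiple
    of [e] over [y], so some series over [y] is fixed by [tau], and with it the unramified tree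
    above. *)
Lemma inert_vertex k y m (s : {rmorphism M -> M}) :
  (forall x, tau_stable x -> exists b b', [/\ k1 b = x, k1 b' = s x & k2 b' = tau (k2 b)]) ->
  (k + m <= n0)%N -> iter k fF y = w -> (iter_ld k y %| iter_ld jj z)%N ->
  (forall l y', (l <= m)%N -> iter l fF y' = y -> iter_ld l y' = 1%N) ->
  exists2 s', iter k fM (Some s') = Some tst &
    forall l x, (l <= m)%N -> iter l fM (Some x) = Some s' -> s x = x.
Proof.
move=> sP kmn yw /dvdnP[c cE] ur.
have rw := rho_spec.2; rewrite -yw in rw.
have [|r [rr ry tr]] := @fixed_solution k y rho _ (c * e) tau_rho rw _ (dvdn_mull _ (dvdnn e)).
  by rewrite cE mulnAC.
have kn : (k <= n0)%N := leq_trans (leq_addr _ _) kmn.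
have [b [bM bL]] := place_lift kn rr.
exists (k1 b) => // l x lm xE.
have kln : (k + l <= n0)%N by rewrite (leq_trans _ kmn) // leq_add2l.
have xt : iter (k + l) fM (Some x) = Some tst by rewrite iterD xE.
have [c1 [c1' [c1x c1s c1t]]] := sP x (place_stable kln xt).
have c1D : iter l fD (Some c1) = Some b.
  have := fD_M l (Some c1); rewrite /= c1x xE.
  by case: (iter l fD _) => //= b' [/fmorph_inj ->].
have := fD_L l (Some c1); rewrite c1D /= bL => c1L.
have [_ _ [_ tc]] := fixed_unramified tr ry (dvdn_mull _ (dvdnn e)) ur lm c1L.
by rewrite -c1s -c1x; congr (k1 _); apply: (fmorph_inj k2); rewrite c1t.
Qed.

End InD.

Lemma place_data : exists (D : fieldType) (i : {rmorphism kL -> D})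
  (k1 : {rmorphism D -> M}) (k2 : {rmorphism D -> lau}) (s : {rmorphism M -> M}),
  [/\ forall c, k1 (i c) = j c, forall c, k2 (i c) = g2 c, gal s,
    forall x, x \in gen_subfield (range j `|`
        [set x | exists2 n, (n <= n0)%N & iter n fM (Some x) = Some tst]) ->
      exists b b', [/\ k1 b = x, k1 b' = s x & k2 b' = tau (k2 b)] &
    forall k y m, (k + m <= n0)%N -> iter k fF y = iter jj fF z ->
      (iter_ld k y %| iter_ld jj z)%N ->
      (forall l y', (l <= m)%N -> iter l fF y' = y -> iter_ld l y' = 1%N) ->
      exists2 s', iter k fM (Some s') = Some tst &
        forall l x, (l <= m)%N -> iter l fM (Some x) = Some s' -> s x = x].
Proof.
have [D [i [k1 [k2 [k1E k2E ext]]]]] := embedding_extension j g2.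
have [s gs sP] := inertia k1E k2E.
exists D, i, k1, k2, s; split=> //; last first.
  move=> k y m kmn yw dv ur; exact: (inert_vertex k1E k2E ext sP kmn yw dv ur).
move=> x xS; apply: sP; apply: gen_subfield_tau_stable xS => x' [[c _ <-]|[n nn0 nE]].
  by exists (i c), (i c); rewrite k1E k2E g2_tau.
exact: (place_stable k1E k2E ext nn0 nE).
Qed.
End Embedding.
End Places.

(** * Galois correspondence on the tree *)

Section GaloisGroup.
Variables (K : fieldType) (f : {fraction {poly K}}) (L : fieldType)
  (iL : {rmorphism K -> L}) (M : fieldType)
  (j : {rmorphism {fraction {poly L}} -> M}) (hM : is_sep_closure j)
  (lam : labeling f iL j).
Local Notation d := (ratdeg f).
Local Notation t := (tvar j).
Local Notation fM := (ratmap (const_emb iL j) f).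
Local Notation pt := (pt lam).
Local Notation Lam := (Lam lam).
Local Notation acts_by := (acts_by lam).
Local Notation G := (G_infty lam).
Local Notation gal := (gal_auto j).

Lemma G_comp g h : G g -> G h -> G (g \o h).
Proof.
move=> /(G_inftyP hM)[s gs sg] /(G_inftyP hM)[r gr rh]; apply/(G_inftyP hM).
by exists (s \o r : {rmorphism M -> M}); [exact: gal_comp | exact: acts_comp].
Qed.

Lemma G_inv g : G g -> exists h, [/\ G h, cancel g h & cancel h g].
Proof.
move=> /(G_inftyP hM)[s gs sg]; have [r [sK rK gr]] := sep_closure_aut_inv hM gs.
have [h rh] := acts_exists lam gr; exists h; split; first by apply/(G_inftyP hM); exists r.
  exact: (acts_cancel sg rh).
exact: (acts_cancel rh sg).
Qed.

Lemma G_size g w : G g -> size (g w) = size w.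
Proof. by move=> /(G_inftyP hM)[s _ /(_ w)[]]. Qed.

Lemma G_cat g u w : G g -> exists w', g (u ++ w) = g u ++ w'.
Proof. by move=> /(G_inftyP hM)[s gs sg]; exact: (acts_cat _ _ gs sg). Qed.

Lemma G_lift g v : G g -> exists h, [/\ G h & forall w, h (v ++ w) = v ++ g w].
Proof.
move=> /(G_inftyP hM)[s gs sg]; have [s' [h [gs' sh _ _ hE]]] := gal_lift v gs sg.
by exists h; split=> //; apply/(G_inftyP hM); exists s'.
Qed.

(** Write [v = v1 v2] with [v2] of length [k]. As [s'] and [t] have the same [k]-th image, [Lam v2]
    maps [s'] to a vertex [v'] of the same level as [v2]. A lift of [s] along [v2] acts as [g] below
    [v2] and trivially below [v'] down to height [m], as [commutator_section] requires. *)
Lemma section_of_fixed_vertex n m k v s g s' :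
  (forall k u w w', size w = k -> size w' = k ->
    exists2 h, level_stab G (size u) h & h (u ++ w) = u ++ w') ->
  gal s -> acts_by s g -> iter k fM (Some s') = iter k fM (Some t) ->
  (forall l x, (l <= m)%N -> iter l fM (Some x) = Some s' -> s x = x) ->
  (n + k <= size v)%N -> level_sections G n v m g.
Proof.
move=> tr gs sg s't sfix nkv.
have kv : (k <= size v)%N := leq_trans (leq_addl _ _) nkv.
pose v1 := take (size v - k) v; pose v2 := drop (size v - k) v.
have sv1 : size v1 = (size v - k)%N by rewrite size_takel // leq_subr.
have sv2 : size v2 = k by rewrite size_drop subKn.
have : preimages f iL j k t (Lam v2 s').
  rewrite /preimages /= -[Some (Lam _ _)]/(omap (Lam v2) (Some s')) Lam_iter s't.
  rewrite -Lam_iter /= -[Lam v2 t]/(pt v2) -sv2; exact: pt_V.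
move=> /(pt_surj lam)[v' [sv' v'E]].
have [s1 [q [gs1 sq s1E _ qE]]] := gal_lift v2 gs sg.
have GI r h : gal r -> acts_by r h -> G h by move=> ? ?; apply/(G_inftyP hM); exists r.
rewrite -(cat_take_drop (size v - k) v) -/v1 -/v2.
have nv1 : (n <= size v1)%N by rewrite sv1; lia.
have qv' w : (size w <= m)%N -> q (v' ++ w) = v' ++ w; last first.
  exact: (commutator_section (G_infty_id lam) G_comp G_inv G_size G_cat G_lift nv1 (etrans sv' (esym sv2))
    tr (GI _ _ gs sg) (GI _ _ gs1 sq) qE qv').
move=> wm; have [r [Lr rL _]] := Lam_inv lam v2.
have rx : s (r (pt (v' ++ w))) = r (pt (v' ++ w)).
  apply: (sfix (size w)) => //; have := pt_cat_iter lam v' w.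
  rewrite -{1}(rL (pt (v' ++ w))) -[Some (Lam _ _)]/(omap (Lam v2) (Some _)) Lam_iter v'E.
  by case: (iter _ _ _) => //= y [/fmorph_inj ->].
have [sz] := sq (v' ++ w); rewrite -(rL (pt (v' ++ w))) s1E rx rL.
by move/(pt_inj (esym sz)).
Qed.

(* Galois correspondence: the coefficients of [\prod_phi ('X - theta_phi)], over the finitely
   many restrictions of elements of [H], are fixed by [H], hence by the whole group. *)
Lemma galois_correspondence (H : set (word d -> word d)) m : H `<=` G ->
  H id -> (forall g h, H g -> H h -> H (g \o h)) ->
  (forall g h, G h -> cancel g h -> cancel h g -> H g -> H h) ->
  (forall a, a \in gen_subfield (range j `|` [set x | exists2 w, (size w <= m)%N & pt w = x]) ->
    (forall s h, gal s -> acts_by s h -> H h -> s a = a) -> forall s, gal s -> s a = a) ->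
  forall g, G g -> exists2 h, H h & forall w, (size w <= m)%N -> h w = g w.
Proof.
move=> HG H1 Hcomp Hinv triv g Gg; pose B := m.-bseq 'I_d.
have sz h (Gh : G h) (w : B) : (size (h w) <= m)%N by rewrite G_size // size_bseq.
pose restr h (Gh : G h) : {ffun B -> B} := [ffun w : B => Bseq (sz h Gh w) : B].
have restrE h Gh w : restr h Gh w = h w :> word d by rewrite ffunE.
pose Phi := [set phi : {ffun B -> B} | `[< exists2 h, H h & forall w : B, phi w = h w :> word d >]]%SET.
(* The restriction of [h] to words of length at most [m], stored as one polynomial over [M]. *)
pose th (h : word d -> word d) : {poly M} := \sum_(w : B) pt (h w) *: 'X^(enum_rank w).
have th_coef h (w : B) : (th h)`_(enum_rank w) = pt (h w).
  rewrite coef_sum (bigD1 w) //= coefZ coefXn eqxx mulr1 big1 ?addr0 // => w' w'w.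
  by rewrite coefZ coefXn eq_sym (inj_eq val_inj) (inj_eq enum_rank_inj) (negPf w'w) mulr0.
have th_map s h h' : gal s -> acts_by s h -> map_poly s (th h') = th (h \o h').
  move=> gs sh; rewrite rmorph_sum /=; apply: eq_bigr => w _.
  by rewrite map_polyZ map_polyXn (sh _).2.
(* A restriction is prolonged by the identity, so that [th] applies to it. *)
pose phiw (phi : {ffun B -> B}) (w : word d) : word d :=
  if insub w is Some u then phi (u : B) else w.
pose P : {poly {poly M}} := \prod_(phi in Phi) ('X - (th (phiw phi))%:P).
have phiwE phi (w : B) : phiw phi w = phi w by rewrite /phiw valK.
have th_ext (h h' : word d -> word d) : (forall w : B, h w = h' w) -> th h = th h'.
  by move=> E; apply: eq_bigr => w _; rewrite E.
have P_map s h : gal s -> acts_by s h -> map_poly (map_poly s) P =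
    \prod_(phi in Phi) ('X - (th (h \o phiw phi))%:P).
  move=> gs sh; rewrite /P rmorph_prod /=; apply: eq_bigr => phi _.
  by rewrite rmorphB /= map_polyX map_polyC /= (th_map _ _ _ gs sh).
have P_fix s h : gal s -> acts_by s h -> H h -> map_poly (map_poly s) P = P.
  move=> gs sh Hh; rewrite (P_map _ _ gs sh); have [h' [Gh' hK h'K]] := G_inv (HG _ Hh).
  pose c (phi : {ffun B -> B}) : {ffun B -> B} := [ffun w => restr h (HG _ Hh) (phi w)].
  have cI : injective c.
    move=> phi psi E; apply/ffunP => w; apply: val_inj; apply: (can_inj hK).
    by have := congr1 (fun a : {ffun B -> B} => val (a w)) E; rewrite /c !ffunE.
  rewrite [RHS](reindex_inj cI) /=; apply: eq_big => [phi|phi _].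
    rewrite !inE; apply/asboolP/asboolP => -[h1 Hh1 h1E].
      by exists (h \o h1); [exact: Hcomp | move=> w; rewrite /c ffunE restrE h1E].
    exists (h' \o h1); first by apply: Hcomp => //; exact: (Hinv _ _ Gh' hK h'K Hh).
    by move=> w; rewrite /= -h1E /c ffunE restrE hK.
  congr ('X - _%:P); apply: th_ext => w /=.
  by rewrite !phiwE /c ffunE restrE.
have coef_mem i k : P`_i`_k \in gen_subfield (range j `|` [set x | exists2 w, (size w <= m)%N & pt w = x]).
  set S := gen_subfield _.
  have thS h (Gh : G h) : th h \is a polyOver S.
    apply: rpred_sum => w _; apply: polyOverZ; last by rewrite polyOverXn.
    apply/asboolP => kk _; apply; right; exists (h w) => //.
    by rewrite G_size // size_bseq.
  suff : forall i, P`_i \is a polyOver S by move=> /(_ i)/polyOverP/(_ k).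
  apply: (big_ind (fun Q : {poly {poly M}} => forall i, Q`_i \is a polyOver S)).
  - by move=> l; rewrite coef1 rpred_nat.
  - by move=> Q1 Q2 Q1S Q2S l; rewrite coefM; apply: rpred_sum => l' _; apply: rpredM.
  move=> phi; rewrite inE => /asboolP[h Hh hE] l.
  rewrite coefB coefX coefC; apply: rpredB; first exact: rpred_nat.
  case: ifP => _; last exact: rpred0.
  rewrite -(th_ext h) ?thS ?HG // => [|w]; first exact: HG.
  by rewrite phiwE hE.
have [s gs sg] : exists2 s : {rmorphism M -> M}, gal s & acts_by s g by apply/(G_inftyP hM).
have Ps : map_poly (map_poly s) P = P.
  apply/polyP => i; rewrite coef_map; apply/polyP => k; rewrite coef_map /=.
  apply: (triv _ (coef_mem i k)) gs => r h gr rh Hh.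
  have := congr1 (fun Q : {poly {poly M}} => Q`_i`_k) (P_fix _ _ gr rh Hh).
  by rewrite !coef_map.
pose id0 : {ffun B -> B} := [ffun w => w].
have id0P : id0 \in Phi.
  by rewrite inE; apply/asboolP; exists id => // w; rewrite ffunE.
(* [th g] is a root of the image of [P] under [s], from the factor of the identity, and this image
   is [P]. *)
have : root P (th g).
  rewrite -Ps (P_map _ _ gs sg) (bigD1 id0) //= rootM root_XsubC; apply/orP; left.
  by apply/eqP/th_ext => w /=; rewrite phiwE ffunE.
rewrite rootE /P horner_prod => /prodf_eq0[phi]; rewrite inE => /asboolP[h Hh hE].
rewrite !hornerE subr_eq0 => /eqP E; exists h => // w wm.
pose u : B := Bseq wm; have := congr1 (fun Q : {poly M} => Q`_(enum_rank u)) E.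
rewrite !th_coef phiwE hE => /pt_inj -> //.
by rewrite (G_size _ Gg) (G_size _ (HG _ Hh)).
Qed.
End GaloisGroup.

(** * Coordinates and places *)

Lemma eval_neq0 (F E : fieldType) (g : {rmorphism F -> E}) (v : E) (P : {poly F}) :
  GRing.closed_field_axiom F -> (forall c, v <> g c) -> P != 0 -> (map_poly g P).[v] != 0.
Proof.
move=> clF vc P0; have [rs PE] := closed_axiom_split clF P.
rewrite PE map_polyZ hornerZ mulf_neq0 //; first by rewrite fmorph_eq0 lead_coef_eq0.
rewrite rmorph_prod horner_prod; rewrite prodf_seq_neq0; apply/allP => c _ /=.
by rewrite rmorphB /= map_polyX map_polyC !hornerE subr_eq0; apply/eqP/vc.
Qed.

Lemma frac_eval (L F E : fieldType) (iO : {rmorphism L -> F}) (g : {rmorphism F -> E}) (v : E) :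
  GRing.closed_field_axiom F -> (forall c, v <> g c) ->
  exists h : {rmorphism {fraction {poly L}} -> E},
    (forall c, h (tofrac c%:P) = g (iO c)) /\ h (tofrac 'X) = v.
Proof.
move=> clF vc; have cf : commr_rmorph (g \o iO) v by move=> x; exact: mulrC.
have [|h hE] := @frac_lift _ _ (horner_morph cf).
  apply: raddf_inj => P; rewrite /= /horner_morph map_poly_comp => /eqP; apply: contraTeq.
  by move=> P0; rewrite eval_neq0 // map_poly_eq0.
exists h; split=> [c|]; first by rewrite hE /= horner_morphC.
by rewrite hE /= horner_morphX.
Qed.

Lemma frac_polyP (F : fieldType) (x : {fraction {poly F}}) :
  exists a b : {poly F}, b != 0 /\ x = tofrac a / tofrac b.
Proof. by have [a [b [b0 ->]]] := frac_numden x; exists a, b. Qed.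

(** The elements with a [q]-th power coming from [L(t)] form a field. It contains the constants,
    since [F] is purely inseparable over [L], and the variable. *)
Lemma purely_inseparable_frac (L F kT : fieldType) (iO : {rmorphism L -> F})
    (emb : {rmorphism {poly F} -> kT}) (io : {rmorphism {fraction {poly L}} -> kT}) z0 :
  (forall x, exists a b : {poly F}, b != 0 /\ x = emb a / emb b) ->
  (forall x : F, exists2 q, [pchar L].-nat q & exists c, x ^+ q = iO c) ->
  (forall c, io (tofrac c%:P) = emb (iO c)%:P) ->
  io (tofrac 'X) = (if z0 is Some a then emb a%:P + (emb 'X)^-1 else emb 'X) ->
  forall x : kT, exists q, [pchar F].-nat q /\ exists c, x ^+ q = io c.
Proof.
move=> fr piF ioC ioX.
pose g : {rmorphism F -> kT} := emb \o polyC.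
have chT q : [pchar F].-nat q -> [pchar kT].-nat q.
  by apply: sub_in_pnat => p _; rewrite (fmorph_pchar g).
have chL q : [pchar L].-nat q -> [pchar F].-nat q.
  by apply: sub_in_pnat => p _; rewrite (fmorph_pchar iO).
pose S x := exists q, [pchar F].-nat q /\ exists c, x ^+ q = io c.
have com x y : S x -> S y -> exists q c c', [/\ [pchar F].-nat q, x ^+ q = io c & y ^+ q = io c'].
  move=> [q [qF [c cE]]] [r [rF [c' c'E]]]; exists (q * r)%N, (c ^+ r), (c' ^+ q).
  by rewrite pnatM qF rF exprM cE mulnC exprM c'E !rmorphXn.
have SB x y : S x -> S y -> S (x - y).
  move=> Sx /(com _ _ Sx)[q [c [c' [qF xE yE]]]]; exists q; split=> //.
  by exists (c - c'); rewrite pchar_nat_exprB ?chT // xE yE rmorphB.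
have SM x y : S x -> S y -> S (x * y).
  move=> Sx /(com _ _ Sx)[q [c [c' [qF xE yE]]]]; exists q; split=> //.
  by exists (c * c'); rewrite exprMn xE yE rmorphM.
have SV x : S x -> S x^-1.
  by move=> [q [qF [c cE]]]; exists q; split=> //; exists c^-1; rewrite exprVn cE fmorphV.
have Sio c : S (io c) by exists 1%N; split=> //; exists c; rewrite expr1.
have SC c : S (emb c%:P).
  have [q qL [l lE]] := piF c; exists q; split; first exact: chL.
  by exists (tofrac l%:P); rewrite ioC -lE -!rmorphXn.
have SD x y : S x -> S y -> S (x + y).
  move=> Sx Sy; rewrite -[y]opprK; apply: (SB _ _ Sx); rewrite -[- y]sub0r.
  by apply: SB Sy; rewrite -(rmorph0 io).
have SX : S (emb 'X).
  case: z0 ioX => [a|] ioX; last by rewrite -ioX.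
  rewrite -[emb 'X]invrK; apply: SV; have -> : (emb 'X)^-1 = io (tofrac 'X) - emb a%:P.
    by rewrite ioX addrC addKr.
  exact: SB.
have SP P : S (emb P).
  elim/poly_ind: P => [|P c IH]; first by rewrite rmorph0 -(rmorph0 io).
  by rewrite rmorphD rmorphM; apply: SD => //; apply: SM.
by move=> x; have [a [b [_ ->]]] := fr x; apply: SM => //; apply: SV.
Qed.

Lemma at_pt_chart (F : fieldType) (y : P1 F) (u : pser F) e : (0 < e)%N -> u 0%N != 0 ->
  at_pt (chart y (lauX F ^+ e * tofrac u)) y e.
Proof. by move=> e0 u0; split=> //; exists u; split=> //; rewrite tofracM tofracXn. Qed.

Lemma ps_inv_neq0 (F : fieldType) (b u : pser F) : b * u = 1 -> b 0%N != 0.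
Proof.
move/(congr1 (fun a : pser F => a 0%N)); rewrite psM0 ps1E /= => E.
by apply/eqP => b0; move/eqP: E; rewrite b0 mul0r eq_sym oner_eq0.
Qed.

Lemma tofrac_inv (F : fieldType) (b u : pser F) : b * u = 1 ->
  tofrac u = (tofrac b)^-1 :> laurent F.
Proof.
move=> bu; have b0 : tofrac b != 0 :> laurent F := tofrac_neq0 (ps_inv_neq0 bu).
by apply: (mulfI b0); rewrite mulfV // -tofracM bu tofrac1.
Qed.

(* The variable of [{fraction {poly F}}] is a coordinate on the [t]-line with [z0] at infinity;
   [th z] expands functions in powers of an [e]-th root of the local parameter at [z]. *)
Lemma coordinate_places (L F : fieldType) (iO : {rmorphism L -> F}) (z0 : P1 F) (e : nat) :
  GRing.closed_field_axiom F -> (0 < e)%N ->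
  exists (io : {rmorphism {fraction {poly L}} -> {fraction {poly F}}})
    (th : P1 F -> {rmorphism {fraction {poly F}} -> laurent F}),
  [/\ forall c, io (tofrac c%:P) = tofrac (iO c)%:P,
      io (tofrac 'X) = (if z0 is Some a then tofrac a%:P + (tofrac 'X)^-1 else tofrac 'X),
      forall z c, th z (tofrac c%:P) = lauC c,
      (forall z, th (Some z) (tofrac 'X) = lauC z + lauX F ^+ e) /\
      th None (tofrac 'X) = (lauX F ^+ e)^-1 &
      forall z, exists y, at_pt (th z (io (tofrac 'X))) y e /\ (z <> None -> y <> z0)].
Proof.
move=> clF e0; pose C : {rmorphism F -> {fraction {poly F}}} := @tofrac _ \o polyC.
pose T : {fraction {poly F}} := tofrac 'X.
have TC c : T <> C c.
  move/tofrac_inj/(congr1 (fun P : {poly F} => size P)); rewrite size_polyX.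
  by move=> E; have := size_polyC_leq1 c; rewrite -E.
(* The function [t] in terms of the new coordinate: a Moebius change placing [z0] at infinity. *)
pose w : {fraction {poly F}} := if z0 is Some a then C a + T^-1 else T.
have wC c : w <> C c.
  rewrite /w; case: (z0) => [a|]; last exact: TC.
  move=> E; apply: (TC (c - a)^-1); rewrite fmorphV rmorphB -E addrC addKr invrK //.
have [io [ioC ioX]] := frac_eval iO clF wC.
pose v (z : P1 F) : laurent F := if z is Some c then lauC c + lauX F ^+ e else (lauX F ^+ e)^-1.
have vE z : v z = chart z (lauX F ^+ e * tofrac 1) by rewrite /v tofrac1 mulr1; case: z.
have v_pt z : at_pt (v z) z e by rewrite vE; apply: at_pt_chart => //; rewrite oner_neq0.
have [th thP] := choice (fun z => frac_eval idfun clF (fun c => at_pt_nconst (c := c) (v_pt z))).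
exists io, th; split=> //.
- by move=> z c; have [-> _] := thP z.
- by split=> [z|]; [have [_ ->] := thP (Some z) | have [_ ->] := thP None].
move=> z; rewrite ioX; have [thC thX] := thP z.
have thw : th z w = if z0 is Some a then lauC a + (v z)^-1 else v z.
  by rewrite /w; case: (z0) => [a|] //; rewrite rmorphD fmorphV thX [th z _]thC.
rewrite thw; case: (z0) => [a|]; last by exists z; split; first exact: v_pt.
have e1 : e <> 0%N by move=> E; rewrite E in e0.
case: (z) => [c|] /=; last first.
  exists (Some a); split; last by case.
  rewrite invrK -[lauX F ^+ e]mulr1 -tofrac1.
  by apply: (@at_pt_chart _ (Some a)) => //; rewrite oner_neq0.
have [-> | c0] := eqVneq c 0.
  exists None; split; last by []; rewrite rmorph0 add0r.
  (* The value [a + x^(-e)] is the inverse of [x^e / (1 + a x^e)], so this place lies over infinity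
     of the [t]-line. *)
  pose u := 1 + psC a * psX F ^+ e.
  have [b bu] : exists b, b * u = 1.
    apply: ps_unitE; rewrite /u psDE psM0 ps1E.
    have -> : (psX F ^+ e) 0%N = 0 by rewrite -[_ ^+ e]mulr1 psX_pow_mul0.
    by rewrite mulr0 addr0 oner_neq0.
  split; first exact: e0.
  exists b; split; first exact: ps_inv_neq0 bu.
  have bu' : tofrac u = (tofrac b)^-1 :> laurent F := tofrac_inv bu.
  rewrite /= tofracM tofracXn invfM -bu' /u tofracD tofracM tofracXn tofrac1.
  by rewrite mulrC mulrDl mul1r mulfK ?lauX_neq0 ?expf_neq0 ?lauX_neq0 // addrC.
pose u := psC c + psX F ^+ e.
have [b bu] : exists b, b * u = 1.
  apply: ps_unitE; rewrite /u psDE.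
  have -> : (psX F ^+ e) 0%N = 0 by rewrite -[_ ^+ e]mulr1 psX_pow_mul0.
  by rewrite addr0 /= mulr1n.
exists (Some (a + c^-1)); split; last first.
  move=> _ [] E; have := c0; rewrite -invr_eq0 -(addKr a c^-1) E addNr.
  by rewrite eqxx.
split; first exact: e0.
exists (- (psC c^-1 * b)); split.
  rewrite psNE psM0 oppr_eq0 mulf_neq0 ?(ps_inv_neq0 bu) //=.
  by rewrite mulr1n invr_eq0.
have ub : u * b = 1 by rewrite mulrC.
have bu' : tofrac b = (tofrac u)^-1 :> laurent F := tofrac_inv ub.
have -> : lauC c + lauX F ^+ e = tofrac u by rewrite /u tofracD tofracXn.
rewrite -bu' /= -[lauC a]/(tofrac (psC a)) -[lauC _]/(tofrac (psC (a + c^-1))) -!tofracD.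
congr tofrac; rewrite rmorphD -addrA; congr (_ + _).
have cc : psC c^-1 * psC c = 1 by rewrite -rmorphM mulVf // rmorph1.
have : psC c^-1 * (b * u) = psC c^-1 by rewrite bu mulr1.
rewrite /u mulrDr mulrDr => E; rewrite -[X in _ = X + _]E.
have -> : psC c^-1 * (b * psC c) = b by rewrite mulrCA cc mulr1.
ring.
Qed.

Lemma prim_root_exists (F : fieldType) e : GRing.closed_field_axiom F ->
  (e%:R : F) != 0 -> exists zeta : F, e.-primitive_root zeta.
Proof.
move=> clF e0; have [rs [urs srs rP]] := roots_Xn clF e0 (oner_neq0 F).
have eg : (0 < e)%N by case: (e) e0 => //; rewrite eqxx.
have : has e.-primitive_root rs.
  apply: cyclic.has_prim_root => //; last by rewrite srs.
  by apply/allP => z /rP zE; rewrite unity_rootE zE.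
by move=> /hasP[z _ zP]; exists z.
Qed.

(** The labeling provides as many distinct preimages of [t] as the degree, so the fibre over [t] is
    separable; a zero Wronskian would give it a multiple root. *)
Lemma wronskian_neq0 (K : fieldType) (f : {fraction {poly K}}) (L : fieldType)
    (iL : {rmorphism K -> L}) (M : fieldType) (j : {rmorphism {fraction {poly L}} -> M}) :
  labeling f iL j -> (0 < ratdeg f)%N ->
  (numer f)^`() * denom f - numer f * (denom f)^`() != 0.
Proof.
move=> lam hd; apply/negP => /eqP W0.
pose P := map_poly (const_rm iL j) (numer f); pose Q := map_poly (const_rm iL j) (denom f).
have cop : coprimep P Q by rewrite coprimep_map; exact: coprime_numer_denom.
have dE : pair_degree P Q = ratdeg f by rewrite /pair_degree !size_map_poly.
pose rs := [seq lab_pt lam x | x <- enum 'I_(ratdeg f)].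
have urs : uniq rs by rewrite map_inj_uniq ?enum_uniq //; exact: lab_pt_inj.
have srs : size rs = pair_degree P Q by rewrite size_map size_enum_ord dE.
have rP r : r \in rs -> P1map P Q (Some r) = Some (tvar j).
  by move=> /mapP[x _ ->]; exact: lab_pt_V.
have hE := fiber_splits cop (etrans (congr1 _ dE) hd) urs srs rP.
set h := P - _ in hE.
pose r := lab_pt lam (Ordinal hd); have rrs : r \in rs by rewrite map_f ?mem_enum.
have [Qr hr] := P1map_root (rP _ rrs).
have W : P^`() * Q = P * Q^`().
  apply/eqP; rewrite -subr_eq0 /P /Q !deriv_map -!rmorphM -rmorphB /= W0.
  by rewrite rmorph0.
have h0 : h != 0 := fiber_neq0 cop (etrans (congr1 _ dE) hd) (Some (tvar j)).
have h'r : root h^`() r.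
  have E : h^`() * Q = Q^`() * h.
    by rewrite /h derivB derivZ mulrBl W -scalerAl mulrBr -scalerAr [P * _]mulrC.
  have := congr1 (fun A : {poly M} => A.[r]) E.
  by rewrite !hornerM (eqP hr) mulr0 => /eqP; rewrite mulf_eq0 (negPf Qr) orbF.
have sep : separable_poly (\prod_(x <- rs) ('X - x%:P)) by rewrite separable_prod_XsubC.
have /negP : (\prod_(x <- rs) ('X - x%:P))^`().[r] != 0.
  by move: sep; rewrite separable_poly.unlock => /coprimep_root; apply; rewrite root_prod_XsubC.
apply; move: h'r; rewrite hE derivZ /root hornerZ mulf_eq0 => /orP[|//].
by rewrite lead_coef_eq0 (negPf h0).
Qed.

Lemma local_degree_tame (K F : fieldType) (i : {rmorphism K -> F}) (f : {fraction {poly K}}) :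
  (0 < ratdeg f)%N ->
  [pchar K] =i pred0 \/ (forall p : nat, p \in [pchar K] ->
     forall z : P1 F, crit i f z -> ~~ (p %| local_degree i f z)%N) ->
  forall y, (local_degree i f y)%:R != 0 :> F.
Proof.
move=> hd ht y; have [cy|ncy] := pselect (crit i f y); last by rewrite ld1 ?oner_neq0.
apply/negP => y0; have [p pF] := natf0_pchar (ld_gt0 i hd y) y0.
have pK : p \in [pchar K] by rewrite -(fmorph_pchar i).
case: ht => [/(_ p)|/(_ p pK y cy)]; first by rewrite pK.
by rewrite (dvdn_pcharf pF) y0.
Qed.

(* Away from the exceptional point, some [y] in the grand orbit relation [f^k y = f^k z] is
   unramified over up to height [m], with [k] bounded independently of [z]: for all but finitely
   many [z] one takes [y = z]. *)
Lemma unramified_witness (K F : fieldType) (e : {rmorphism K -> F}) (f : {fraction {poly K}}) m :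
  GRing.closed_field_axiom F -> (0 < ratdeg f)%N ->
  (numer f)^`() * denom f - numer f * (denom f)^`() != 0 ->
  (Upsilon e f #<= `I_1)%card ->
  exists J : nat, forall z, ~ Upsilon e f z -> exists k y,
    [/\ (k <= J)%N, iter k (ratmap e f) y = iter k (ratmap e f) z,
      (iter_ld f e k y %| iter_ld f e k z)%N &
      forall l y', (l <= m)%N -> iter l (ratmap e f) y' = y -> iter_ld f e l y' = 1%N].
Proof.
move=> clF hd W hU; have [cs csP] := crit_finite e hd W.
(* Images of critical points under at most [m] steps. Outside this finite list [k = 0] serves, so
   only finitely many [z] affect the bound. *)
pose B := flatten [seq [seq iter n (ratmap e f) c | c <- cs] | n <- iota 0 m.+1].
pose D J z := exists k y,
    [/\ (k <= J)%N, iter k (ratmap e f) y = iter k (ratmap e f) z,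
      (iter_ld f e k y %| iter_ld f e k z)%N &
      forall l y', (l <= m)%N -> iter l (ratmap e f) y' = y -> iter_ld f e l y' = 1%N].
have D_mono J J' z : (J <= J')%N -> D J z -> D J' z.
  by move=> JJ' [k [y [kJ *]]]; exists k, y; split=> //; exact: leq_trans kJ JJ'.
have ex z : ~ Upsilon e f z -> exists J, D J z.
  move=> nz; have [pz|npz] := pselect (postcrit e f z); last first.
    by exists 0%N, 0%N, z; split=> // l y' _; exact: iter_ld_npostcrit.
  have [k [y [_ yz ny dv]]] := nexceptional_witness clF hd hU pz nz.
  by exists k, k, y; split=> // l y' _; exact: iter_ld_npostcrit.
have [J JP] : exists J, forall z, z \in B -> ~ Upsilon e f z -> D J z.
  elim: (B) => [|z s [J IH]]; first by exists 0%N.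
  have [J' J'P] : exists J', ~ Upsilon e f z -> D J' z.
    by have [uz|/ex[J' ?]] := pselect (Upsilon e f z); [exists 0%N | exists J'].
  exists (maxn J J') => z'; rewrite inE => /orP[/eqP->|z's] nz'.
    by apply: D_mono (J'P nz'); rewrite leq_maxr.
  by apply: D_mono (IH _ z's nz'); rewrite leq_maxl.
exists J => z nz; have [zB|zB] := boolP (z \in B); first exact: JP.
exists 0%N, z; split=> // l y' lm y'z; apply: (iter_ld1 hd) => i il cy'.
move/negP: zB; apply; apply/flattenP.
exists [seq iter (l - i) (ratmap e f) c | c <- cs].
  by apply/mapP; exists (l - i)%N => //; rewrite mem_iota /= add0n ltnS (leq_trans (leq_subr _ _)).
apply/mapP; exists (iter i (ratmap e f) y'); first exact: csP.
by rewrite -iterD subnK ?y'z // ltnW.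
Qed.

(** * Mixing *)

Section Mixing.
Variables (K : fieldType) (f : {fraction {poly K}}) (L : fieldType)
  (iL : {rmorphism K -> L}) (M : fieldType)
  (j : {rmorphism {fraction {poly L}} -> M}) (hM : is_sep_closure j)
  (lam : labeling f iL j) (F : fieldType) (iO : {rmorphism L -> F}).
Hypotheses (clF : GRing.closed_field_axiom F) (hd : (0 < ratdeg f)%N)
  (piF : forall x : F, exists2 q, [pchar L].-nat q & exists c, x ^+ q = iO c)
  (tame : forall y, (local_degree (iO \o iL) f y)%:R != 0 :> F).
Local Notation d := (ratdeg f).
Local Notation t := (tvar j).
Local Notation fM := (ratmap (const_emb iL j) f).
Local Notation pt := (pt lam).
Local Notation G := (G_infty lam).
Local Notation gal := (gal_auto j).
Local Notation eK := (iO \o iL : {rmorphism K -> F}).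

Lemma iter_t k : exists x, iter k fM (Some t) = Some x.
Proof.
pose w : word d := nseq k (Ordinal hd); have [r [Lr _ rc]] := Lam_inv lam w.
exists (r t); have := ratmap_equivariant f iL rc k (Some (pt w)).
rewrite /= [r (pt w)]Lr => ->; have := pt_V lam w.
by rewrite /preimages /= size_nseq => ->.
Qed.

Let level_field m : {pred M} :=
  gen_subfield (range j `|` [set x | exists2 w, (size w <= m)%N & pt w = x]).
Let orbit_field k m tst : {pred M} := gen_subfield (range j `|`
        [set x | exists2 n, (n <= m + k)%N & iter n fM (Some x) = Some tst]).

(** A vertex at level [l] over [t] is at level [l + k] over [f^k(t)], and Galois automorphisms
    preserve levels. *)
Let gal_level_field k m tst (s : {rmorphism M -> M}) a : gal s ->
  iter k fM (Some t) = Some tst -> a \in level_field m -> s a \in orbit_field k m tst.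
Proof.
move=> gs tE /asboolP aS; set S := orbit_field k m tst.
have [S1 SB SV] : GRing.divring_closed S := gen_subfield_divring_closed _.
apply: (aS (fun x => s x \in S)).
  split=> [|x y xS yS|x y xS yS]; rewrite /= unfold_in /= ?rmorph1 ?rmorphB ?fmorph_div //.
    exact: SB.
  exact: SV.
move=> y [[c _ <-]|[w wm <-]]; rewrite unfold_in /=; apply/asboolP => k' _; apply.
  by left; exists c; rewrite // gs.
right; exists (size w + k)%N; first by rewrite leq_add2r.
have := gal_iter f iL gs (size w) (Some (pt w)).
rewrite [iter (size w) fM (Some (pt w))](pt_V lam w) /= (gal_t gs) addnC iterD => ->.
by [].
Qed.

Variables (z0 : P1 F) (m J : nat).
Hypothesis witness : forall z, z <> z0 -> exists k y,
  [/\ (k <= J)%N, iter k (ratmap eK f) y = iter k (ratmap eK f) z,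
    (iter_ld f eK k y %| iter_ld f eK k z)%N &
    forall l y', (l <= m)%N -> iter l (ratmap eK f) y' = y -> iter_ld f eK l y' = 1%N].
Hypothesis tr : forall k u w w', size w = k -> size w' = k ->
    exists2 h, level_stab G (size u) h & h (u ++ w) = u ++ w'.

(** The length required of [v] beyond [n] is [J]: the commutator is formed below the prefix of [v]
    of length [size v - k], which must still reach level [n]. *)
Lemma level_sections_full n v g : (n + J <= size v)%N -> G g ->
  exists2 h, level_sections G n v m h & forall w, (size w <= m)%N -> h w = g w.
Proof.
move=> nJv; apply: galois_correspondence => //.
- by move=> h [].
- exact: level_sections1 (G_infty_id lam) _ _ _.
- by move=> g1 g2; apply: level_sections_comp; [exact: G_comp | exact: G_size].
- by move=> g1 g2; apply: level_sections_inv; [exact: G_inv | exact: G_size].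
(* The tree over [f^k(t)] is needed to height [m + k], at most [m + J], and each level consumes one
   factor [tame_exp]. *)
move=> a aS afix; pose e := (tame_exp f F ^ (m + J))%N.
have eF : e%:R != 0 :> F by rewrite natrX expf_neq0 // tame_exp_neq0.
have e0 : (0 < e)%N by case: (e) eF => //; rewrite eqxx.
have [zeta zP] := prim_root_exists clF eF.
have ze := prim_expr_order zP.
have zeta0 : zeta != 0.
  by apply/eqP => z'; move/eqP: ze; rewrite z' expr0n eqn0Ngt e0 eq_sym oner_eq0.
have [tau tz] := lau_rot_exists zeta0.
have [io [th [ioC ioX thC [th_fin th_inf] th_pt]]] := coordinate_places iO z0 clF e0.
have io_pi := purely_inseparable_frac (@frac_polyP F) piF ioC ioX.
have tau_th z x : tau (th z x) = th z x.
  exact: (rot_fixes_th (@frac_polyP F) thC th_fin th_inf _ _ ze tz).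
apply: (trivial_cover hM clF (@tofrac_eq0 _) (@frac_polyP F) io_pi e0 eF thC th_fin th_inf zP tz).
move=> z; have [y [zy yz0]] := th_pt z.
have thio c : (th z \o io) (tofrac c%:P) = lauC (iO c) by rewrite /= ioC thC.
have tau_io x : tau ((th z \o io) x) = (th z \o io) x by exact: tau_th.
have place k : (k <= J)%N -> (tame_exp f F ^ (m + k) %| e)%N.
  by move=> kJ; rewrite dvdn_exp2l // leq_add2l.
(* At infinity, that is over [z0], no witness is assumed. There [tau] only has to permute the
   conjugates, for which the tree over [t] itself suffices. *)
case: z y zy yz0 thio tau_io => [c|] y zy yz0 thio tau_io; last first.
  have [D [i [k1 [k2 [s [k1E k2E gs sP _]]]]]] := @place_data _ _ _ _ _ _ hM lam _ _ clF hd tame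
    y e zeta tau (th None \o io) 0 (m + 0) zP tz thio tau_io zy (place 0%N isT) t erefl.
  have sP' s' := fun gs' => sP _ (@gal_level_field 0 m t s' a gs' erefl aS).
  exists D, i, k1, k2; split=> // s'.
    by move=> /sP'[b [_ [bx _ _]]]; exists b.
  move=> b gs' bE; have [b0 [b' [b0E b's b't]]] := sP' _ gs'.
  exists (s \o s'), b'; split; [exact: gal_comp | exact: b's |].
  by rewrite b't; congr (tau (k2 _)); apply: (fmorph_inj k1); rewrite bE b0E.
have [k [y' [kJ y'y dv ur]]] := witness (yz0 ltac:(done)).
have [tst tE] := iter_t k.
have [D [i [k1 [k2 [s [k1E k2E gs sP vert]]]]]] := @place_data _ _ _ _ _ _ hM lam _ _ clF hd tame
    y e zeta tau (th (Some c) \o io) k (m + k) zP tz thio tau_io zy (place k kJ) tst tE.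
have sP' s' := fun gs' => sP _ (@gal_level_field k m tst s' a gs' tE aS).
have km : (k + m <= m + k)%N by rewrite addnC.
have [s1 s1E s1fix] := vert k y' m km y'y dv ur.
have [g0 sg0] := acts_exists lam gs.
have Hg0 : level_sections G n v m g0.
  apply: (section_of_fixed_vertex (k := k) hM tr gs sg0 _ s1fix); first by rewrite s1E tE.
  by rewrite (leq_trans _ nJv) // leq_add2l.
(* Normality: the conjugate of [s] by [s'] still acts through [level_sections], so it fixes [a], and
   [s] fixes [s' a]. *)
have sfix s' : gal s' -> s (s' a) = s' a.
  move=> gs'; have [r [s'r rs' gr]] := sep_closure_aut_inv hM gs'.
  have [g1 sg1] := acts_exists lam gs'; have [g2 rg2] := acts_exists lam gr.
  have GI r0 h : gal r0 -> acts_by lam r0 h -> G h by move=> ? ?; apply/(G_inftyP hM); exists r0.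
  have : (r \o (s \o s')) a = a.
    apply: (afix _ (g2 \o g0 \o g1)).
    - by do 2!apply: gal_comp => //.
    - exact: (acts_comp rg2 (acts_comp sg0 sg1)).
    have g21 : cancel g2 g1 := acts_cancel rg2 sg1 rs'.
    have g12 : cancel g1 g2 := acts_cancel sg1 rg2 s'r.
    have := level_sections_conj (G_infty_id lam) (G_comp hM (lam := lam)) (G_inv hM (lam := lam))
      (G_size hM (lam := lam)) (G_lift hM (lam := lam)) (GI _ _ gr rg2) (GI _ _ gs' sg1) g21 g12 Hg0.
    exact.
  by move=> /(congr1 s') /=; rewrite rs'.
exists D, i, k1, k2; split=> // s'.
  by move=> /sP'[b [_ [bx _ _]]]; exists b.
move=> b gs' bE; have [b0 [b' [b0E b's b't]]] := sP' _ gs'.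
have -> : b = b0 by apply: (fmorph_inj k1); rewrite bE b0E.
by rewrite -b't; congr (k2 _); apply: (fmorph_inj k1); rewrite b's b0E sfix.
Qed.
End Mixing.

Theorem theoremE (R : realType) (K : fieldType) (f : {fraction {poly K}})
    (hd : (2 <= ratdeg f)%N)
    (L : fieldType) (iL : {rmorphism K -> L}) (hL : is_sep_closure iL)
    (Om : fieldType) (iO : {rmorphism L -> Om}) (hO : is_alg_closure iO)
    (htame : [pchar K]%R =i pred0 \/
       forall p : nat, p \in [pchar K]%R ->
         forall z : P1 Om, crit (iO \o iL) f z ->
           ~~ (p %| local_degree (iO \o iL) f z)%N)
    (M : fieldType) (j : {rmorphism {fraction {poly L}} -> M})
    (hM : is_sep_closure j)
    (lam : labeling f iL j)
    (mu : probability (borel_group (G_infty_id lam)) R) (hmu : is_haar mu)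
    (hmart : is_martingale mu (@fixed_points R _ _ (G_infty_id lam)))
    (hUps : (Upsilon (iO \o iL) f #<= `I_1)%card) :
  mixing (G_infty lam).
Proof.
have d0 : (0 < ratdeg f)%N := ltnW hd.
have [algO clF] := hO.
have piF x : exists2 q, [pchar L].-nat q & exists c, x ^+ q = iO c.
  by have [q [qL qE]] := root_purely_inseparable hL.2 (algO x); exists q.
have tame := local_degree_tame d0 htame.
have [GS Gtr GV] := G_fractal hM lam.
(* The martingale starts at level one; the children of the root are permuted transitively by [G],
   which fixes level zero. *)
have children n v x y : size v = n ->
    exists2 h, level_stab (G_infty lam) n h & h (rcons v x) = rcons v y.
  case: n => [|n] vn; last first.
    exact: (martingale_transitive (G_comp hM (lam := lam)) (G_inv hM (lam := lam))
      (G_size hM (lam := lam)) (G_cat hM (lam := lam)) hmu hmart x y (ltn0Sn n) vn).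
  rewrite (size0nil vn); have [|g Gg gE] := Gtr [:: x] [:: y]; first by [].
  exists g => //; split=> // u u0; rewrite (size0nil u0).
  by apply/nilP; rewrite /nilp (G_size hM (lam := lam) _ Gg).
have tr := level_stab_transitive (G_infty_id lam) (G_comp hM (lam := lam))
  (G_size hM (lam := lam)) (G_cat hM (lam := lam)) children.
have W := wronskian_neq0 lam d0.
split; first exact: G_fractal.
  by move=> n u un k _ w w' wk w'k; exact: (tr k).
(* Without an exceptional point, infinity is taken. *)
have [z0 z0P] : exists z0, forall z, z <> z0 -> ~ Upsilon (iO \o iL) f z.
  have [[z0 uz0]|nU] := pselect (exists z, Upsilon (iO \o iL) f z).
    by exists z0 => z zz0 uz; apply: zz0; exact: (card_le1_eq hUps uz uz0).
  by exists None => z _ uz; apply: nU; exists z.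
(* [N m] is the uniform bound on [k] for height [m]; it does not involve [n]. *)
have /choice[N NP] := fun m => unramified_witness m clF d0 W hUps.
exists N => n m _ _ v nv; apply/seteqP; split=> x [g].
  move=> [[Gg gn] gv] <-; exists (section g v) => //; exact: GS.
move=> Gg <-.
have [h [Gh [h' hh' h'E]] hg] := @level_sections_full _ f _ iL _ j hM lam _ iO clF d0 piF tame z0 m
  (N m) (fun z zz0 => NP m z (z0P z zz0)) (fun k u w w' => tr k (size u) u w w' erefl) n v g nv Gg.
exists h' => //; apply: funext => w; rewrite /pi_level /section h'E ?size_bseq //.
by rewrite drop_size_cat // hg // size_bseq.
Qed.
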